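(* Let $M=\bigoplus_{i\in I}Am_i$ be a free $A$-supermodule where $I=\mathbb Z$ or $I=\tfrac12\mathbb Z$, with $m_i$ even for $i\in\mathbb Z$ and odd for $i\in\tfrac12+\mathbb Z$, and let $q$ be the $A$-quadratic form on $M$ defined by $q(m_i,m_j)=(-1)^i\delta_{i,-j}$ for $i,j\in\mathbb Z$; $q(m_i,m_j)=(-1)^{i+\frac12}\delta_{i,-j}$ for $i,j\in\tfrac12+\mathbb Z$; and $q(m_i,m_j)=0$ for $i\in\mathbb Z$, $j\in\tfrac12+\mathbb Z$. Let $\operatorname{osp_{fd}}(q)$ be the set of all $A$-endomorphisms $(a_{ij})$ in $\operatorname{osp}(q)$ of $M$ which have finitely many nonzero diagonals, and let $\mathcal E=\operatorname{osp_{fd}}(q)$. If the nonzero elements of $\mathbb Z$ are invertible in $A$, then $\operatorname{osp_{fd}}(q)$ is self-normalizing in $\operatorname{osp}(q)$ and $$\operatorname{Der}_K\mathcal E_\infty=\operatorname{ad}(\mathcal E_\infty)\rtimes\{d_{S,0}: S\in(\operatorname{Der}_KA)_M\}.$$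
   Context: Conventions. All structures are $\mathbb Z_2$-graded; $|z|$ is the degree of a homogeneous element $z$, and formulas involving $|z|$ are for homogeneous elements, extended linearly. $K$ is a unital associative superring containing $\tfrac12$ that is supercommutative: $ab=(-1)^{|a||b|}ba$. A $K$-supermodule is a $K$-bimodule $M=M_{\bar0}\oplus M_{\bar1}$ with $K_\alpha M_\beta\subset M_{\alpha+\beta}$ and $am=(-1)^{|a||m|}ma$. A map $\phi$ is $K$-linear if additive with $\phi(ma)=\phi(m)a$. Bilinear means biadditive with $\phi(ma,n)=\phi(m,an)$, $\phi(m,na)=\phi(m,n)a$. For endomorphisms, $[x,y]=xy-(-1)^{|x||y|}yx$. $A$ is a superextension of $K$: a unital associative supercommutative $K$-superalgebra. An $A$-quadratic form on $M$ is an $A$-bilinear $q:M\times M\to A$ of degree $\bar0$ with $q(m,n)=(-1)^{|m||n|}q(n,m)$. $\operatorname{osp}(q)=\{x\in\operatorname{End}_A M: q(x(m),n)+(-1)^{|m||n|}q(x(n),m)=0\ \forall m,n\}$. $\mathbf E_{m,n}(p)=m\,q(n,p)-(-1)^{|n||p|}q(m,p)n$. Endomorphisms of $M$ are written as matrices $(a_{ij})_{i,j\in I}$ with respect to the basis $\{m_i\}$; the diagonals are the sets of entries with $i-j$ constant. Self-normalizing means that $x\in\operatorname{osp}(q)$ and $[x,\mathcal E]\subset\mathcal E$ imply $x\in\mathcal E$. $\mathcal E_\infty=\{(a,m,n,x): a\in A,\ m,n\in M,\ x\in\mathcal E\}$ is the Lie superalgebra with product $[(a,m,n,x),(a',m',n',x')]=\big(q(m,n')-q(n,m'),\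 am'+xm'-ma'-(-1)^{|x'||m|}x'm,\ -an'+xn'+na'-(-1)^{|x'||n|}x'n,\ \mathbf E_{m,n'}+\mathbf E_{n,m'}+[x,x']\big)$. $\operatorname{Der}_K$: spanned by homogeneous $K$-linear $d$ with $d(xy)=d(x)y+(-1)^{|d||x|}x\,d(y)$; $\operatorname{ad}(x)(y)=[x,y]$; $X\rtimes Y$ means a direct sum of an ideal $X$ and a subalgebra $Y$. For $\Delta\in\operatorname{Der}_KA$, $\Delta_M\in\operatorname{End}_KM$ is given by $\Delta_M(\sum_i a_im_i)=\sum_i\big(\tfrac12\Delta(q(m_i,m_{-i}))q(m_i,m_{-i})^{-1}a_i+\Delta(a_i)\big)m_i$, and $(\operatorname{Der}_KA)_M=\{\Delta_M\}$. For $S\in(\operatorname{Der}_KA)_M$, $d_{S,0}$ is the endomorphism $d_{S,0}(a,m,n,x)=([S,a\,\mathrm{Id}],S(m),S(n),[S,x])$ of $\mathcal E_\infty$, where $A$ is identified with $A\cdot\mathrm{Id}$. *)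

(* Defs.v *)
From HB Require Import structures.
From mathcomp Require Import all_boot all_order all_algebra.
From mathcomp Require Import all_classical.

Set Implicit Arguments.
Unset Strict Implicit.
Unset Printing Implicit Defensive.
Import Order.TTheory GRing.Theory Num.Theory.
Local Open Scope classical_set_scope.
Local Open Scope ring_scope.

(* Degrees are booleans ([false] even, [true] odd), added with [(+)] and
   multiplied with [&&]. A decomposition V = V_0 (+) V_1 is given by its two
   projections [g b : V -> V_b]; z is homogeneous of degree b when g b z = z.
   A formula in homogeneous elements is extended linearly by summing it over
   the components of its arguments. *)
Record grading (V : zmodType) := Grading {
  part :> bool -> V -> V;
  partB : forall b x y, part b (x - y) = part b x - part b y;
  part_part : forall b c x, part b (part c x) = if b == c then part c x else 0;
  part_sum : forall x, part false x + part true x = x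
}.

Definition homog (T : Type) (p : bool -> T -> T) (b : bool) (z : T) : Prop :=
  p b z = z.

(* koszul b c x = (-1)^(b c) x *)
Definition koszul (V : zmodType) (b c : bool) (x : V) : V :=
  if b && c then - x else x.

Definition superring (R : pzRingType) (g : grading R) : Prop :=
  forall b c x y, homog g b x -> homog g c y -> homog g (b (+) c) (x * y).

Definition supercommutative (R : pzRingType) (g : grading R) : Prop :=
  forall b c x y, homog g b x -> homog g c y -> x * y = koszul b c (y * x).

Definition supermodule (R : pzRingType) (gR : grading R)
    (M : lmodType R) (gM : grading M) : Prop :=
  forall b c a v, homog gR b a -> homog gM c v -> homog gM (b (+) c) (a *: v).

(* The right action of a supermodule is determined by the left action [la]:
   v a = (-1)^(|a||v|) a v. *)
Definition ract (R : Type) (gR : bool -> R -> R) (V : zmodType)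
    (gV : bool -> V -> V) (la : R -> V -> V) (v : V) (a : R) : V :=
  \sum_(b : bool) \sum_(c : bool) koszul b c (la (gR b a) (gV c v)).

(* The component of degree b of an endomorphism, and the supercommutator. *)
Definition epart (V : zmodType) (p : bool -> V -> V) (b : bool) (f : V -> V) :
    V -> V :=
  fun z => \sum_(c : bool) p (b (+) c) (f (p c z)).

Definition sbr (V : zmodType) (p : bool -> V -> V) (f g : V -> V) : V -> V :=
  fun z => \sum_(b : bool) \sum_(c : bool)
    (epart p b f (epart p c g z) - koszul b c (epart p c g (epart p b f z))).

Definition inverse_of (R : pzRingType) (x : R) : set R :=
  [set y | x * y = 1 /\ y * x = 1].

Definition rinv (R : pzRingType) (x : R) : R := xget 0 (inverse_of x).

(* Derivations of a K-superalgebra L. The underlying supermodule of L is a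
   subset of an additive group T, and the component maps [p], the left
   K-action [la] and the product [mul] are defined on T. A map L -> L is
   represented by any map T -> T which restricts to it: the conditions below
   only involve values on L, and equality of maps is equality on L. *)
Section Derivations.
Variables (K : Type) (gK : bool -> K -> K).
Variables (T : zmodType) (p : bool -> T -> T) (la : K -> T -> T).
Variables (mul : T -> T -> T) (L : set T).

Definition hder (b : bool) (d : T -> T) : Prop :=
  [/\ forall x, L x -> L (d x),
      forall x y, L x -> L y -> d (x + y) = d x + d y,
      forall x k, L x -> d (ract gK p la x k) = ract gK p la (d x) k,
      forall c x, L x -> homog p c x -> homog p (b (+) c) (d x) &
      forall c x y, L x -> L y -> homog p c x ->
        d (mul x y) = mul (d x) y + koszul b c (mul x (d y))].

Definition Der : set (T -> T) :=
  [set d | exists d0 d1, [/\ hder false d0, hder true d1 &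
     forall x, L x -> d x = d0 x + d1 x]].

Definition adset : set (T -> T) :=
  [set d | exists2 y, L y & forall x, L x -> d x = mul y x].

Definition subsupermodule (X : set (T -> T)) : Prop :=
  [/\ X (fun=> 0),
      forall d e, X d -> X e -> X (fun z => d z - e z),
      forall k d, X d -> X (fun z => la k (d z)) &
      forall b d, X d -> X (epart p b d)].

(* Z = X >< Y inside the Lie superalgebra of endomorphisms of L *)
Definition semidirect (Z X Y : set (T -> T)) : Prop :=
  [/\ subsupermodule X /\ subsupermodule Y,
      Z = [set d | exists d1 d2, [/\ X d1, Y d2 &
             forall x, L x -> d x = d1 x + d2 x]],
      forall d, X d -> Y d -> forall x, L x -> d x = 0,
      forall d e, Z d -> X e -> X (sbr p d e) &
      forall d e, Y d -> Y e -> Y (sbr p d e)].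

End Derivations.

Definition Zidx : set rat := [set i | i \is a Num.int].
Definition halfZidx : set rat := [set i | i *+ 2 \is a Num.int].
Definition oddidx : set rat := [set i | i + 2^-1 \is a Num.int].

Section Osp.
Variables (A : pzRingType) (gA : grading A).
Variables (M : lmodType A) (gM : grading M).
Variables (I : set rat) (m : rat -> M) (q : M -> M -> A).

Local Notation "v <* a" := (ract gA gM (fun b w => b *: w) v a)
  (at level 40, left associativity).

Definition expansion (v : M) (c : rat -> A) : Prop :=
  [/\ finite_set [set i | c i != 0], [set i | c i != 0] `<=` I &
      v = \sum_(i \in I) c i *: m i].

(* The values of m outside I are irrelevant. *)
Definition homog_basis : Prop :=
  [/\ forall v, exists! c, expansion v c,
      forall i, I i -> Zidx i -> homog gM false (m i) &
      forall i, I i -> oddidx i -> homog gM true (m i)].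

Definition coord (v : M) : rat -> A := xget (fun=> 0) (expansion v).

Definition quadratic_form : Prop :=
  [/\ (forall u v w, q (u + v) w = q u w + q v w) /\
      (forall u v w, q u (v + w) = q u v + q u w),
      forall u v a, q (u <* a) v = q u (a *: v),
      forall u v a, q u (v <* a) = q u v * a,
      forall b c u v, homog gM b u -> homog gM c v ->
        homog gA (b (+) c) (q u v) &
      forall b c u v, homog gM b u -> homog gM c v ->
        q u v = koszul b c (q v u)].

(* Num.floor turns the integral indices i and i + 1/2 into elements of int. *)
Definition standard_values : Prop :=
  [/\ forall i j, I i -> I j -> Zidx i -> Zidx j ->
        q (m i) (m j) = if i == - j then (-1) ^+ `|Num.floor i|%N else 0,
      forall i j, I i -> I j -> oddidx i -> oddidx j ->
        q (m i) (m j) =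
          if i == - j then (-1) ^+ `|Num.floor (i + 2^-1)|%N else 0 &
      forall i j, I i -> I j -> Zidx i -> oddidx j -> q (m i) (m j) = 0].

Definition EndA (x : M -> M) : Prop :=
  (forall u v, x (u + v) = x u + x v) /\
  (forall v a, x (v <* a) = x v <* a).

Definition osp : set (M -> M) :=
  [set x | EndA x /\ forall b c u v, homog gM b u -> homog gM c v ->
     q (x u) v + koszul b c (q (x v) u) = 0].

(* The matrix entry a_ij of x is the coordinate of x(m_j) at m_i; D is a
   finite list of values i - j. *)
Definition osp_fd : set (M -> M) :=
  [set x | osp x /\ exists D : seq rat, forall i j, I i -> I j ->
     coord (x (m j)) i != 0 -> i - j \in D].

Definition self_normalizing (E : set (M -> M)) : Prop :=
  forall x, osp x -> (forall y, E y -> E (sbr gM x y)) -> E x.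

Definition opE (u v w : M) : M :=
  \sum_(b : bool) \sum_(c : bool)
    (u <* q (gM b v) (gM c w) - koszul b c (q u (gM c w) *: gM b v)).

(* [signed_app x v] extends (-1)^(|x||v|) x v *)
Definition signed_app (x : M -> M) (v : M) : M :=
  \sum_(b : bool) \sum_(c : bool) koszul b c (epart gM b x (gM c v)).

(* The ambient additive group of E_oo; (a, u, v, x) lies in E_oo if x is in
   E. *)
Definition Tinf : zmodType := (A * M * M * (M -> M))%type.

Definition Einf (E : set (M -> M)) : set Tinf := [set z | E z.2].

Definition Einf_part (b : bool) (z : Tinf) : Tinf :=
  let: (a, u, v, x) := z in (gA b a, gM b u, gM b v, epart gM b x).

Definition Einf_mul (z z' : Tinf) : Tinf :=
  let: (a, u, v, x) := z in let: (a', u', v', x') := z' in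
  (q u v' - q v u',
   a *: u' + x u' - u <* a' - signed_app x' u,
   - (a *: v') + x v' + v <* a' - signed_app x' v,
   fun w => opE u v' w + opE v u' w + sbr gM x x' w).

Definition Delta_M (Delta : A -> A) (v : M) : M :=
  \sum_(i \in I)
    (rinv 2%:R * Delta (q (m i) (m (- i))) * rinv (q (m i) (m (- i)))
       * coord v i + Delta (coord v i)) *: m i.

(* inverse of a |-> a Id, which is injective on A since M is free *)
Definition unscalar (f : M -> M) : A := xget 0 [set b | f = fun v => b *: v].

Definition dS0 (S : M -> M) (z : Tinf) : Tinf :=
  let: (a, u, v, x) := z in
  (unscalar (sbr gM S (fun w => a *: w)), S u, S v, sbr gM S x).

(* K acts on A and on E_oo through the structure map K -> A. *)
Variables (K : pzRingType) (gK : grading K) (iota : {rmorphism K -> A}).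

Definition actA (k : K) (a : A) : A := iota k * a.

Definition Einf_act (k : K) (z : Tinf) : Tinf :=
  let: (a, u, v, x) := z in
  (iota k * a, iota k *: u, iota k *: v, fun w => iota k *: x w).

Definition DerA : set (A -> A) := Der gK gA actA *%R setT.

Definition DerA_M : set (M -> M) := [set Delta_M Delta | Delta in DerA].

Definition DerEinf (E : set (M -> M)) : set (Tinf -> Tinf) :=
  Der gK Einf_part Einf_act Einf_mul (Einf E).

Definition adEinf (E : set (M -> M)) : set (Tinf -> Tinf) :=
  adset Einf_mul (Einf E).

Definition dSset (E : set (M -> M)) : set (Tinf -> Tinf) :=
  [set d | exists2 S, DerA_M S & forall z, Einf E z -> d z = dS0 S z].

End Osp.

(* A unital K-superalgebra structure on a supercommutative superring A is a
   degree-preserving unital ring morphism k |-> k 1. *)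
Definition superextension (K : pzRingType) (gK : grading K)
    (A : pzRingType) (gA : grading A) (iota : {rmorphism K -> A}) : Prop :=
  [/\ superring gA, supercommutative gA &
      forall b k, homog gK b k -> homog gA b (iota k)].

(* Main.v *)
Require Import Defs.
From HB Require Import structures.
From mathcomp Require Import all_boot all_order all_algebra.
From mathcomp Require Import all_classical.

(** The Lie superalgebra [E_oo] is graded by the eigenvalues 1, 0, -1 of the
    bracket with [hgrad = (1, 0, 0, 0)], and the proof rests on this grading.

    Let [d] be a homogeneous derivation. Subtracting an inner derivation removes
    the part of [d hgrad] in the two copies of [M]. Applying [d] to the
    eigenvalue equations of [hgrad] then shows, 2 being invertible, that [d]
    kills [hgrad] and so preserves the grading ([deriv_hgrad0]): it is given by
    maps [S] and [S'] on the two copies of [M] and by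
    [(a, 0, 0, x) |-> (f a + g x, 0, 0, F a + H x)]. The product rule relates
    these maps. [F a] commutes with [E], whose center is trivial ([E_center]), so
    [F = 0]; hence [f] is a derivation of [A] over which [S] and [S'] are
    semilinear. The difference [S - S'] commutes with [E] up to scalars, so it is
    a scalar [r] ([central_scalar]), and [g = 0]. What remains of [S] after
    subtracting [r / 2] and the coordinatewise extension of [f] is an [A]-linear
    map [X] of [osp q] which normalizes [E], hence lies in [E] by
    self-normalization, and [d] is the sum of [ad (r / 2, 0, 0, X)] and of the
    extension of [f] ([decompose_hgrad0]).

    [E] is self-normalizing ([E_self_normalizing]) because it contains the degree
    operator [m_i |-> 2 i m_i]: the bracket of [x = (a_ij)] with it has entries
    [2 (j - i) a_ij], so it has as many nonzero diagonals as [x], up to the main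
    one.

    Conversely, inner maps are derivations by the Jacobi identity, which is
    checked for each of the four components of the first factor ([hder_ad]). The
    component in [E] and the scalar derivations are handled together: both act
    through a map of [M] which is semilinear over a derivation of [A] and leaves
    [q] invariant ([semiskew], [leibniz_extend]), derivations of [A] having this
    property because they kill the values of [q] on the basis, which are signs
    or 0. The two copies of [M] are exchanged by the automorphism [flip].

    All identities are additive, which reduces them to homogeneous arguments. The
    signs then depend on finitely many parities; for each value of these an
    equality between sums in an abelian group is left to the tactic [zmod]. *)

Set Implicit Arguments.
Unset Strict Implicit.
Unset Printing Implicit Defensive.
Import Order.TTheory GRing.Theory Num.Theory.
Local Open Scope classical_set_scope.
Local Open Scope ring_scope.

(** * Equality of sums in an abelian group *)

(** [zmod] proves an equality between two expressions built with [+], [-] and 0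
    by comparing the integer coefficients of their atoms. *)
Inductive zexp :=
  | ZVar of nat | ZAdd of zexp & zexp | ZOpp of zexp | ZZero.

Fixpoint zeval (V : zmodType) (env : seq V) (e : zexp) : V :=
  match e with
  | ZVar n => env`_n
  | ZAdd e1 e2 => zeval env e1 + zeval env e2
  | ZOpp e1 => - zeval env e1
  | ZZero => 0
  end.

Fixpoint zcoef (e : zexp) (n : nat) : int :=
  match e with
  | ZVar k => (if k == n then 1 else 0)%Z
  | ZAdd e1 e2 => zcoef e1 n + zcoef e2 n
  | ZOpp e1 => - zcoef e1 n
  | ZZero => 0
  end.

Fixpoint zbound (e : zexp) (n : nat) : bool :=
  match e with
  | ZVar k => (k < n)%N
  | ZAdd e1 e2 => zbound e1 n && zbound e2 n
  | ZOpp e1 => zbound e1 n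
  | ZZero => true
  end.

Lemma zevalE (V : zmodType) (env : seq V) e : zbound e (size env) ->
  zeval env e = \sum_(i < size env) env`_i *~ zcoef e i.
Proof.
elim: e => [k|e1 IH1 e2 IH2|e1 IH1|] /=.
- move=> kb; rewrite (bigD1 (Ordinal kb)) //= eqxx mulr1z big1 ?addr0 // => i.
  rewrite -val_eqE /= eq_sym => /negPf->; by rewrite mulr0z.
- move=> /andP[b1 b2]; rewrite IH1 // IH2 // -big_split /=.
  by apply: eq_bigr => i _; rewrite mulrzDr.
- by move=> b; rewrite IH1 // -sumrN; apply: eq_bigr => i _; rewrite mulrNz.
- by move=> _; rewrite big1 // => i _; rewrite mulr0z.
Qed.

Lemma zeval_eq (V : zmodType) (env : seq V) e1 e2 :
    [&& zbound e1 (size env), zbound e2 (size env) &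
      all (fun n => zcoef e1 n == zcoef e2 n) (iota 0 (size env))] ->
  zeval env e1 = zeval env e2.
Proof.
case/and3P=> b1 b2 /allP eqc; rewrite !zevalE //.
by apply: eq_bigr => i _; rewrite (eqP (eqc i _)) // mem_iota /=.
Qed.

(* Atoms are compared up to conversion, since the same subterm may occur with
   different but convertible instances of its structures. *)
Ltac zatom t env :=
  lazymatch env with
  | nil => constr:((0%N, cons t nil))
  | cons ?h ?tl =>
    match goal with
    | _ => let _ := match goal with _ => first [constr_eq h t | unify h t] end in
           constr:((0%N, env))
    | _ => lazymatch zatom t tl with (?n, ?tl') => constr:((S n, cons h tl')) end
    end
  end.

Ltac zreify t env :=
  lazymatch t with
  | (?a + ?b)%R =>
    lazymatch zreify a env with (?ea, ?env1) =>
    lazymatch zreify b env1 with (?eb, ?env2) => constr:((ZAdd ea eb, env2)) end end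
  | (- ?a)%R => lazymatch zreify a env with (?ea, ?env1) => constr:((ZOpp ea, env1)) end
  | (0)%R => constr:((ZZero, env))
  | _ => lazymatch zatom t env with (?n, ?env1) => constr:((ZVar n, env1)) end
  end.

Ltac zmod :=
  lazymatch goal with
  | |- @eq ?V ?a ?b =>
    lazymatch zreify a (@nil V) with (?ea, ?env1) =>
    lazymatch zreify b env1 with (?eb, ?env2) =>
      apply: (@zeval_eq _ env2 ea eb); vm_compute; reflexivity
    end end
  end.

(** * Graded subgroups and homogeneous maps *)

Lemma addrr_eq (V : zmodType) (x : V) : x = x + x -> x = 0.
Proof. by move/eqP; rewrite -subr_eq subrr => /eqP. Qed.

Lemma koszulB (V : zmodType) b c (x y : V) :
  koszul b c (x - y) = koszul b c x - koszul b c y.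
Proof. by rewrite /koszul; case: (b && c) => //; zmod. Qed.

Lemma koszulD (V : zmodType) b c (x y : V) :
  koszul b c (x + y) = koszul b c x + koszul b c y.
Proof. by rewrite /koszul; case: (b && c) => //; zmod. Qed.

Lemma koszul0 (V : zmodType) b c : koszul b c 0 = 0 :> V.
Proof. by rewrite /koszul; case: (b && c); rewrite ?oppr0. Qed.

Lemma koszulK (V : zmodType) b c (x : V) : koszul b c (koszul b c x) = x.
Proof. by rewrite /koszul; case: (b && c); rewrite ?opprK. Qed.

Lemma koszulf (V : zmodType) b (x : V) : koszul b false x = x.
Proof. by rewrite /koszul andbF. Qed.

Lemma koszul_scale (R : pzRingType) (V : lmodType R) b c (a : R) (x : V) :
  koszul b c (a *: x) = a *: koszul b c x.
Proof. by rewrite /koszul; case: (b && c); rewrite ?scalerN. Qed.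

(** The functions [M -> M], which are one component of the carrier of [E_oo], are
    the sum of their two parts only when they are additive. This is why the
    decomposition is required on a subset [L]. *)
Record graded (T : zmodType) (p : bool -> T -> T) (L : set T) : Prop := Graded {
  graded0 : L 0;
  gradedB : forall x y, L x -> L y -> L (x - y);
  graded_part : forall b x, L x -> L (p b x);
  graded_partB : forall b x y, L x -> L y -> p b (x - y) = p b x - p b y;
  graded_pp : forall b c x, L x -> p b (p c x) = if b == c then p c x else 0;
  graded_sum : forall x, L x -> p false x + p true x = x
}.

Lemma grading_graded (V : zmodType) (g : grading V) : graded g setT.
Proof.
by split=> // *; rewrite ?(partB, part_part, part_sum).
Qed.

Record hmap (T : zmodType) (p : bool -> T -> T) (L : set T) (b : bool)
    (f : T -> T) : Prop := Hmap {
  hmapL : forall x, L x -> L (f x);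
  hmapD : forall x y, L x -> L y -> f (x + y) = f x + f y;
  hmap_homog : forall c x, L x -> homog p c x -> homog p (b (+) c) (f x)
}.

Section Graded.
Variables (T : zmodType) (p : bool -> T -> T) (L : set T).
Hypothesis G : graded p L.
Implicit Types (b c : bool) (x y z : T) (f g : T -> T).

Lemma gradedN x : L x -> L (- x).
Proof. by move=> Lx; rewrite -[- x]add0r; apply: (gradedB G (graded0 G) Lx). Qed.

Lemma gradedD x y : L x -> L y -> L (x + y).
Proof. by move=> Lx /gradedN /(gradedB G Lx); rewrite opprK. Qed.

Lemma graded_part0 b : p b 0 = 0.
Proof. by have := graded_partB G b (graded0 G) (graded0 G); rewrite subr0 subrr. Qed.

Lemma graded_partN b x : L x -> p b (- x) = - p b x.
Proof.
by move=> Lx; rewrite -[- x]add0r (graded_partB G) ?graded_part0 ?add0r //;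
  exact: (graded0 G).
Qed.

Lemma graded_partD b x y : L x -> L y -> p b (x + y) = p b x + p b y.
Proof.
move=> Lx Ly; rewrite -{1}[y]opprK (graded_partB G) ?graded_partN ?opprK //.
exact: gradedN.
Qed.

Lemma homog_part b x : L x -> homog p b (p b x).
Proof. by move=> Lx; rewrite /homog (graded_pp G) ?eqxx. Qed.

Lemma homog_partE b c x : L x -> homog p c x -> p b x = if b == c then x else 0.
Proof.
move=> Lx hx; rewrite -[in LHS]hx (graded_pp G) //.
by case: ifP => // _; rewrite hx.
Qed.

Lemma homogD b x y : L x -> L y -> homog p b x -> homog p b y ->
  homog p b (x + y).
Proof. by move=> Lx Ly hx hy; rewrite /homog graded_partD // hx hy. Qed.

Lemma homogN b x : L x -> homog p b x -> homog p b (- x).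
Proof. by move=> Lx hx; rewrite /homog graded_partN // hx. Qed.

Lemma homogB b x y : L x -> L y -> homog p b x -> homog p b y ->
  homog p b (x - y).
Proof. by move=> Lx Ly hx hy; rewrite /homog (graded_partB G) // hx hy. Qed.

Lemma homog0 b : homog p b 0.
Proof. exact: graded_part0. Qed.

Lemma homog_koszul b c e x : L x -> homog p b x -> homog p b (koszul c e x).
Proof. by rewrite /koszul; case: ifP => // _; exact: homogN. Qed.

Lemma koszul_mem b c x : L x -> L (koszul b c x).
Proof. by rewrite /koszul; case: ifP => // _; exact: gradedN. Qed.

Lemma graded_ind (P : T -> Prop) :
  (forall x y, L x -> L y -> P x -> P y -> P (x + y)) ->
  (forall b x, L x -> homog p b x -> P x) -> forall x, L x -> P x.
Proof.
move=> PD Ph x Lx; rewrite -(graded_sum G Lx).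
have Lp b : L (p b x) by apply: (graded_part G _ Lx).
by apply: PD => //; apply: (Ph _ _ (Lp _)); exact: homog_part.
Qed.

Lemma additive_on0 f : (forall x y, L x -> L y -> f (x + y) = f x + f y) ->
  f 0 = 0.
Proof.
by move=> fD; have := fD _ _ (graded0 G) (graded0 G); rewrite addr0 => /addrr_eq.
Qed.

Lemma hmap0 b f : hmap p L b f -> f 0 = 0.
Proof. by case=> _ fD _; exact: additive_on0. Qed.

Lemma hmapN b f x : hmap p L b f -> L x -> f (- x) = - f x.
Proof.
move=> hf Lx; apply/eqP; rewrite -subr_eq0 opprK addrC; apply/eqP.
by rewrite -(hmapD hf) ?subrr ?(hmap0 hf) //; exact: gradedN.
Qed.

Lemma hmapB b f x y : hmap p L b f -> L x -> L y -> f (x - y) = f x - f y.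
Proof.
by move=> hf Lx Ly; rewrite (hmapD hf) ?(hmapN hf) //; exact: gradedN.
Qed.

Lemma hmap_koszul b c e f x : hmap p L b f -> L x ->
  f (koszul c e x) = koszul c e (f x).
Proof.
by move=> hf Lx; rewrite /koszul; case: ifP => // _; rewrite (hmapN hf).
Qed.

Lemma eq_hmap b f g : (forall x, L x -> f x = g x) -> hmap p L b f -> hmap p L b g.
Proof.
move=> fg [fL fD fh]; split=> [x Lx|x y Lx Ly|c x Lx hx]; rewrite -?fg //.
- exact: fL.
- exact: fD.
- exact: gradedD.
- exact: fh.
Qed.

Lemma hmap_sub b f g : hmap p L b f -> hmap p L b g ->
  hmap p L b (fun x => f x - g x).
Proof.
move=> hf hg; split=> [x Lx|x y Lx Ly|c x Lx hx].
- by apply: (gradedB G); [apply: (hmapL hf)|apply: (hmapL hg)].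
- by rewrite (hmapD hf) // (hmapD hg) //; zmod.
- apply: homogB; [exact: (hmapL hf Lx)|exact: (hmapL hg Lx)| |].
    exact: (hmap_homog hf Lx hx).
  exact: (hmap_homog hg Lx hx).
Qed.

Lemma hmap_const0 b : hmap p L b (fun=> 0).
Proof.
split=> *; [exact: (graded0 G)|by rewrite addr0|exact: homog0].
Qed.

Lemma hmap_opp b f : hmap p L b f -> hmap p L b (fun x => - f x).
Proof.
move=> hf; apply: (eq_hmap _ (hmap_sub (hmap_const0 b) hf)) => x _.
by rewrite sub0r.
Qed.

Lemma hmap_add b f g : hmap p L b f -> hmap p L b g ->
  hmap p L b (fun x => f x + g x).
Proof.
move=> hf hg; apply: (eq_hmap _ (hmap_sub hf (hmap_opp hg))) => x _.
by rewrite opprK.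
Qed.

Lemma hmap_comp b c f g : hmap p L b f -> hmap p L c g ->
  hmap p L (b (+) c) (fun x => f (g x)).
Proof.
move=> hf hg; split=> [x Lx|x y Lx Ly|e x Lx hx].
- by apply: (hmapL hf); apply: (hmapL hg).
- by rewrite (hmapD hg) // (hmapD hf) //; exact: (hmapL hg).
- rewrite -addbA; apply: (hmap_homog hf); first exact: (hmapL hg Lx).
  exact: (hmap_homog hg Lx hx).
Qed.

Lemma hmap_kos b c e f : hmap p L b f -> hmap p L b (fun x => koszul c e (f x)).
Proof. by rewrite /koszul; case: (c && e) => // hf; exact: hmap_opp. Qed.

Lemma hmap_scomm b c f g : hmap p L b f -> hmap p L c g ->
  hmap p L (b (+) c) (fun z => f (g z) - koszul b c (g (f z))).
Proof.
move=> hf hg; apply: hmap_sub; first exact: hmap_comp.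
by apply: hmap_kos; rewrite addbC; exact: hmap_comp.
Qed.

(** On a homogeneous map the sums which define [epart] have one nonzero term.
    This brings [epart] and [sbr] back to plain compositions of maps. *)
Lemma epart_hmap b c f z : hmap p L c f -> L z ->
  epart p b f z = if b == c then f z else 0.
Proof.
move=> hf Lz; rewrite /epart big_bool /=.
have Lp e : L (p e z) by apply: (graded_part G _ Lz).
have hp e : homog p (c (+) e) (f (p e z)).
  exact: (hmap_homog hf (Lp e) (homog_part _ Lz)).
rewrite !(homog_partE _ (hmapL hf (Lp _)) (hp _)).
have := hmapD hf (Lp false) (Lp true); rewrite (graded_sum G) // => ->.
by case: b c {hf hp} => [] [] /=; zmod.
Qed.

Lemma epart_hmap_id b f z : hmap p L b f -> L z -> epart p b f z = f z.
Proof. by move=> hf Lz; rewrite (epart_hmap _ hf) ?eqxx. Qed.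

Lemma eq_epart b f g z : (forall x, L x -> f x = g x) -> L z ->
  epart p b f z = epart p b g z.
Proof.
move=> fg Lz; rewrite /epart; apply: eq_bigr => c _; rewrite fg //.
exact: (graded_part G _ Lz).
Qed.

Section Additive.
Variable f : T -> T.
Hypothesis fL : forall x, L x -> L (f x).
Hypothesis fD : forall x y, L x -> L y -> f (x + y) = f x + f y.

Lemma hmap_epart b : hmap p L b (epart p b f).
Proof.
have Lp e w : L w -> L (p e w) by move=> Lw; exact: (graded_part G _).
rewrite /epart; split=> [x Lx|x y Lx Ly|c x Lx hx]; rewrite !big_bool /=.
- by apply: gradedD; apply/Lp/fL/Lp.
- have Lpf e e' w : L w -> L (p e (f (p e' w))) by move=> Lw; apply/Lp/fL/Lp.
  rewrite !graded_partD // !fD; try exact: Lp.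
  by rewrite !graded_partD; try zmod; apply/fL/Lp.
- have f0 := additive_on0 fD.
  rewrite !(homog_partE _ Lx hx).
  by case: c {hx}; rewrite /= ?f0 ?graded_part0 ?addr0 ?add0r; apply/homog_part/fL.
Qed.

Lemma epart_sum z : L z -> epart p false f z + epart p true f z = f z.
Proof.
move=> Lz; rewrite /epart !big_bool /=.
have Lp e : L (p e z) by apply: (graded_part G _).
have -> : f z = f (p false z) + f (p true z) by rewrite -fD // (graded_sum G).
have E e := esym (graded_sum G (fL (Lp e))).
by rewrite [f _ in RHS]E [X in _ = _ + X]E; zmod.
Qed.

End Additive.

Lemma sbr_hmap b c f g z : hmap p L b f -> hmap p L c g -> L z ->
  sbr p f g z = f (g z) - koszul b c (g (f z)).
Proof.
move=> hf hg Lz; rewrite /sbr !big_bool /=.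
have Lf := hmapL hf Lz; have Lg := hmapL hg Lz.
have E e1 e2 : epart p e1 f (epart p e2 g z) - koszul e1 e2
      (epart p e2 g (epart p e1 f z)) =
    if (e1 == b) && (e2 == c) then f (g z) - koszul b c (g (f z)) else 0.
  rewrite (epart_hmap e1 hf Lz) (epart_hmap e2 hg Lz).
  case: (e1 =P b) => [->|/eqP nb]; last first.
    have -> : epart p e2 g 0 = 0.
      by rewrite (epart_hmap _ hg (graded0 G)) (hmap0 hg) if_same.
    have L1 : L (if e2 == c then g z else 0).
      by case: ifP => // _; exact: (graded0 G).
    by rewrite (epart_hmap _ hf L1) (negPf nb) koszul0 subr0.
  rewrite (epart_hmap _ hg Lf).
  case: (e2 =P c) => [->|nc] /=; first by rewrite (epart_hmap_id hf).
  by rewrite (epart_hmap _ hf (graded0 G)) (hmap0 hf) if_same koszul0 subr0.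
by rewrite !E; case: (b) (c) => [] [] /=; rewrite ?addr0 ?add0r.
Qed.

Lemma epart_split f (f' : bool -> T -> T) b z :
    (forall b, hmap p L b (f' b)) ->
    (forall x, L x -> f x = f' false x + f' true x) -> L z ->
  epart p b f z = f' b z.
Proof.
move=> hf fE Lz; rewrite (eq_epart b fE Lz).
transitivity (epart p b (f' false) z + epart p b (f' true) z).
  have Lp c : L (p c z) by exact: (graded_part G).
  by rewrite /epart !big_bool /= !graded_partD; try zmod; exact: (hmapL (hf _)).
by rewrite !(epart_hmap _ (hf _) Lz); case: b; rewrite /= ?addr0 ?add0r.
Qed.

(** A decomposition into homogeneous maps is unique on [L], so that any of them
    computes the supercommutator. *)
Lemma sbr_sum f g (f' g' : bool -> T -> T) z :
  (forall b, hmap p L b (f' b)) -> (forall b, hmap p L b (g' b)) ->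
  (forall x, L x -> f x = f' false x + f' true x) ->
  (forall x, L x -> g x = g' false x + g' true x) -> L z ->
  sbr p f g z = \sum_(b : bool) \sum_(c : bool)
     (f' b (g' c z) - koszul b c (g' c (f' b z))).
Proof.
move=> hf hg fE gE Lz; rewrite /sbr.
apply: eq_bigr => b _; apply: eq_bigr => c _.
have Lf := hmapL (hf b) Lz; have Lg := hmapL (hg c) Lz.
by rewrite (epart_split c hg gE Lz) (epart_split b hf fE Lg)
  (epart_split b hf fE Lz) (epart_split c hg gE Lf).
Qed.

End Graded.

Lemma grading_ind (V : zmodType) (g : grading V) (P : V -> Prop) :
  (forall x y, P x -> P y -> P (x + y)) ->
  (forall b x, homog g b x -> P x) -> forall x, P x.
Proof.
move=> PD Ph x; apply: (graded_ind (grading_graded g)) => // [y z _ _|b y _].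
  exact: PD.
exact: Ph.
Qed.

Lemma homog_epart (V : zmodType) (g : grading V) (f : V -> V) b :
  (forall x y, f (x + y) = f x + f y) ->
  homog (epart g) b f <-> hmap g setT b f.
Proof.
move=> fD; split=> [<-|hf].
  by apply: (hmap_epart (grading_graded g)) => // x y _ _; exact: fD.
by apply/funext => z; exact: (epart_hmap_id (grading_graded g) hf).
Qed.

(** * Superderivations on a graded subgroup *)

Record graded_module (K : pzRingType) (gK : grading K) (T : zmodType)
    (p : bool -> T -> T) (la : K -> T -> T) (L : set T) : Prop := GradedModule {
  gm_graded : graded p L;
  gm_mem : forall k z, L z -> L (la k z);
  gm_addr : forall k x y, L x -> L y -> la k (x + y) = la k x + la k y;
  gm_zero : forall z, L z -> la 0 z = 0;
  gm_homog : forall b c k z, homog gK b k -> L z -> homog p c z ->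
    homog p (b (+) c) (la k z)
}.

Record graded_product (T : zmodType) (p : bool -> T -> T) (mul : T -> T -> T)
    (L : set T) : Prop := GradedProduct {
  gp_mem : forall x y, L x -> L y -> L (mul x y);
  gp_addl : forall x y z, L x -> L y -> L z -> mul (x + y) z = mul x z + mul y z;
  gp_addr : forall x y z, L x -> L y -> L z -> mul x (y + z) = mul x y + mul x z;
  gp_homog : forall b c x y, L x -> L y -> homog p b x -> homog p c y ->
    homog p (b (+) c) (mul x y)
}.

Section GradedModule.
Variables (K : pzRingType) (gK : grading K).
Variables (T : zmodType) (p : bool -> T -> T) (la : K -> T -> T) (L : set T).
Hypothesis modL : graded_module gK p la L.
Let G : graded p L := gm_graded modL.
Let laL := gm_mem modL.
Let laD := gm_addr modL.
Let la0 := gm_zero modL.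

Local Notation ract := (ract gK p la).

Definition klinear (b : bool) (d : T -> T) : Prop :=
  forall c k z, homog gK c k -> L z -> d (la k z) = koszul b c (la k (d z)).

Lemma la_r0 k : la k 0 = 0.
Proof. exact: (additive_on0 G (laD k)). Qed.

Lemma laN k z : L z -> la k (- z) = - la k z.
Proof.
move=> Lz; apply/eqP; rewrite -subr_eq0 opprK -laD ?addNr ?la_r0 //.
exact: (gradedN G).
Qed.

Lemma la_koszul b c k z : L z -> la k (koszul b c z) = koszul b c (la k z).
Proof. by move=> Lz; rewrite /koszul; case: (b && c); rewrite ?laN. Qed.

Lemma ract_homogr k c z : L z -> homog p c z ->
  ract z k = la (gK false k) z + koszul true c (la (gK true k) z).
Proof.
move=> Lz hz; rewrite /ract !big_bool /= !(homog_partE G _ Lz hz).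
by case: c hz => hz; rewrite /koszul /= !la_r0; zmod.
Qed.

Lemma ractD k x y : L x -> L y -> ract (x + y) k = ract x k + ract y k.
Proof.
move=> Lx Ly; rewrite /ract !big_bool /=.
have Lp c z : L z -> L (p c z) by move=> Lz; exact: (graded_part G).
rewrite !(graded_partD G) // !laD; try exact: Lp.
by rewrite !koszulD; zmod.
Qed.

Lemma homogK b k : homog gK b k -> forall c, gK c k = if c == b then k else 0.
Proof.
by move=> hk c; exact: (homog_partE (grading_graded gK) _ I hk).
Qed.

Lemma ract_homog b c k z : homog gK b k -> L z -> homog p c z ->
  ract z k = koszul b c (la k z).
Proof.
move=> hk Lz hz; rewrite (ract_homogr _ Lz hz) !(homogK hk).
by case: b hk => hk /=; rewrite la0 ?koszul0 // ?add0r ?addr0.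
Qed.

Lemma ract_mem k z : L z -> L (ract z k).
Proof.
move=> Lz; rewrite /ract !big_bool /=.
by do ![apply: (gradedD G)]; apply: (koszul_mem G); apply: laL;
  exact: (graded_part G).
Qed.

(** The signed left form of linearity, for derivations and for endomorphisms, is
    the one used below: all scalars can then be collected on the left. *)
Lemma right_linearP b d : hmap p L b d ->
  (forall x k, L x -> d (ract x k) = ract (d x) k) <-> klinear b d.
Proof.
move=> hd; have dL := hmapL hd; have dD := hmapD hd.
split=> [dK c k z hk|dK z k]; move: z.
  apply: (graded_ind G) => [x y Lx Ly Ex Ey|e x Lx hx].
    by rewrite laD // !dD ?Ex ?Ey ?laD ?koszulD //; try exact: laL; exact: dL.
  have := dK x k Lx; rewrite (ract_homog hk Lx hx).
  rewrite (ract_homog hk (dL _ Lx) (hmap_homog hd Lx hx)).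
  rewrite (hmap_koszul G _ _ hd (laL k Lx)) => /(congr1 (koszul c e)).
  rewrite koszulK => ->; rewrite /koszul.
  by case: c e b {hx hk hd dK} => [] [] [] //=; rewrite ?opprK.
apply: (graded_ind G) => [x y Lx Ly Ex Ey|e x Lx hx].
  rewrite ractD // (hmapD hd) // ?Ex ?Ey ?(hmapD hd) ?ractD //; try exact: dL;
  exact: ract_mem.
rewrite (ract_homogr _ Lx hx) (ract_homogr _ (dL _ Lx) (hmap_homog hd Lx hx)).
have La c : L (la (gK c k) x) by exact: laL.
rewrite (hmapD hd) ?(hmap_koszul G _ _ hd) //; last exact: (koszul_mem G).
have hk c : homog gK c (gK c k) by exact: (homog_part (grading_graded gK)).
rewrite !(dK _ _ _ (hk _) Lx) koszulf; congr (_ + _); rewrite /koszul.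
by case: b e {hd dK hx} => [] [] /=; rewrite ?opprK.
Qed.

End GradedModule.

Section GradedDerivations.
Variables (K : pzRingType) (gK : grading K).
Variables (T : zmodType) (p : bool -> T -> T) (la : K -> T -> T).
Variables (mul : T -> T -> T) (L : set T).
Hypothesis modL : graded_module gK p la L.
Hypothesis prodL : graded_product p mul L.
Let G : graded p L := gm_graded modL.
Let laL := gm_mem modL.
Let laD := gm_addr modL.
Let mulL := gp_mem prodL.
Let mulDl := gp_addl prodL.
Let mulDr := gp_addr prodL.
Let mul_homog := gp_homog prodL.

Local Notation hder := (hder gK p la mul L).
Local Notation Der := (Der gK p la mul L).
Local Notation klinear := (klinear gK la L).

Definition leibniz (b : bool) (d : T -> T) : Prop :=
  forall c x y, L x -> L y -> homog p c x ->
    d (mul x y) = mul (d x) y + koszul b c (mul x (d y)).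

Lemma hderP b d : hder b d <-> [/\ hmap p L b d, klinear b d & leibniz b d].
Proof.
split=> [[dL dD dK dh dM]|[hd dK dM]].
  have hd : hmap p L b d by split.
  by split=> //; apply: (right_linearP modL hd).1 => x k; exact: dK.
by have := hd; case=> *; split=> // x k; exact: (right_linearP modL hd).2.
Qed.

Lemma eq_hder b d e : (forall x, L x -> d x = e x) -> hder b d -> hder b e.
Proof.
move=> de /hderP[hd dK dM]; apply/hderP; split; first exact: (eq_hmap G de hd).
- by move=> c k z hk Lz; rewrite -!de ?(dK c) //; exact: laL.
- by move=> c x y Lx Ly hx; rewrite -!de ?(dM c) //; exact: mulL.
Qed.

Lemma mul_subr x y z : L x -> L y -> L z -> mul x (y - z) = mul x y - mul x z.
Proof.
by move=> Lx Ly Lz; have := mulDr Lx (gradedB G Ly Lz) Lz; rewrite subrK => ->; zmod.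
Qed.

Lemma mul_subl x y z : L x -> L y -> L z -> mul (x - y) z = mul x z - mul y z.
Proof.
by move=> Lx Ly Lz; have := mulDl (gradedB G Lx Ly) Ly Lz; rewrite subrK => ->; zmod.
Qed.

Lemma mul_oppr x y : L x -> L y -> mul x (- y) = - mul x y.
Proof.
move=> Lx Ly; have L0 := graded0 G.
by rewrite -sub0r mul_subr // -[X in mul x X](subrr 0) mul_subr // subrr sub0r.
Qed.

Lemma mul_oppl x y : L x -> L y -> mul (- x) y = - mul x y.
Proof.
move=> Lx Ly; have L0 := graded0 G.
by rewrite -sub0r mul_subl // -[X in mul X y](subrr 0) mul_subl // subrr sub0r.
Qed.

Lemma leibniz_homogP b d : hmap p L b d ->
  (forall c e x y, L x -> L y -> homog p c x -> homog p e y ->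
    d (mul x y) = mul (d x) y + koszul b c (mul x (d y))) -> leibniz b d.
Proof.
move=> hd H c x y Lx Ly hx; have Ld := hmapL hd; move: y Ly.
apply: (graded_ind G) => [y z Ly Lz E E'|e y Ly hy]; last exact: (H c e).
have Lxy := mulL Lx Ly; have Lxz := mulL Lx Lz.
have Ldx := Ld _ Lx; have Ldy := Ld _ Ly; have Ldz := Ld _ Lz.
by rewrite mulDr // (hmapD hd) // E E' (hmapD hd) // !mulDr // koszulD; zmod.
Qed.

Lemma leibniz_add b d e : (forall x, L x -> L (d x)) -> (forall x, L x -> L (e x)) ->
  leibniz b d -> leibniz b e -> leibniz b (fun z => d z + e z).
Proof.
move=> Ld Le dM eM c x y Lx Ly hx.
rewrite (dM c) // (eM c) // mulDl ?mulDr ?koszulD; auto; zmod.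
Qed.

Lemma eq_leibniz b d e : (forall x, L x -> d x = e x) ->
  leibniz b d -> leibniz b e.
Proof.
by move=> de dM c x y Lx Ly hx; rewrite -!de ?(dM c) //; exact: mulL.
Qed.

Lemma hder_sub b d e : hder b d -> hder b e -> hder b (fun z => d z - e z).
Proof.
move=> /hderP[hd dK dM] /hderP[he eK eM]; apply/hderP; split.
- exact: (hmap_sub G).
- move=> c k z hk Lz; rewrite (dK c) // (eK c) // -koszulB -(laN modL) ?laD //;
    by try apply: (gradedN G); apply: (hmapL he) || apply: (hmapL hd).
- move=> c x y Lx Ly hx; rewrite (dM c) // (eM c) //.
  rewrite mul_subl ?mul_subr ?koszulB //; try zmod;
    by apply: (hmapL he) || apply: (hmapL hd).
Qed.

Lemma hder_const0 b : hder b (fun=> 0).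
Proof.
apply/hderP; split; first exact: (hmap_const0 G).
- by move=> c k z hk Lz; rewrite (la_r0 modL) koszul0.
- move=> c x y Lx Ly hx; have L0 := graded0 G.
  by rewrite -[X in mul X y](subrr 0) mul_subl // subrr -[X in mul x X](subrr 0)
    mul_subr // subrr koszul0 addr0.
Qed.

Lemma hder_add b d e : hder b d -> hder b e -> hder b (fun z => d z + e z).
Proof.
move=> hd he.
apply: (eq_hder _ (hder_sub hd (hder_sub (hder_const0 b) he))) => z _ /=.
by zmod.
Qed.

Lemma hder_scomm b c d e : hder b d -> hder c e ->
  hder (b (+) c) (fun z => d (e z) - koszul b c (e (d z))).
Proof.
move=> /hderP[hd dK dM] /hderP[he eK eM]; apply/hderP; split.
- exact: (hmap_scomm G).
- move=> f k z hk Lz.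
  have Ld := hmapL hd; have Le := hmapL he.
  rewrite (eK f) // (dK f) // (hmap_koszul G _ _ hd); last by apply/laL/Le.
  rewrite (hmap_koszul G _ _ he); last by apply/laL/Ld.
  rewrite (eK f) ?(dK f) //; try by [apply: Le|apply: Ld].
  have L1 := Ld _ (Le _ Lz); have L2 := Le _ (Ld _ Lz).
  rewrite laD // ?(laN modL) ?(la_koszul modL) //;
    last exact: (gradedN G (koszul_mem G _ _ L2)).
    by rewrite /koszul; case: b c f {hd he dK dM eK eM hk} => [] [] [] /=; zmod.
  exact: (koszul_mem G).
- move=> f x y Lx Ly hx.
  have Ld := hmapL hd; have Le := hmapL he.
  have hdx := hmap_homog hd Lx hx; have hex := hmap_homog he Lx hx.
  have Lm := mulL; have Lk := koszul_mem G.
  rewrite (eM f) // (dM f) // (hmapD hd) ?(hmapD he) //; try by auto.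
  rewrite (hmap_koszul G _ _ hd) ?(hmap_koszul G _ _ he) //; try by auto.
  rewrite (dM (c (+) f) (e x)) ?(eM (b (+) f) (d x)) ?(dM f) ?(eM f) //;
    try by auto.
  rewrite mul_subl ?mul_subr //; try by auto.
  rewrite /koszul; case: b c f {hd he dK dM eK eM hx hdx hex} => [] [] [] /=;
    rewrite ?mul_oppl ?mul_oppr; auto; by zmod.
Qed.

Lemma Der_hder b d : hder b d -> Der d.
Proof.
move=> hd; case: b hd => hd.
  by exists (fun=> 0), d; split=> // [|x _]; [exact: hder_const0|rewrite add0r].
by exists d, (fun=> 0); split=> // [|x _]; [exact: hder_const0|rewrite addr0].
Qed.

Lemma eq_Der d e : (forall x, L x -> d x = e x) -> Der d -> Der e.
Proof.
by move=> de [d0 [d1 [h0 h1 dE]]]; exists d0, d1; split=> // x Lx; rewrite -de ?dE.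
Qed.

Lemma Der_sub d e : Der d -> Der e -> Der (fun z => d z - e z).
Proof.
move=> [d0 [d1 [h0 h1 dE]]] [e0 [e1 [g0 g1 eE]]].
exists (fun z => d0 z - e0 z), (fun z => d1 z - e1 z).
by split=> [||x Lx]; [exact: hder_sub|exact: hder_sub|rewrite dE // eE //; zmod].
Qed.

Lemma Der_add d e : Der d -> Der e -> Der (fun z => d z + e z).
Proof.
move=> [d0 [d1 [h0 h1 dE]]] [e0 [e1 [g0 g1 eE]]].
exists (fun z => d0 z + e0 z), (fun z => d1 z + e1 z).
by split=> [||x Lx]; [exact: hder_add|exact: hder_add|rewrite dE // eE //; zmod].
Qed.

Lemma Der_split d : Der d -> exists d' : bool -> T -> T,
  (forall b, hder b (d' b)) /\ forall x, L x -> d x = d' false x + d' true x.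
Proof.
by move=> [d0 [d1 [h0 h1 dE]]]; exists (fun b => if b then d1 else d0); split=> // -[].
Qed.

(** ** The ideal of inner derivations *)

Local Notation adset := (adset mul L).

Lemma adset_subsupermodule :
    (forall k x y, L x -> L y -> la k (mul x y) = mul (la k x) y) ->
  subsupermodule p la adset.
Proof.
move=> la_mul; split.
- exists 0 => [|x Lx]; first exact: (graded0 G).
  by rewrite -[X in mul X x](subrr 0) mul_subl ?subrr //; exact: (graded0 G).
- move=> d e [y Ly dE] [y' Ly' eE]; exists (y - y'); first exact: (gradedB G).
  by move=> x Lx; rewrite dE // eE // mul_subl.
- move=> k d [y Ly dE]; exists (la k y); first exact: laL.
  by move=> x Lx; rewrite dE ?la_mul.
- move=> b d [y Ly dE]; exists (p b y); first exact: (graded_part G).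
  move=> x Lx; have Lp c := graded_part G c Ly.
  apply: (epart_split G (f' := fun c => mul (p c y))) => // [c|z Lz]; last first.
    by rewrite dE // -mulDl // (graded_sum G).
  split=> [z Lz|z w Lz Lw|e z Lz hz]; [exact: mulL|exact: mulDr|].
  by apply: mul_homog => //; exact: (homog_part G).
Qed.

(** The supercommutator of [d] and [ad y] is [ad (d y)], which is the product
    rule read as an equation between maps. *)
Lemma adset_ideal d e : Der d -> adset e -> adset (sbr p d e).
Proof.
move=> /Der_split[d' [hd dE]] [y Ly eE].
have hd' b : hmap p L b (d' b) by have /hderP[] := hd b.
exists (d y) => [|x Lx].
  by rewrite dE //; apply: (gradedD G); exact: (hmapL (hd' _)).
have Lp c := graded_part G c Ly.
have he c : hmap p L c (mul (p c y)).
  split=> [z Lz|z w Lz Lw|f z Lz hz]; [exact: mulL|exact: mulDr|].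
  by apply: mul_homog => //; exact: (homog_part G).
rewrite (sbr_sum G hd' he dE) //; last first.
  by move=> z Lz; rewrite eE // -mulDl // (graded_sum G).
have E b c : d' b (mul (p c y) x) - koszul b c (mul (p c y) (d' b x)) =
    mul (d' b (p c y)) x.
  have /hderP[_ _ /(_ c _ x (Lp c) Lx (homog_part G _ Ly)) ->] := hd b.
  by zmod.
under eq_bigr do under eq_bigr do rewrite E.
have Ld b c : L (d' b (p c y)) by exact: (hmapL (hd' b)).
rewrite !big_bool /= -!mulDl //; try exact: (gradedD G).
congr (mul _ x); rewrite dE // -{5 6}(graded_sum G Ly) !(hmapD (hd' _)) //.
by zmod.
Qed.

End GradedDerivations.

(** * Coordinates in a basis indexed by a set of rationals *)

Section Basis.
Variables (A : pzRingType) (M : lmodType A) (I : set rat) (m : rat -> M).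
Hypothesis expansion_ex1 : forall v, exists! c, expansion I m v c.
Local Notation coord := (Defs.coord I m).

Lemma coordP v : expansion I m v (coord v).
Proof. by have [c [cP _]] := expansion_ex1 v; apply: xgetPex; exists c. Qed.

Lemma coord_unique v c : expansion I m v c -> coord v = c.
Proof.
have [c' [_ c'1]] := expansion_ex1 v => cP.
by rewrite -(c'1 _ cP); apply/esym/c'1/coordP.
Qed.

Lemma fsum_seq (F : rat -> M) (s : seq rat) : uniq s ->
  (forall i, i \in s -> I i) -> (forall i, i \notin s -> F i = 0) ->
  \sum_(i \in I) F i = \sum_(i <- s) F i.
Proof.
move=> us sI F0; rewrite [RHS]fsbig_seq //; apply/esym/fsbig_widen => // i [_] /=.
by move/negP/F0.
Qed.

Lemma expansion_seq (c : rat -> A) (s : seq rat) : uniq s ->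
  (forall i, i \in s -> I i) -> (forall i, i \notin s -> c i = 0) ->
  expansion I m (\sum_(i <- s) c i *: m i) c.
Proof.
move=> us sI c0; have cs i : c i != 0 -> i \in s by apply: contraNT => /c0->.
split; last by rewrite (fsum_seq us) // => i /c0->; rewrite scale0r.
  by apply: (sub_finite_set (B := [set` s])) => // i /cs.
by move=> i /cs/sI.
Qed.

(** Finitely many vectors have their supports in a common finite list, which
    reduces statements on coordinates to finite sums. *)
Lemma coord_seq (vs : seq M) : exists s : seq rat, [/\ uniq s,
  forall i, i \in s -> I i &
  forall v, v \in vs -> (forall i, i \notin s -> coord v i = 0) /\
    v = \sum_(i <- s) coord v i *: m i].
Proof.
suff [s [us sI s0]] : exists s : seq rat, [/\ uniq s, forall i, i \in s -> I i &
    forall v, v \in vs -> forall i, i \notin s -> coord v i = 0].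
  exists s; split=> // v /s0 c0; split=> //.
  have [_ _ {1}->] := coordP v; rewrite (fsum_seq us) // => i /c0->.
  by rewrite scale0r.
elim: vs => [|v vs [s [us sI s0]]]; first by exists [::].
have [fv vI _] := coordP v; have /finite_seqP[t tE] := fv.
have tP i : (i \in t) = (coord v i != 0).
  by have := congr1 (fun S : set rat => S i) tE; rewrite /= => E; apply/idP/idP;
    rewrite E.
exists (undup (t ++ s)); split; first exact: undup_uniq.
  by move=> i; rewrite mem_undup mem_cat tP => /orP[/vI|/sI].
move=> w; rewrite inE => /orP[/eqP->|/s0 w0] i; rewrite mem_undup mem_cat negb_or.
  by case/andP; rewrite tP negbK => /eqP.
by case/andP=> _ /w0.
Qed.

Lemma coordD u v i : coord (u + v) i = coord u i + coord v i.
Proof.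
have [s [us sI sP]] := coord_seq [:: u; v].
have [u0 uE] := sP u (mem_head _ _).
have [v0 vE] : (forall i, i \notin s -> coord v i = 0) /\
    v = \sum_(i <- s) coord v i *: m i by apply: sP; rewrite !inE eqxx orbT.
rewrite {1}uE {1}vE -big_split /=.
under eq_bigr do rewrite -scalerDl.
by rewrite (coord_unique (expansion_seq us sI _)) // => j js; rewrite u0 ?v0 ?addr0.
Qed.

Lemma coordZ a v i : coord (a *: v) i = a * coord v i.
Proof.
have [s [us sI sP]] := coord_seq [:: v].
have [v0 vE] := sP v (mem_head _ _).
rewrite {1}vE scaler_sumr; under eq_bigr do rewrite scalerA.
by rewrite (coord_unique (expansion_seq us sI _)) // => j js; rewrite v0 ?mulr0.
Qed.

Lemma coord0 i : coord 0 i = 0.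
Proof. by rewrite -(scale0r 0) coordZ mul0r. Qed.

Lemma coordN v i : coord (- v) i = - coord v i.
Proof. by rewrite -scaleN1r coordZ mulN1r. Qed.

Lemma coordB u v i : coord (u - v) i = coord u i - coord v i.
Proof. by rewrite coordD coordN. Qed.

Lemma coord_basis i j : I i -> coord (m i) j = (j == i)%:R.
Proof.
move=> Ii.
have -> : m i = \sum_(k <- [:: i]) (k == i)%:R *: m k.
  by rewrite big_seq1 eqxx scale1r.
rewrite (coord_unique (expansion_seq _ _ _)) // => k; rewrite inE.
  by move/eqP->.
by move/negPf->.
Qed.

Lemma coord_scale_basis a i j : I i -> coord (a *: m i) j = if j == i then a else 0.
Proof.
by move=> Ii; rewrite coordZ coord_basis //; case: ifP; rewrite ?mulr1 ?mulr0.
Qed.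

Lemma coord_inj u v : (forall i, I i -> coord u i = coord v i) -> u = v.
Proof.
move=> uv; have [_ _ ->] := coordP u; have [_ _ ->] := coordP v.
by apply: eq_fsbigr => i; rewrite inE => /uv->.
Qed.

Lemma basis_ind (P : M -> Prop) : P 0 -> (forall u v, P u -> P v -> P (u + v)) ->
  (forall i a, I i -> P (a *: m i)) -> forall v, P v.
Proof.
move=> P0 PD Pm v; have [s [us sI /(_ v (mem_head _ _))[_ ->]]] := coord_seq [:: v].
rewrite big_seq; apply: big_ind => // i /sI; exact: Pm.
Qed.

(** [Delta_M] and the degree operator are both of this form. *)
Definition coordwise (F : rat -> A -> A) (v : M) : M :=
  \sum_(i \in I) F i (coord v i) *: m i.

Section Coordwise.
Variable F : rat -> A -> A.
Hypothesis FD : forall i a b, F i (a + b) = F i a + F i b.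

Lemma coordwise_zero i : F i 0 = 0.
Proof. by have := FD i 0 0; rewrite addr0 => /addrr_eq. Qed.

Lemma coord_coordwise v i : I i -> coord (coordwise F v) i = F i (coord v i).
Proof.
move=> Ii; have [s [us sI sP]] := coord_seq [:: v].
have [v0 _] := sP v (mem_head _ _).
pose c j := if j \in s then F j (coord v j) else 0.
have -> : coordwise F v = \sum_(j <- s) c j *: m j.
  rewrite /coordwise (fsum_seq us) => // [|j js].
    by apply: eq_big_seq => j js; rewrite /c js.
  by rewrite v0 // coordwise_zero scale0r.
rewrite (coord_unique (expansion_seq us sI _)) /c => [|j /negPf->//].
by case: ifPn => // /v0->; rewrite coordwise_zero.
Qed.

Lemma coordwiseD u v : coordwise F (u + v) = coordwise F u + coordwise F v.
Proof.
by apply: coord_inj => i Ii; rewrite coordD !coord_coordwise // coordD FD.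
Qed.

Lemma coordwise_basis a i : I i -> coordwise F (a *: m i) = F i a *: m i.
Proof.
move=> Ii; apply: coord_inj => j Ij.
rewrite coord_coordwise // !coord_scale_basis //.
by case: eqP => [->|_] //; rewrite coordwise_zero.
Qed.

End Coordwise.
End Basis.

(** * Supermodules over a supercommutative superring *)

Section Supermodule.
Variables (A : pzRingType) (gA : grading A).
Variables (M : lmodType A) (gM : grading M).
Hypotheses (superA : superring gA) (commA : supercommutative gA).
Hypothesis superM : supermodule gA gM.

Let GA := grading_graded gA.
Let GM := grading_graded gM.

Local Notation "v <* a" := (ract gA gM (fun b w => b *: w) v a)
  (at level 40, left associativity).

(** Comparing the parts of [x = x * 1] for homogeneous [x] shows that the odd
    part of 1 annihilates [A], hence 1 itself. *)
Lemma homog_one : homog gA false 1.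
Proof.
suff o1 x : x * gA true 1 = 0.
  by rewrite /homog -[RHS](part_sum gA) -(mul1r (gA true 1)) o1 addr0.
move: x; apply: (grading_ind (g := gA)) => [x y Ex Ey|b x hx].
  by rewrite mulrDl Ex Ey addr0.
have hxe c : homog gA (b (+) c) (x * gA c 1).
  by apply: superA => //; exact: (homog_part GA).
have E : x = x * gA false 1 + x * gA true 1 by rewrite -mulrDr part_sum mulr1.
have := congr1 (gA (b (+) true)) E.
rewrite (graded_partD GA) // (homog_partE GA _ I hx).
rewrite !(homog_partE GA _ I (hxe _)).
by case: (b); rewrite /= add0r.
Qed.

Lemma part_scale b e a w : homog gM e w ->
  gM b (a *: w) = gA (b (+) e) a *: w.
Proof.
move=> hw; move: a; apply: (grading_ind (g := gA)) => [x y Ex Ey|c x hx].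
  by rewrite scalerDl !(graded_partD GM, graded_partD GA) // Ex Ey scalerDl.
rewrite (homog_partE GM _ I (superM hx hw)) (homog_partE GA _ I hx).
by case: b c e {hx hw} => [] [] [] /=; rewrite ?scale0r.
Qed.

Lemma supermodule_graded : graded_module gA gM (fun a v => a *: v) setT.
Proof.
by split=> // *; rewrite ?scalerDr ?scale0r //; exact: superM.
Qed.
Let modM := supermodule_graded.

Lemma rscale_homog b c a v : homog gA b a -> homog gM c v ->
  v <* a = koszul b c (a *: v).
Proof. by move=> ha hv; exact: (ract_homog modM). Qed.

Lemma rscaleDl a v w : (v + w) <* a = v <* a + w <* a.
Proof. exact: (ractD modM). Qed.

Lemma rscaleDr v a b : v <* (a + b) = v <* a + v <* b.
Proof.
rewrite /ract !big_bool /= !(graded_partD GA) // !scalerDl !koszulD; zmod.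
Qed.

Lemma rscale0l a : 0 <* a = 0 :> M.
Proof. by have := rscaleDl a 0 0; rewrite addr0 => /addrr_eq. Qed.

Lemma rscale0r v : v <* 0 = 0 :> M.
Proof. by have := rscaleDr v 0 0; rewrite addr0 => /addrr_eq. Qed.

Lemma rscaleNl a v : (- v) <* a = - (v <* a).
Proof. by apply/eqP; rewrite -subr_eq0 opprK -rscaleDl addNr rscale0l. Qed.

Lemma rscaleNr a v : v <* (- a) = - (v <* a).
Proof. by apply/eqP; rewrite -subr_eq0 opprK -rscaleDr addNr rscale0r. Qed.

Lemma rscale1 v : v <* 1 = v.
Proof.
move: v; apply: (grading_ind (g := gM)) => [v w Ev Ew|c v hv].
  by rewrite rscaleDl Ev Ew.
by rewrite (rscale_homog homog_one hv) scale1r.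
Qed.

Lemma part_rscale b c w a : homog gA c a -> gM (b (+) c) (w <* a) = gM b w <* a.
Proof.
move=> ha; move: w; apply: (grading_ind (g := gM)) => [v w Ev Ew|e v hv].
  by rewrite rscaleDl !(graded_partD GM) // rscaleDl Ev Ew.
rewrite (rscale_homog ha hv) (homog_partE GM b I hv).
rewrite (homog_partE GM _ I (homog_koszul GM _ _ I (superM ha hv))).
case: (b =P e) => [->|nbe].
  by rewrite addbC eqxx (rscale_homog ha hv).
by case: b c e nbe {ha hv} => [] [] [] //=; rewrite rscale0l.
Qed.

Lemma scale_rscale a v b : (a *: v) <* b = a *: (v <* b).
Proof.
move: b; apply: (grading_ind (g := gA)) => [x y Ex Ey|c b hb].
  by rewrite !rscaleDr Ex Ey scalerDr.
move: v; apply: (grading_ind (g := gM)) => [x y Ex Ey|d v hv].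
  by rewrite scalerDr !rscaleDl Ex Ey scalerDr.
move: a; apply: (grading_ind (g := gA)) => [x y Ex Ey|e a ha].
  by rewrite !scalerDl rscaleDl Ex Ey.
rewrite (rscale_homog hb (superM ha hv)) (rscale_homog hb hv).
rewrite -koszul_scale !scalerA (commA hb ha) /koszul.
by case: c d e {hb hv ha} => [] [] [] /=; rewrite ?scaleNr ?scalerN ?opprK ?scalerA.
Qed.

Lemma signed_app_homog b c x v : hmap gM setT b x -> homog gM c v ->
  signed_app gM x v = koszul b c (x v).
Proof.
move=> hx hv; rewrite /signed_app !big_bool /= !(homog_partE GM _ I hv).
rewrite !(epart_hmap GM _ hx) //.
have x0 := hmap0 GM hx.
case: b c {hx hv} => [] []; rewrite /koszul /= ?x0; zmod.
Qed.

(** ** Homogeneous endomorphisms *)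

Notation klin := (klinear gA (fun a v => a *: v) setT).

Lemma klin_hmapP b x : hmap gM setT b x ->
  (forall v a, x (v <* a) = x v <* a) <-> klin b x.
Proof.
move=> hx; have P := right_linearP modM hx.
by split=> [xl|/P xl v a]; [apply/P => *|]; exact: xl.
Qed.

Record hend (b : bool) (x : M -> M) : Prop := Hend {
  hend_map : hmap gM setT b x;
  hend_lin : klin b x
}.

Lemma hendZ b c a v x : hend b x -> homog gA c a ->
  x (a *: v) = koszul b c (a *: x v).
Proof. by move=> hx ha; exact: (hend_lin hx). Qed.

Lemma EndA_hend b x : hend b x -> EndA gA gM x.
Proof.
case=> hx /klin_hmapP xl; split; last exact: xl.
by move=> u v; exact: (hmapD hx).
Qed.

Lemma hend_EndA b x : hmap gM setT b x -> EndA gA gM x -> hend b x.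
Proof. by move=> hx [_ xl]; split=> //; apply/klin_hmapP. Qed.

Lemma EndA_sub x y : EndA gA gM x -> EndA gA gM y ->
  EndA gA gM (fun v => x v - y v).
Proof.
move=> [xD xl] [yD yl]; split=> [u v|v a]; first by rewrite xD yD; zmod.
by rewrite xl yl rscaleDl rscaleNl.
Qed.

Lemma EndA0 : EndA gA gM (fun=> 0).
Proof. by split=> *; rewrite ?addr0 ?rscale0l. Qed.

Lemma epart_homog b e x v : x 0 = 0 -> homog gM e v ->
  epart gM b x v = gM (b (+) e) (x v).
Proof.
move=> x0 hv; rewrite /epart big_bool /= !(homog_partE GM _ I hv).
by case: e hv => hv /=; rewrite x0 (graded_part0 GM) ?addr0 ?add0r.
Qed.

Lemma sbr_epart x y : sbr gM x y = fun z =>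
  let t b c := epart gM b x (epart gM c y z) -
    koszul b c (epart gM c y (epart gM b x z)) in
  (t true true + t true false) + (t false true + t false false).
Proof. by apply/funext => z; rewrite /sbr !big_bool. Qed.

Lemma EndA_scale a x : EndA gA gM x -> EndA gA gM (fun v => a *: x v).
Proof.
by move=> [xD xl]; split=> *; rewrite ?xD ?xl ?scalerDr ?scale_rscale.
Qed.

Lemma EndA_epart b x : EndA gA gM x -> hend b (epart gM b x).
Proof.
move=> [xD xl]; have hx : hmap gM setT b (epart gM b x).
  by apply: (hmap_epart GM) => // u v _ _; exact: xD.
split=> //; apply/klin_hmapP => // v a.
have xpD c : hmap gM setT c (epart gM c x).
  by apply: (hmap_epart GM) => // u w _ _; exact: xD.
move: a; apply: (grading_ind (g := gA)) => [a a' E E'|c a ha].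
  by rewrite !rscaleDr (hmapD hx) // E E'.
move: v; apply: (grading_ind (g := gM)) => [u w E E'|e v hv].
  by rewrite rscaleDl !(hmapD hx) // rscaleDl E E'.
have x0 : x 0 = 0 by apply: (additive_on0 GM (f := x)) => u w _ _; exact: xD.
rewrite (epart_homog _ x0 hv) -(part_rscale _ _ ha) -xl (@epart_homog b (c (+) e)) //.
  by rewrite -addbA (addbC e).
by rewrite (rscale_homog ha hv); apply: (homog_koszul GM) => //; exact: superM.
Qed.

Lemma EndA_sum x z : EndA gA gM x -> x z = epart gM false x z + epart gM true x z.
Proof. by move=> [xD _]; rewrite (epart_sum GM) // => u v _ _; exact: xD. Qed.

Lemma hend_add b x y : hend b x -> hend b y -> hend b (fun v => x v + y v).
Proof.
move=> [hx xl] [hy yl]; split; first exact: (hmap_add GM).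
by move=> c a v ha _; rewrite (xl c) // (yl c) // -koszulD scalerDr.
Qed.

Lemma hend_scalar c a : homog gA c a -> hend c (fun v => a *: v).
Proof.
move=> ha; split; first split=> // *; [by rewrite scalerDr|exact: superM|].
move=> e b v hb _; rewrite !scalerA (commA ha hb) /koszul.
by case: (c && e); rewrite ?scaleNr.
Qed.

(** * Quadratic forms and the orthosymplectic superalgebra *)

Variable q : M -> M -> A.
Hypothesis quad_q : quadratic_form gA gM q.

Lemma qDl u v w : q (u + v) w = q u w + q v w.
Proof. by have [[]] := quad_q. Qed.

Lemma qDr u v w : q u (v + w) = q u v + q u w.
Proof. by have [[]] := quad_q. Qed.

Lemma q0l v : q 0 v = 0.
Proof. by have := qDl 0 0 v; rewrite addr0 => /addrr_eq. Qed.

Lemma q0r v : q v 0 = 0.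
Proof. by have := qDr v 0 0; rewrite addr0 => /addrr_eq. Qed.

Lemma qNl u v : q (- u) v = - q u v.
Proof. by apply/eqP; rewrite -subr_eq0 opprK -qDl addNr q0l. Qed.

Lemma qNr u v : q u (- v) = - q u v.
Proof. by apply/eqP; rewrite -subr_eq0 opprK -qDr addNr q0r. Qed.

Lemma q_homog b c u v : homog gM b u -> homog gM c v -> homog gA (b (+) c) (q u v).
Proof. by have [_ _ _ qh _] := quad_q; exact: qh. Qed.

Lemma q_sym b c u v : homog gM b u -> homog gM c v -> q u v = koszul b c (q v u).
Proof. by have [_ _ _ _ qs] := quad_q; exact: qs. Qed.

Lemma q_koszull b c u v : q (koszul b c u) v = koszul b c (q u v).
Proof. by rewrite /koszul; case: (b && c); rewrite ?qNl. Qed.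

Lemma q_koszulr b c u v : q u (koszul b c v) = koszul b c (q u v).
Proof. by rewrite /koszul; case: (b && c); rewrite ?qNr. Qed.

(** The axioms of [q] mix the left and right actions of [A]; these two lemmas
    restate them for the left action alone. *)
Lemma qZr b c a u v : homog gA b a -> homog gM c u ->
  q u (a *: v) = koszul b c (a * q u v).
Proof.
move=> ha hu; move: v; apply: (grading_ind (g := gM)) => [v w E E'|e v hv].
  by rewrite scalerDr !qDr E E' mulrDr koszulD.
have [_ _ qr _ _] := quad_q.
have := qr u v a; rewrite (rscale_homog ha hv) q_koszulr.
rewrite (commA (q_homog hu hv) ha) => /(congr1 (koszul b e)).
by rewrite koszulK => ->; rewrite /koszul; case: b c e {ha hu hv} => [] [] [] /=;
  rewrite ?opprK.
Qed.

Lemma qZl a u v : q (a *: u) v = a * q u v.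
Proof.
move: a; apply: (grading_ind (g := gA)) => [a a' E E'|b a ha].
  by rewrite scalerDl qDl E E' mulrDl.
move: u; apply: (grading_ind (g := gM)) => [u w E E'|c u hu].
  by rewrite scalerDr !qDl E E' mulrDr.
have [_ ql _ _ _] := quad_q.
have := ql u v a; rewrite (rscale_homog ha hu) q_koszull (qZr _ ha hu).
by move=> /(congr1 (koszul b c)); rewrite !koszulK.
Qed.

Lemma part_q b c w v : homog gM c v -> gA (b (+) c) (q w v) = q (gM b w) v.
Proof.
move=> hv; move: w; apply: (grading_ind (g := gM)) => [u w E E'|e u hu].
  by rewrite qDl (graded_partD GA) // (graded_partD GM) // qDl E E'.
rewrite (homog_partE GA _ I (q_homog hu hv)) (homog_partE GM _ I hu).
by case: b c e {hu hv} => [] [] [] //=; rewrite q0l.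
Qed.

(** ** The operators [E_{u,v}] *)

Lemma opEDl u u' v w : opE gA gM q (u + u') v w = opE gA gM q u v w + opE gA gM q u' v w.
Proof.
by rewrite /opE !big_bool /koszul /= !rscaleDl !qDl !scalerDl; zmod.
Qed.

Lemma opEDr u v v' w : opE gA gM q u (v + v') w = opE gA gM q u v w + opE gA gM q u v' w.
Proof.
rewrite /opE !big_bool /koszul /= !(graded_partD GM) // !qDl !rscaleDr !scalerDr.
by zmod.
Qed.

Lemma opEDw u v w w' : opE gA gM q u v (w + w') = opE gA gM q u v w + opE gA gM q u v w'.
Proof.
rewrite /opE !big_bool /koszul /= !(graded_partD GM) // !qDr !rscaleDr !scalerDl.
by zmod.
Qed.

Lemma opE0l v w : opE gA gM q 0 v w = 0.
Proof. by have := opEDl 0 0 v w; rewrite addr0 => /addrr_eq. Qed.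

Lemma opE0r v w : opE gA gM q v 0 w = 0.
Proof. by have := opEDr v 0 0 w; rewrite addr0 => /addrr_eq. Qed.

Lemma opENl u v w : opE gA gM q (- u) v w = - opE gA gM q u v w.
Proof. by apply/eqP; rewrite -subr_eq0 opprK -opEDl addNr opE0l. Qed.

Lemma opENr u v w : opE gA gM q u (- v) w = - opE gA gM q u v w.
Proof. by apply/eqP; rewrite -subr_eq0 opprK -opEDr addNr opE0r. Qed.

Lemma opE_koszull b c u v w : opE gA gM q (koszul b c u) v w = koszul b c (opE gA gM q u v w).
Proof. by rewrite /koszul; case: (b && c); rewrite ?opENl. Qed.

Lemma opE_koszulr b c u v w : opE gA gM q u (koszul b c v) w = koszul b c (opE gA gM q u v w).
Proof. by rewrite /koszul; case: (b && c); rewrite ?opENr. Qed.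

Lemma opE_half c e u v w : homog gM c v -> homog gM e w ->
  opE gA gM q u v w = u <* q v w - koszul c e (q u w *: v).
Proof.
move=> hv hw; rewrite /opE !big_bool /=.
rewrite !(homog_partE GM _ I hv) !(homog_partE GM _ I hw).
by case: c e {hv hw} => [] []; rewrite /koszul /= ?q0l ?q0r ?rscale0r ?scaler0 ?scale0r;
  zmod.
Qed.

Lemma opE_homog b c e u v w : homog gM b u -> homog gM c v -> homog gM e w ->
  opE gA gM q u v w =
    koszul (c (+) e) b (q v w *: u) - koszul c e (q u w *: v).
Proof.
move=> hu hv hw; rewrite (opE_half _ hv hw).
by rewrite (rscale_homog (q_homog hv hw) hu).
Qed.

Lemma hmap_opE b c u v : homog gM b u -> homog gM c v ->
  hmap gM setT (b (+) c) (opE gA gM q u v).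
Proof.
move=> hu hv; split=> // [x y _ _|e w _ hw]; first exact: opEDw.
rewrite (opE_homog hu hv hw); apply: (homogB GM) => //; apply: (homog_koszul GM) => //.
  have -> : b (+) c (+) e = c (+) e (+) b by case: b c e {hu hv hw} => [] [] [].
  by apply: superM => //; exact: q_homog.
have -> : b (+) c (+) e = b (+) e (+) c by case: b c e {hu hv hw} => [] [] [].
by apply: superM => //; exact: q_homog.
Qed.

Lemma hend_opE b c u v : homog gM b u -> homog gM c v ->
  hend (b (+) c) (opE gA gM q u v).
Proof.
move=> hu hv; split; first exact: hmap_opE.
move=> e a w ha _; move: w; apply: (grading_ind (g := gM)) => [x y E E'|f w hw].
  by rewrite scalerDr !opEDw E E' scalerDr koszulD.
rewrite (opE_homog hu hv (superM ha hw)) (opE_homog hu hv hw).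
rewrite (qZr _ ha hu) (qZr _ ha hv) /koszul.
by case: b c e f {hu hv ha hw} => [] [] [] [] /=;
  rewrite ?scaleNr ?scalerBr ?scalerN ?scalerA; zmod.
Qed.

Lemma opE_scalel a u v w : opE gA gM q (a *: u) v w = a *: opE gA gM q u v w.
Proof.
move: v; apply: (grading_ind (g := gM)) => [x y E E'|c v hv].
  by rewrite !opEDr E E' scalerDr.
move: w; apply: (grading_ind (g := gM)) => [x y E E'|e w hw].
  by rewrite !opEDw E E' scalerDr.
rewrite !(opE_half _ hv hw) scale_rscale qZl scalerBr -scalerA.
by rewrite koszul_scale.
Qed.

Lemma opE_scale b c a u v w : homog gA b a -> homog gM c u ->
  opE gA gM q (a *: u) v w = koszul b c (opE gA gM q u (a *: v) w).
Proof.
move=> ha hu; move: v; apply: (grading_ind (g := gM)) => [x y E E'|d v hv].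
  by rewrite scalerDr !opEDr E E' koszulD.
move: w; apply: (grading_ind (g := gM)) => [x y E E'|e w hw].
  by rewrite !opEDw E E' koszulD.
rewrite (opE_homog (superM ha hu) hv hw) (opE_homog hu (superM ha hv) hw).
rewrite !qZl !scalerA (commA (q_homog hv hw) ha) (commA (q_homog hu hw) ha).
by rewrite /koszul; case: b c d e {hu hv ha hw} => [] [] [] [] /=;
  rewrite ?scaleNr; zmod.
Qed.

Lemma opE_sym b c u v w : homog gM b u -> homog gM c v ->
  opE gA gM q u v w = - koszul b c (opE gA gM q v u w).
Proof.
move=> hu hv; move: w; apply: (grading_ind (g := gM)) => [x y E E'|e w hw].
  by rewrite !opEDw E E' koszulD; zmod.
rewrite (opE_homog hu hv hw) (opE_homog hv hu hw) /koszul.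
by case: b c e {hu hv hw} => [] [] [] /=; zmod.
Qed.

(** ** Skew maps up to a derivation of the scalars *)

(** The case [f = 0] gives the homogeneous elements of [osp q]; in the other case
    of interest [f] is a derivation of [A] and [S] is [Delta_M]. *)
Record semiskew (b : bool) (f : A -> A) (S : M -> M) : Prop := Semiskew {
  ss_map : hmap gM setT b S;
  ss_fmap : hmap gA setT b f;
  ss_scale : forall c a v, homog gA c a ->
    S (a *: v) = f a *: v + koszul b c (a *: S v);
  ss_q : forall c u v, homog gM c u ->
    f (q u v) = q (S u) v + koszul b c (q u (S v))
}.

(** The operators [E_{u,v}] are defined from [q] alone, so a map which leaves [q]
    invariant acts on them through its action on [u] and [v]. *)
Lemma semiskew_opE b f S c d u v w : semiskew b f S ->
  homog gM c u -> homog gM d v ->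
  S (opE gA gM q u v w) - koszul b (c (+) d) (opE gA gM q u v (S w)) =
    opE gA gM q (S u) v w + koszul b c (opE gA gM q u (S v) w).
Proof.
move=> [Sm fm Sa Sq] hu hv.
move: w; apply: (grading_ind (g := gM)) => [x y E E'|e w hw].
  rewrite (hmapD Sm) // !opEDw (hmapD Sm) // !koszulD.
  have -> (a b' c' d' : M) : a + b' - (c' + d') = (a - c') + (b' - d') by zmod.
  by rewrite E E'; zmod.
have hS k z : homog gM k z -> homog gM (b (+) k) (S z) by exact: (hmap_homog Sm).
rewrite (opE_homog hu hv hw) (opE_homog hu hv (hS _ _ hw)).
rewrite (opE_homog (hS _ _ hu) hv hw) (opE_homog hu (hS _ _ hv) hw).
rewrite (hmapB GM Sm) // !(hmap_koszul GM _ _ Sm) //.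
rewrite (Sa (d (+) e)) ?(Sa (c (+) e)); try exact: q_homog.
rewrite (Sq d) // (Sq c) // /koszul.
by case: b c d e {Sm fm Sa Sq hu hv hw hS} => [] [] [] [] /=;
  rewrite ?scalerDl ?scaleNr; zmod.
Qed.

Local Notation osp := (osp gA gM q).

Lemma semiskew_hend b x : semiskew b (fun=> 0) x -> hend b x.
Proof.
case=> xm _ xa _; split=> // c a v ha _.
by rewrite (xa c) // scale0r add0r.
Qed.

Lemma semiskew_osp b x : semiskew b (fun=> 0) x -> osp x.
Proof.
move=> sx; split; first exact: EndA_hend (semiskew_hend sx).
case: sx => xm _ _ xq c e u v hu hv; rewrite [RHS](xq c u v hu).
rewrite (q_sym hu (hmap_homog xm I hv)) /koszul.
by case: b c e {xq hu hv xm} => [] [] [] /=; rewrite ?opprK.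
Qed.

Lemma osp_semiskew b x : hmap gM setT b x -> osp x -> semiskew b (fun=> 0) x.
Proof.
move=> xm [xE xq]; have [_ xl] := hend_EndA xm xE; split=> //.
- exact: (hmap_const0 GA).
- by move=> c a v ha; rewrite (xl c) // scale0r add0r.
- move=> c u v hu; move: v; apply: (grading_ind (g := gM)) => [v w E E'|e v hv].
    by rewrite (hmapD xm) // !qDr koszulD -[LHS]addr0 {1}E E'; zmod.
  rewrite -(xq c e u v hu hv) (q_sym hu (hmap_homog xm I hv)) /koszul.
  by case: b c e {xq hu hv xm xl} => [] [] [] /=; rewrite ?opprK.
Qed.

Lemma osp_epart b x : osp x -> osp (epart gM b x).
Proof.
move=> [xE xq]; have [hx hl] := EndA_epart b xE.
split; first exact: EndA_hend (Hend hx hl).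
move=> c e u v hu hv.
have x0 : x 0 = 0.
  by case: xE => xD _; apply: (additive_on0 GM (f := x)) => *; exact: xD.
have ep d w : homog gM d w -> epart gM b x w = gM (b (+) d) (x w).
  exact: epart_homog.
have := congr1 (gA (b (+) c (+) e)) (xq c e u v hu hv).
rewrite (graded_part0 GA) (graded_partD GA) // part_q // -ep //.
have -> : gA (b (+) c (+) e) (koszul c e (q (x v) u)) =
    koszul c e (gA (b (+) e (+) c) (q (x v) u)).
  have -> : b (+) c (+) e = b (+) e (+) c by case: b c e {hu hv hx hl ep} => [] [] [].
  by rewrite /koszul; case: (c && e) => //; rewrite (graded_partN GA).
by rewrite part_q // -ep.
Qed.

Lemma osp_sum x z : osp x -> x z = epart gM false x z + epart gM true x z.
Proof. by move=> [xE _]; exact: EndA_sum. Qed.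

Lemma osp_hmap b x : osp x -> hmap gM setT b (epart gM b x).
Proof. by move=> [xE _]; case: (EndA_epart b xE). Qed.

Lemma osp0 : osp (fun=> 0).
Proof.
split; first exact: EndA0.
by move=> b c u v _ _; rewrite !q0l koszul0 addr0.
Qed.

Lemma osp_sub x y : osp x -> osp y -> osp (fun v => x v - y v).
Proof.
move=> [xE xq] [yE yq]; split; first exact: EndA_sub.
move=> b c u v hu hv; rewrite !qDl !qNl koszulB.
by rewrite -[RHS](subrr 0) -{1}(xq b c u v hu hv) -(yq b c u v hu hv); zmod.
Qed.

Lemma osp_add x y : osp x -> osp y -> osp (fun v => x v + y v).
Proof.
move=> xo yo; have -> : (fun v => x v + y v) = (fun v => x v - (0 - y v)).
  by apply/funext => v; zmod.
by apply: osp_sub => //; apply: osp_sub => //; exact: osp0.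
Qed.

Lemma osp_scale a x : osp x -> osp (fun v => a *: x v).
Proof.
move=> [xE xq]; split; first exact: EndA_scale.
move=> b c u v hu hv; rewrite !qZl.
have -> : koszul b c (a * q (x v) u) = a * koszul b c (q (x v) u).
  by rewrite /koszul; case: (b && c); rewrite ?mulrN.
by rewrite -mulrDr xq // mulr0.
Qed.

Lemma eq_semiskew b f g S : f =1 g -> semiskew b f S -> semiskew b g S.
Proof. by move=> /funext->. Qed.

Lemma semiskew_scomm b c f g S T : semiskew b f S -> semiskew c g T ->
  semiskew (b (+) c) (fun a => f (g a) - koszul b c (g (f a)))
    (fun z => S (T z) - koszul b c (T (S z))).
Proof.
move=> [Sm fm Sa Sq] [Tm gm Ta Tq]; split.
- exact: (hmap_scomm GM).
- exact: (hmap_scomm GA).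
- move=> e a v ha.
  have hf := hmap_homog fm I ha; have hg := hmap_homog gm I ha.
  rewrite (Ta _ _ _ ha) (Sa _ _ _ ha) (hmapD Sm) // (hmapD Tm) //.
  rewrite (hmap_koszul GM _ _ Sm) // (hmap_koszul GM _ _ Tm) //.
  rewrite (Sa _ _ _ hg) (Ta _ _ _ hf) (Ta _ _ _ ha) (Sa _ _ _ ha) /koszul.
  by case: (b) (c) (e) => [] [] [] /=; rewrite scalerBl scalerBr ?scalerN ?scaleNr; zmod.
- move=> e u v hu.
  have hS := hmap_homog Sm I hu; have hT := hmap_homog Tm I hu.
  rewrite (Tq _ _ _ hu) (Sq _ _ _ hu) (hmapD fm) // (hmapD gm) //.
  rewrite (hmap_koszul GA _ _ fm) // (hmap_koszul GA _ _ gm) //.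
  rewrite (Sq _ _ _ hT) (Tq _ _ _ hS) (Tq _ _ _ hu) (Sq _ _ _ hu).
  rewrite qDl qNl qDr qNr q_koszull q_koszulr /koszul.
  by case: (b) (c) (e) => [] [] [] /=; zmod.
Qed.

Lemma semiskew_scomm0 b c f S x : semiskew b f S -> semiskew c (fun=> 0) x ->
  semiskew (b (+) c) (fun=> 0) (fun z => S (x z) - koszul b c (x (S z))).
Proof.
move=> sS sx; apply: (eq_semiskew _ (semiskew_scomm sS sx)) => a.
by rewrite (hmap0 GA (ss_fmap sS)) koszul0 subr0.
Qed.

Lemma osp_sbr x y : osp x -> osp y -> osp (sbr gM x y).
Proof.
move=> xo yo.
have S b c := semiskew_scomm0 (osp_semiskew (osp_hmap b xo) (osp_epart b xo))
  (osp_semiskew (osp_hmap c yo) (osp_epart c yo)).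
have O b c := semiskew_osp (S b c).
rewrite sbr_epart /=; exact: (osp_add (osp_add (O true true) (O true false))
                                      (osp_add (O false true) (O false false))).
Qed.

Lemma semiskew_homog_opE b c u v : homog gM b u -> homog gM c v ->
  semiskew (b (+) c) (fun=> 0) (opE gA gM q u v).
Proof.
move=> hu hv; have [hm hl] := hend_opE hu hv; split=> //.
- exact: (hmap_const0 GA).
- by move=> e a w ha; rewrite (hl e) // scale0r add0r.
- move=> e w z hw; move: z; apply: (grading_ind (g := gM)) => [x y E E'|f z hz].
    by rewrite opEDw !qDr koszulD -[LHS]addr0 {1}E E'; zmod.
  rewrite (opE_homog hu hv hw) (opE_homog hu hv hz) !(qDl, qNl, qDr, qNr).
  rewrite !(q_koszull, q_koszulr) !qZl.
  rewrite (qZr _ (q_homog hv hz) hw) (qZr _ (q_homog hu hz) hw).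
  rewrite (q_sym hw hu) (q_sym hw hv).
  rewrite (_ : q v z * koszul e b (q u w) = koszul e b (q v z * q u w)); last first.
    by rewrite /koszul; case: (e && b); rewrite ?mulrN.
  rewrite (_ : q u z * koszul e c (q v w) = koszul e c (q u z * q v w)); last first.
    by rewrite /koszul; case: (e && c); rewrite ?mulrN.
  rewrite (commA (q_homog hv hz) (q_homog hu hw)).
  rewrite (commA (q_homog hu hz) (q_homog hv hw)) /koszul.
  by case: b c e f {hu hv hw hz hm hl} => [] [] [] [] /=; zmod.
Qed.

Lemma osp_opE u v : osp (opE gA gM q u v).
Proof.
move: u; apply: (grading_ind (g := gM)) => [x y E E'|b u hu].
  have -> : opE gA gM q (x + y) v = fun w => opE gA gM q x v w + opE gA gM q y v w.
    by apply/funext => w; rewrite opEDl.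
  exact: osp_add.
move: v; apply: (grading_ind (g := gM)) => [x y E E'|c v hv].
  have -> : opE gA gM q u (x + y) = fun w => opE gA gM q u x w + opE gA gM q u y w.
    by apply/funext => w; rewrite opEDr.
  exact: osp_add.
exact: semiskew_osp (semiskew_homog_opE hu hv).
Qed.

(** * The basis and the orthosymplectic maps with finitely many diagonals *)

Variables (I : set rat) (m : rat -> M).
Hypothesis hI : I = Zidx \/ I = halfZidx.
Hypothesis basis_m : homog_basis gM I m.
Hypothesis values_q : standard_values I m q.
Hypothesis invZ : forall n : int, n != 0 -> exists y : A, inverse_of n%:~R y.

Local Notation coord := (Defs.coord I m).
Local Notation opE := (opE gA gM q).

Let ex1 : forall v, exists! c, expansion I m v c.
Proof. by case: basis_m. Qed.

Definition parity (i : rat) : bool := i \isn't a Num.int.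

(* The integer [z = 2 i] is odd, and [z = 2 k + 1] gives [i + 1/2 = k + 1]. *)
Lemma half_parity i : halfZidx i -> parity i -> oddidx i.
Proof.
rewrite /halfZidx /oddidx /parity /= => /intrP[z iE] ni; apply/intrP.
have two0 : 2%:R != 0 :> rat by [].
have iz : i = z%:~R / 2%:R by rewrite -iE -(mulr_natr i) mulfK.
have := divz_eq z 2; have := modz_ge0 z (d := 2) isT.
have := ltz_pmod z (d := 2) isT.
move: (z %/ 2)%Z (z %% 2)%Z => k r; case: r => // -[|[|//]] _ _ zE.
  case/negP: ni; rewrite iz zE addr0 intrM mulfK //; exact: intr_int.
exists (k + 1).
by rewrite iz zE !intrD intrM mulrDl mulfK // -addrA; congr (_ + _).
Qed.

Lemma I_half i : I i -> halfZidx i.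
Proof.
by case: hI => -> //; rewrite /Zidx /halfZidx /= => ii; exact: rpredMn.
Qed.

Lemma I_opp i : I i -> I (- i).
Proof.
by case: hI => ->; rewrite /Zidx /halfZidx /= ?mulNrn rpredN.
Qed.

Lemma I_int (n : int) : I n%:~R.
Proof.
have ni : (n%:~R : rat) \is a Num.int by exact: intr_int.
by case: hI => ->; rewrite /Zidx /halfZidx /= ?rpredMn.
Qed.

Lemma parity_opp i : parity (- i) = parity i.
Proof. by rewrite /parity rpredN. Qed.

Lemma parity_int (n : int) : parity n%:~R = false.
Proof. by rewrite /parity intr_int. Qed.

Lemma homog_basis_vec i : I i -> homog gM (parity i) (m i).
Proof.
move=> Ii; have [_ ev od] := basis_m.
case: (boolP (parity i)) => [pi|]; first by apply: od => //; exact: half_parity (I_half Ii) pi.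
by rewrite negbK => pi; exact: ev.
Qed.

Lemma q_basis_off i j : I i -> I j -> i != - j -> q (m i) (m j) = 0.
Proof.
move=> Ii Ij /negPf nij; have [qe qo qm] := values_q.
case: (boolP (parity i)) => [pi|]; case: (boolP (parity j)) => [pj|]; rewrite ?negbK.
- by rewrite qo ?nij //; apply: half_parity => //; exact: I_half.
- move=> pj; rewrite (q_sym (homog_basis_vec Ii) (homog_basis_vec Ij)).
  rewrite qm ?koszul0 //; apply: half_parity => //; exact: I_half.
- by move=> pi; rewrite qm //; apply: half_parity => //; exact: I_half.
- by move=> pj pi; rewrite qe ?nij.
Qed.

Lemma q_basis_opp i : I i -> exists n, q (m i) (m (- i)) = (-1) ^+ n.
Proof.
move=> Ii; have [qe qo _] := values_q; have IN := I_opp Ii.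
have hi := I_half Ii; have hN := I_half IN.
case: (boolP (parity i)) => [pi|pi].
  rewrite qo ?opprK ?eqxx //; [by eexists|exact: half_parity|].
  by apply: half_parity; rewrite ?parity_opp.
rewrite negbK in pi.
by rewrite qe ?opprK ?eqxx //; [eexists|rewrite /Zidx /= rpredN].
Qed.

Lemma coord_part b v i : I i ->
  coord (gM b v) i = gA (b (+) parity i) (coord v i).
Proof.
move=> Ii; move: v; apply: (basis_ind ex1).
- by rewrite (graded_part0 GM) !(coord0 ex1) (graded_part0 GA).
- move=> u v E E'; rewrite (graded_partD GM) // !(coordD ex1).
  by rewrite (graded_partD GA) // E E'.
- move=> j a Ij; rewrite (part_scale _ _ (homog_basis_vec Ij)).
  rewrite !(coord_scale_basis ex1) //; case: eqP => [->//|_].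
  by rewrite (graded_part0 GA).
Qed.

Lemma homog_basis_ind b (P : M -> Prop) : P 0 ->
  (forall u v, homog gM b u -> homog gM b v -> P u -> P v -> P (u + v)) ->
  (forall i a, I i -> homog gA (b (+) parity i) a -> P (a *: m i)) ->
  forall v, homog gM b v -> P v.
Proof.
move=> P0 PD Pm v hv.
have [s [us sI /(_ v (mem_head _ _))[_ vE]]] := coord_seq ex1 [:: v].
have hc i : I i -> homog gA (b (+) parity i) (coord v i).
  by move=> Ii; rewrite /homog -coord_part // hv.
have hm i : I i -> homog gM b (coord v i *: m i).
  move=> Ii; have := superM (hc i Ii) (homog_basis_vec Ii).
  by rewrite -addbA addbb addbF.
have [_ Ps] : homog gM b (\sum_(i <- s) coord v i *: m i) /\
    P (\sum_(i <- s) coord v i *: m i).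
  rewrite big_seq; apply: (big_ind (fun w => homog gM b w /\ P w)).
  - by split=> //; exact: (homog0 GM).
  - by move=> x y [hx Px] [hy Py]; split; [exact: (homogD GM)|exact: PD].
  - by move=> i /sI Ii; split; [exact: hm|apply: Pm => //; exact: hc].
by rewrite vE.
Qed.

Lemma homog_coeff_ind (P : M -> Prop) : P 0 ->
  (forall u v, P u -> P v -> P (u + v)) ->
  (forall i b a, I i -> homog gA b a -> P (a *: m i)) -> forall v, P v.
Proof.
move=> P0 PD Pm; apply: (basis_ind ex1) => // i a Ii.
move: a; apply: (grading_ind (g := gA)) => [x y|b a ha]; last exact: (Pm i b).
by rewrite scalerDl; exact: PD.
Qed.

Lemma hend_basis0 b x : hend b x -> (forall i, I i -> x (m i) = 0) ->
  forall v, x v = 0.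
Proof.
move=> hx x0; apply: homog_coeff_ind.
- exact: (hmap0 GM (hend_map hx)).
- by move=> u v E E'; rewrite (hmapD (hend_map hx)) // E E' addr0.
- by move=> i c a Ii ha; rewrite (hendZ _ hx ha) x0 // scaler0 koszul0.
Qed.

Lemma scale_inj (a a' : A) : (forall v : M, a *: v = a' *: v) -> a = a'.
Proof.
move=> E; have I0 := I_int 0.
have := congr1 (fun v => coord v 0%:~R) (E (m 0%:~R)).
by rewrite !(coord_scale_basis ex1) // eqxx.
Qed.

(** ** Finitely many diagonals *)

Definition fin_diag (x : M -> M) : Prop :=
  exists D : seq rat, forall i j, I i -> I j -> coord (x (m j)) i != 0 -> i - j \in D.

Lemma fin_diag0 : fin_diag (fun=> 0).
Proof. by exists [::] => i j _ _; rewrite (coord0 ex1) eqxx. Qed.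

Lemma fin_diag_sub x y : fin_diag x -> fin_diag y -> fin_diag (fun v => x v - y v).
Proof.
move=> [D xD] [D' yD]; exists (D ++ D') => i j Ii Ij.
rewrite (coordB ex1) mem_cat; apply: contraR; rewrite negb_or => /andP[nD nD'].
have /eqP-> : coord (x (m j)) i == 0 by apply: contraR nD; exact: xD.
have /eqP-> : coord (y (m j)) i == 0 by apply: contraR nD'; exact: yD.
by rewrite subr0.
Qed.

Lemma fin_diag_add x y : fin_diag x -> fin_diag y -> fin_diag (fun v => x v + y v).
Proof.
move=> fx fy; have -> : (fun v => x v + y v) = (fun v => x v - (0 - y v)).
  by apply/funext => v; zmod.
by apply: fin_diag_sub => //; apply: fin_diag_sub => //; exact: fin_diag0.
Qed.

Lemma fin_diag_scale a x : fin_diag x -> fin_diag (fun v => a *: x v).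
Proof.
move=> [D xD]; exists D => i j Ii Ij; rewrite (coordZ ex1) => ci.
by apply: xD => //; apply: contraNneq ci => ->; rewrite mulr0.
Qed.

Lemma fin_diag_koszul b c x : fin_diag x -> fin_diag (fun v => koszul b c (x v)).
Proof.
move=> fx; have -> : (fun v => koszul b c (x v)) =
    (fun v => (if b && c then -1 else 1) *: x v).
  by apply/funext => v; rewrite /koszul; case: ifP; rewrite ?scaleN1r ?scale1r.
exact: fin_diag_scale.
Qed.

Lemma osp_at0 x : osp x -> x 0 = 0.
Proof. by move=> [[xD _] _]; apply: (additive_on0 GM (f := x)) => *; exact: xD. Qed.

Lemma fin_diag_epart b x : x 0 = 0 -> fin_diag x -> fin_diag (epart gM b x).
Proof.
move=> x0 [D xD]; exists D => i j Ii Ij.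
rewrite (epart_homog _ x0 (homog_basis_vec Ij)) coord_part // => ci.
by apply: xD => //; apply: contraNneq ci => ->; rewrite (graded_part0 GA).
Qed.

(** If the diagonals of [x] and [y] have indices in [D] and [D'], those of their
    composite have indices in [D + D']. *)
Lemma fin_diag_comp b x y : hend b x -> fin_diag x -> fin_diag y ->
  fin_diag (fun v => x (y v)).
Proof.
move=> hx [D xD] [D' yD]; exists [seq d + d' | d <- D, d' <- D'] => i j Ii Ij.
apply: contraR => nD.
have [s [us sI /(_ _ (mem_head _ _))[_ ->]]] := coord_seq ex1 [:: y (m j)].
rewrite big_seq; apply/eqP.
apply: (big_ind (fun v => coord (x v) i = 0)).
- by rewrite (hmap0 GM (hend_map hx)) (coord0 ex1).
- by move=> u v E E'; rewrite (hmapD (hend_map hx)) // (coordD ex1) E E' addr0.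
move=> k /sI Ik; have [->|ck] := eqVneq (coord (y (m j)) k) 0.
  by rewrite scale0r (hmap0 GM (hend_map hx)) (coord0 ex1).
have xk : coord (x (m k)) i = 0.
  apply/eqP; apply: contraR nD => xk; apply/allpairsP.
  exists (i - k, k - j); split; [exact: xD|exact: yD|].
  by rewrite /= addrA subrK.
move: (coord (y (m j)) k); apply: (grading_ind (g := gA)) => [a a' E E'|c a ha].
  by rewrite scalerDl (hmapD (hend_map hx)) // (coordD ex1) E E' addr0.
rewrite (hendZ _ hx ha) /koszul.
by case: (b && c); rewrite ?(coordN ex1) (coordZ ex1) xk mulr0 ?oppr0.
Qed.

Local Notation E := (osp_fd gA gM I m q).

Lemma E_osp x : E x -> osp x. Proof. by case. Qed.

Lemma E0 : E (fun=> 0).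
Proof. by split; [exact: osp0|exact: fin_diag0]. Qed.

Lemma E_sub x y : E x -> E y -> E (fun v => x v - y v).
Proof.
by move=> [xo xf] [yo yf]; split; [exact: osp_sub|exact: fin_diag_sub].
Qed.

Lemma E_add x y : E x -> E y -> E (fun v => x v + y v).
Proof.
by move=> [xo xf] [yo yf]; split; [exact: osp_add|exact: fin_diag_add].
Qed.

Lemma E_scale a x : E x -> E (fun v => a *: x v).
Proof. by move=> [xo xf]; split; [exact: osp_scale|exact: fin_diag_scale]. Qed.

Lemma E_epart b x : E x -> E (epart gM b x).
Proof.
move=> [xo xf]; split; first exact: osp_epart.
by apply: fin_diag_epart => //; exact: osp_at0.
Qed.

Lemma E_sbr x y : E x -> E y -> E (sbr gM x y).
Proof.
move=> xE yE; split; first by apply: osp_sbr; exact: E_osp.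
have [hx hy] : (forall b, hend b (epart gM b x)) /\ (forall b, hend b (epart gM b y)).
  by case: xE yE => [[xo _] _] [[yo _] _]; split=> b; exact: EndA_epart.
have fx b : fin_diag (epart gM b x) by case: (E_epart b xE).
have fy b : fin_diag (epart gM b y) by case: (E_epart b yE).
have S b c : fin_diag (fun z => epart gM b x (epart gM c y z) -
    koszul b c (epart gM c y (epart gM b x z))).
  apply: fin_diag_sub; first exact: (fin_diag_comp (hx b)).
  by apply: fin_diag_koszul; exact: (fin_diag_comp (hy c)).
rewrite sbr_epart /=.
exact: (fin_diag_add (fin_diag_add (S true true) (S true false))
                     (fin_diag_add (S false true) (S false false))).
Qed.

(** Only the entries at [(i, -j)] and [(j, -i)] can be nonzero, and both lie on
    the diagonal [i + j]. *)
Lemma fin_diag_opE i j a b (c e : bool) : I i -> I j -> homog gA c a -> homog gA e b ->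
  fin_diag (opE (a *: m i) (b *: m j)).
Proof.
move=> Ii Ij ha hb; exists [:: i + j] => k l Ik Il.
have hi := homog_basis_vec Ii; have hj := homog_basis_vec Ij.
rewrite (opE_homog (superM ha hi) (superM hb hj) (homog_basis_vec Il)) !qZl.
rewrite (coordB ex1) inE; apply: contraR => nk.
have kos b1 b2 v : coord v k = 0 -> coord (koszul b1 b2 v) k = 0.
  by rewrite /koszul; case: (b1 && b2); rewrite // (coordN ex1) => ->; rewrite oppr0.
have z1 i' j' a' b' : I i' -> I j' -> k - l != i' + j' ->
    coord (a' * q (m j') (m l) *: (b' *: m i')) k = 0.
  move=> Ii' Ij' nk'; rewrite !(coordZ ex1) (coord_basis ex1) //.
  case: eqP => [kE|]; last by rewrite !mulr0.
  rewrite q_basis_off // ?mulr0 ?mul0r //; apply: contraNneq nk' => ->.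
  by rewrite kE addrC.
by rewrite !kos ?subr0 //; apply: z1 => //; rewrite (addrC j).
Qed.

Lemma E_opE u v : E (opE u v).
Proof.
split; first exact: osp_opE.
move: u; apply: (homog_coeff_ind (P := fun u => fin_diag (opE u v))).
- rewrite (_ : opE 0 v = fun=> 0); first exact: fin_diag0.
  by apply/funext => w; rewrite opE0l.
- move=> x y fx fy; rewrite (_ : opE (x + y) v = fun w => opE x v w + opE y v w).
    exact: fin_diag_add.
  by apply/funext => w; rewrite opEDl.
move=> i b a Ii ha; move: v.
apply: (homog_coeff_ind (P := fun v => fin_diag (opE (a *: m i) v))).
- rewrite (_ : opE _ 0 = fun=> 0); first exact: fin_diag0.
  by apply/funext => w; rewrite opE0r.
- move=> x y fx fy.
  rewrite (_ : opE _ (x + y) = fun w => opE (a *: m i) x w + opE (a *: m i) y w).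
    exact: fin_diag_add.
  by apply/funext => w; rewrite opEDr.
by move=> j c b' Ij hb; exact: (fin_diag_opE _ _ ha hb).
Qed.

(** * Semilinear maps acting on coordinates *)

Section Leibniz.
Variables (b : bool) (D : A -> A).
Hypotheses (Dmap : hmap gA setT b D) (DM : leibniz gA *%R setT b D).

Lemma leibniz_one : D 1 = 0.
Proof.
have := DM Logic.I Logic.I homog_one (y := 1).
rewrite mulr1 koszulf mul1r mulr1 => /eqP.
by rewrite -subr_eq subrr => /eqP.
Qed.

Lemma leibniz_sign n : D ((-1) ^+ n) = 0.
Proof.
elim: n => [|n IH]; first exact: leibniz_one.
by rewrite exprS mulN1r (hmapN GA Dmap) // IH oppr0.
Qed.

(** Both sides of the invariance of [q] obey the same product rules, so that it
    is enough to check it on the basis. *)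
Lemma semiskew_basis (S : M -> M) : hmap gM setT b S ->
    (forall c a v, homog gA c a -> S (a *: v) = D a *: v + koszul b c (a *: S v)) ->
    (forall i j, I i -> I j -> D (q (m i) (m j)) =
       q (S (m i)) (m j) + koszul b (parity i) (q (m i) (S (m j)))) ->
  semiskew b D S.
Proof.
move=> Sm Sa Sq; split=> // c u v; move: u; apply: homog_basis_ind.
- by rewrite (hmap0 GM Sm) !q0l (hmap0 GA Dmap) koszul0 addr0.
- move=> u u' hu hu' E1 E2; rewrite (hmapD Sm) // !qDl (hmapD Dmap) //.
  by rewrite E1 E2 koszulD; zmod.
move=> i a Ii ha; have hi := homog_basis_vec Ii.
move: v; apply: homog_coeff_ind.
- by rewrite (hmap0 GM Sm) !q0r (hmap0 GA Dmap) koszul0 addr0.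
- move=> v v' E1 E2; rewrite (hmapD Sm) // !qDr (hmapD Dmap) //.
  by rewrite E1 E2 koszulD; zmod.
move=> j e a' Ij ha'; have hj := homog_basis_vec Ij.
have hS := hmap_homog Sm Logic.I hi.
have hD := hmap_homog Dmap Logic.I ha'.
rewrite (Sa _ _ _ ha) (Sa _ _ _ ha') qDl qDr q_koszull q_koszulr !qZl.
rewrite (qZr _ ha' hi) (qZr _ ha' hS) (qZr _ hD hi) (qZr _ ha' hi).
have kos b1 b2 (x y : A) : x * koszul b1 b2 y = koszul b1 b2 (x * y).
  by rewrite /koszul; case: (b1 && b2); rewrite ?mulrN.
rewrite !kos (hmap_koszul GA _ _ Dmap) // (DM Logic.I Logic.I ha).
rewrite (DM Logic.I Logic.I ha') Sq // /koszul.
by case: (b) (parity i) (c) (e) => [] [] [] [] /=;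
  rewrite ?(mulrDr, mulrN, mulNr, mulrDl); zmod.
Qed.

Lemma hmap_coordwise c (F : rat -> A -> A) : (forall i, hmap gA setT c (F i)) ->
  hmap gM setT c (coordwise I m F).
Proof.
move=> hF; have FD i a a' : F i (a + a') = F i a + F i a' by exact: (hmapD (hF i)).
split=> // [u v _ _|d v _]; first exact: (coordwiseD ex1).
move: v; apply: homog_basis_ind => [|u v hu hv E1 E2|i a Ii ha].
- have -> : coordwise I m F 0 = 0; last exact: (homog0 GM).
  by have := coordwiseD ex1 FD 0 0; rewrite addr0 => /addrr_eq.
- by rewrite (coordwiseD ex1) //; exact: (homogD GM).
rewrite (coordwise_basis ex1) //.
have := superM (hmap_homog (hF i) Logic.I ha) (homog_basis_vec Ii).
by rewrite -!addbA addbb addbF.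
Qed.

Definition lift_der : M -> M := coordwise I m (fun _ => D).

Lemma lift_scale c a v : homog gA c a ->
  lift_der (a *: v) = D a *: v + koszul b c (a *: lift_der v).
Proof.
have DD (i : rat) x y : D (x + y) = D x + D y by exact: (hmapD Dmap).
have l0 : lift_der 0 = 0.
  by have := coordwiseD ex1 DD 0 0; rewrite addr0 => /addrr_eq.
move=> ha; move: v; apply: (basis_ind ex1) => [|u v E1 E2|i a' Ii].
- by rewrite !scaler0 l0 scaler0 koszul0 addr0.
- have LD x y : lift_der (x + y) = lift_der x + lift_der y := coordwiseD ex1 DD x y.
  rewrite scalerDr !LD E1 E2.
  by rewrite !scalerDr koszulD; zmod.
rewrite scalerA /lift_der !(coordwise_basis ex1) // (DM Logic.I Logic.I ha) scalerDl scalerA.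
by rewrite /koszul; case: (b && c); rewrite ?scaleNr scalerA.
Qed.

Lemma lift_basis i : I i -> lift_der (m i) = 0.
Proof.
move=> Ii; rewrite -[m i]scale1r /lift_der (coordwise_basis ex1) ?leibniz_one ?scale0r //.
by move=> _ x y; exact: (hmapD Dmap).
Qed.

(** On the basis, invariance of [q] says that [D] kills the values of [q], and
    these are 0 and signs. *)
Lemma semiskew_lift : semiskew b D lift_der.
Proof.
apply: semiskew_basis; [exact: hmap_coordwise|exact: lift_scale|].
move=> i j Ii Ij; rewrite !lift_basis // q0l q0r koszul0 addr0.
have [->|ij] := eqVneq i (- j).
  have [n] := q_basis_opp (I_opp Ij); rewrite opprK => ->; exact: leibniz_sign.
by rewrite q_basis_off // (hmap0 GA Dmap).
Qed.

Lemma fin_diag_lift c x : hend c x -> fin_diag x ->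
  fin_diag (fun v => lift_der (x v) - koszul b c (x (lift_der v))).
Proof.
move=> hx [F xF]; exists F => i j Ii Ij; rewrite lift_basis //.
rewrite (hmap0 GM (hend_map hx)) koszul0 subr0 /lift_der (coord_coordwise ex1) //.
  move=> ci; apply: xF => //; apply: contraNneq ci => ->.
  by rewrite (hmap0 GA Dmap).
by move=> _ y z; exact: (hmapD Dmap).
Qed.

End Leibniz.

(** ** The degree operator and self-normalization *)

Lemma homog_int (n : int) : homog gA false n%:~R.
Proof.
have hn k : homog gA false k%:R.
  elim: k => [|k IH]; first exact: (homog0 GA).
  by rewrite -addn1 natrD; apply: (homogD GA) => //; exact: homog_one.
by case: n => n; [exact: hn|rewrite NegzE mulrNz; apply: (homogN GA) => //; exact: hn].
Qed.

(** The factor 2 makes the degrees of half-integral indices integers. *)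
Definition degree (i : rat) : int := Num.floor (i *+ 2).

Lemma degreeE i : I i -> (degree i)%:~R = i *+ 2.
Proof. by move=> /I_half ii; rewrite /degree floorK. Qed.

Definition degree_op : M -> M := coordwise I m (fun i a => (degree i)%:~R * a).

Lemma degree_op_basis a i : I i -> degree_op (a *: m i) = (degree i)%:~R *: (a *: m i).
Proof.
move=> Ii; rewrite /degree_op (coordwise_basis ex1) ?scalerA //.
by move=> k x y; rewrite mulrDr.
Qed.

Lemma leibniz_const0 : leibniz gA *%R setT false (fun=> 0 : A).
Proof. by move=> c x y _ _ _; rewrite mul0r mulr0 koszul0 addr0. Qed.

Lemma semiskew_degree : semiskew false (fun=> 0) degree_op.
Proof.
have hF i : hmap gA setT false (fun a => (degree i)%:~R * a).
  split=> // [x y _ _|c a _ ha]; first by rewrite mulrDr.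
  by apply: superA => //; exact: homog_int.
have hm : hmap gM setT false degree_op := hmap_coordwise hF.
apply: (semiskew_basis (hmap_const0 GA _) leibniz_const0) => //.
- move=> c a v ha; rewrite scale0r add0r /=.
  move: v; apply: (basis_ind ex1) => [|u v E1 E2|i a' Ii].
  + by rewrite scaler0 (hmap0 GM hm) scaler0.
  + by rewrite scalerDr !(hmapD hm) // E1 E2 scalerDr.
  + by rewrite scalerA !degree_op_basis // !scalerA commr_int mulrA.
- move=> i j Ii Ij; rewrite -[m i]scale1r -[m j]scale1r.
  rewrite !degree_op_basis // !scale1r qZl (qZr _ (homog_int _) (homog_basis_vec Ii)).
  rewrite /koszul /= -mulrDl; have [->|ij] := eqVneq i (- j); last first.
    by rewrite q_basis_off ?mulr0.
  have -> : degree (- j) = - degree j.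
    apply: (@intr_inj rat); rewrite mulrNz !degreeE ?mulNrn //; exact: I_opp.
  by rewrite mulrNz addNr mul0r.
Qed.

Lemma E_degree : E degree_op.
Proof.
split; first exact: semiskew_osp semiskew_degree.
exists [:: 0] => i j Ii Ij; rewrite -[m j]scale1r degree_op_basis // scale1r.
rewrite (coordZ ex1) (coord_basis ex1) // inE subr_eq0.
by case: (i == j); rewrite ?mulr0 ?eqxx.
Qed.

(** The bracket with the degree operator multiplies the entry [a_ij] by
    [2 (j - i)], which is invertible off the main diagonal. *)
Lemma E_self_normalizing : self_normalizing gA gM q E.
Proof.
move=> x xo xN; split=> //.
have hx b := EndA_epart b xo.1.
have hH := ss_map semiskew_degree.
have [_ [D HD]] := xN _ E_degree; exists (0 :: D) => i j Ii Ij ci.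
rewrite inE subr_eq0; case: eqVneq => //= nij; apply: HD => //.
have -> : sbr gM x degree_op (m j) = ((degree j)%:~R - (degree i)%:~R) *: x (m j) +
    ((degree i)%:~R *: x (m j) - degree_op (x (m j))).
  rewrite (sbr_sum GM (f' := fun b => epart gM b x)
    (g' := fun b => if b then fun=> 0 else degree_op)) //; first last.
  - by move=> z _; rewrite addr0.
  - by move=> z _; exact: osp_sum.
  - by case=> //; exact: (hmap_const0 GM).
  - by move=> b; case: (hx b).
  have Hj : degree_op (m j) = (degree j)%:~R *: m j.
    by rewrite -{1}[m j]scale1r degree_op_basis // scale1r.
  rewrite !big_bool /= !koszulf Hj !(hendZ _ (hx _) (homog_int _)) !koszulf.
  rewrite !(hmap0 GM (hend_map (hx _))) /koszul /=.
  rewrite [in RHS](osp_sum (m j) xo) (hmapD hH) // scalerBl !scalerDr; zmod.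
rewrite (coordD ex1) (coordB ex1) !(coordZ ex1) (coord_coordwise ex1) //; last first.
  by move=> k a a'; rewrite mulrDr.
rewrite subrr addr0 -mulrzBr /=.
have dji : degree j - degree i != 0.
  rewrite subr_eq0; apply: contraNneq nij => /(congr1 (fun n : int => n%:~R : rat)).
  rewrite !degreeE // => /eqP; rewrite -(mulr_natr j) -(mulr_natr i).
  by rewrite (inj_eq (mulIf _)) // eq_sym.
have [y [_ y1]] := invZ dji.
by apply: contraNneq ci => c0; rewrite -[coord _ _]mul1r -y1 -mulrA c0 mulr0.
Qed.

(** * The Lie superalgebra E_oo *)

Variables (K : pzRingType) (gK : grading K) (iota : {rmorphism K -> A}).
Hypothesis iota_homog : forall b k, homog gK b k -> homog gA b (iota k).

Local Notation T := (Tinf M).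
Local Notation L := (Einf E).
Local Notation p := (Einf_part gA gM).
Local Notation la := (Einf_act iota).
Local Notation mul := (Einf_mul gA gM q).

Lemma TinfD (a a' : A) (u u' v v' : M) (x x' : M -> M) :
  (a, u, v, x) + (a', u', v', x') =
    (a + a', u + u', v + v', fun w => x w + x' w) :> T.
Proof. by []. Qed.

Lemma TinfN (a : A) (u v : M) (x : M -> M) :
  - ((a, u, v, x) : T) = (- a, - u, - v, fun w => - x w).
Proof. by []. Qed.

Lemma koszul_Tinf b c (a : A) (u v : M) (x : M -> M) :
  koszul b c ((a, u, v, x) : T) =
    (koszul b c a, koszul b c u, koszul b c v, fun w => koszul b c (x w)).
Proof. by rewrite /koszul; case: (b && c). Qed.

Lemma eq_Tinf (a a' : A) (u u' v v' : M) (x x' : M -> M) :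
  a = a' -> u = u' -> v = v' -> x =1 x' -> (a, u, v, x) = (a', u', v', x') :> T.
Proof. by move=> -> -> -> /funext->. Qed.

Lemma epartB b x y z : epart gM b (fun w => x w - y w) z = epart gM b x z - epart gM b y z.
Proof. by rewrite /epart !big_bool /= !(graded_partB GM) //; zmod. Qed.

Lemma E_hmap b x : E x -> hmap gM setT b (epart gM b x).
Proof. by move=> /E_osp; exact: osp_hmap. Qed.

Lemma graded_Einf : graded p L.
Proof.
split.
- exact: E0.
- by move=> [[[a u] v] x] [[[a' u'] v'] x'] Ex Ex'; exact: (E_sub Ex Ex').
- by move=> b [[[a u] v] x] Ex; exact: (E_epart b Ex).
- move=> b [[[a u] v] x] [[[a' u'] v'] x'] _ _.
  apply: eq_Tinf; rewrite ?partB // => w; exact: epartB.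
- move=> b c [[[a u] v] x] Ex /=.
  have -> : (if b == c then (gA c a, gM c u, gM c v, epart gM c x) else 0) =
    (if b == c then gA c a else 0, if b == c then gM c u else 0,
     if b == c then gM c v else 0, fun w => if b == c then epart gM c x w else 0) :> T.
    by case: (b == c).
  apply: eq_Tinf; rewrite ?part_part // => w.
  by rewrite (epart_hmap GM _ (E_hmap c Ex)).
- move=> [[[a u] v] x] Ex; apply: eq_Tinf; rewrite ?part_sum // => w.
  by rewrite [RHS](osp_sum w (E_osp (Ex : E x))).
Qed.

Lemma homog_Einf c a u v x : E x -> homog p c ((a, u, v, x) : T) <->
  [/\ homog gA c a, homog gM c u, homog gM c v & hmap gM setT c x].
Proof.
move=> /E_osp[[xD _] _]; split=> [[ha hu hv hx]|[ha hu hv hx]].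
  by split=> //; apply/homog_epart.
by apply: eq_Tinf => //; move=> w; move/homog_epart: hx => ->.
Qed.

Lemma E_hend c x : E x -> hmap gM setT c x -> hend c x.
Proof. by move=> /E_osp[xE _] hx; exact: hend_EndA. Qed.

Lemma E_semiskew c x : E x -> hmap gM setT c x -> semiskew c (fun=> 0) x.
Proof. by move=> /E_osp xo hx; exact: osp_semiskew. Qed.

Lemma module_Einf : graded_module gK p la L.
Proof.
split; first exact: graded_Einf.
- by move=> k [[[a u] v] x] Ex; exact: (E_scale (iota k) Ex).
- move=> k [[[a u] v] x] [[[a' u'] v'] x'] _ _; rewrite TinfD /= TinfD.
  by apply: eq_Tinf => [|||w] /=; rewrite ?mulrDr ?scalerDr.
- move=> [[[a u] v] x] _ /=.
  by apply: eq_Tinf => [|||w] /=; rewrite rmorph0 ?mul0r ?scale0r.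
- move=> b c k [[[a u] v] x] hk Ex /(homog_Einf _ _ _ _ Ex)[ha hu hv hx].
  apply/(homog_Einf _ _ _ _ (E_scale (iota k) Ex)).
  have hi := iota_homog hk; split; [exact: superA|exact: superM|exact: superM|].
  exact: (hmap_comp (hend_map (hend_scalar hi)) hx).
Qed.

Lemma signed_appDl x y v : signed_app gM (fun w => x w + y w) v =
  signed_app gM x v + signed_app gM y v.
Proof.
rewrite /signed_app /epart !big_bool /koszul /= !(graded_partD GM) //; zmod.
Qed.

Lemma signed_appDr x u v : E x -> signed_app gM x (u + v) =
  signed_app gM x u + signed_app gM x v.
Proof.
move=> Ex; have xD b := hmapD (E_hmap b Ex) Logic.I Logic.I.
by rewrite /signed_app !big_bool /koszul /= !(graded_partD GM) // !xD; zmod.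
Qed.

Lemma epartD b x y z : epart gM b (fun w => x w + y w) z = epart gM b x z + epart gM b y z.
Proof. by rewrite /epart !big_bool /= !(graded_partD GM) //; zmod. Qed.

Lemma epart_additive b x : (forall u v, x (u + v) = x u + x v) ->
  forall u v, epart gM b x (u + v) = epart gM b x u + epart gM b x v.
Proof.
by move=> xA u v; rewrite /epart !big_bool /= !(graded_partD GM) // !xA
  !(graded_partD GM) //; zmod.
Qed.

Lemma sbrDl x y z w : (forall u v, z (u + v) = z u + z v) ->
  sbr gM (fun w => x w + y w) z w = sbr gM x z w + sbr gM y z w.
Proof.
move=> zA; have zD b := epart_additive b zA.
by rewrite !sbr_epart /koszul /= !epartD !zD; zmod.
Qed.

Lemma sbrDr x y z w : (forall u v, x (u + v) = x u + x v) ->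
  sbr gM x (fun w => y w + z w) w = sbr gM x y w + sbr gM x z w.
Proof.
move=> xA; have xD b := epart_additive b xA.
by rewrite !sbr_epart /koszul /= !epartD !xD; zmod.
Qed.

Lemma E_additive x : E x -> forall u v, x (u + v) = x u + x v.
Proof. by case=> [[[]]]. Qed.

Lemma Einf_mem_mul x y : L x -> L y -> L (mul x y).
Proof.
case: x y => [[[a u] v] x] [[[a' u'] v'] x'] Ex Ex'.
have := E_add (E_add (E_opE u v') (E_opE v u')) (E_sbr Ex Ex'); exact.
Qed.

(** With all scalars on the left, the components of nested products can be
    compared term by term. *)
Lemma mulE c e (a a' : A) (u v u' v' : M) (x x' : M -> M) :
    homog gM c u -> homog gM c v -> hmap gM setT c x ->
    homog gA e a' -> hmap gM setT e x' ->
  mul (a, u, v, x) (a', u', v', x') =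
    (q u v' - q v u',
     a *: u' + x u' - koszul e c (a' *: u) - koszul e c (x' u),
     - (a *: v') + x v' + koszul e c (a' *: v) - koszul e c (x' v),
     fun w => opE u v' w + opE v u' w + (x (x' w) - koszul c e (x' (x w)))).
Proof.
move=> hu hv hx ha' hx'; apply: eq_Tinf => // [||w].
- by rewrite (rscale_homog ha' hu) (signed_app_homog hx' hu).
- by rewrite (rscale_homog ha' hv) (signed_app_homog hx' hv).
- by rewrite (sbr_hmap GM hx hx').
Qed.

Lemma product_Einf : graded_product p mul L.
Proof.
split; first exact: Einf_mem_mul.
- move=> [[[a u] v] x] [[[a1 u1] v1] x1] [[[a' u'] v'] x'] Ex Ex1 Ex'.
  rewrite TinfD /= TinfD; apply: eq_Tinf => [|||w]; rewrite ?qDl ?scalerDl ?rscaleDl.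
  + by zmod.
  + by rewrite signed_appDr //; zmod.
  + by rewrite signed_appDr //; zmod.
  + by rewrite !opEDl sbrDl; [zmod|exact: E_additive].
- move=> [[[a u] v] x] [[[a1 u1] v1] x1] [[[a' u'] v'] x'] Ex Ex1 Ex'.
  rewrite TinfD /= TinfD; apply: eq_Tinf => [|||w];
    rewrite ?qDr ?scalerDr ?rscaleDr ?signed_appDl ?(E_additive (Ex : E x)).
  + by zmod.
  + by zmod.
  + by zmod.
  + by rewrite !opEDr sbrDr; [zmod|exact: E_additive].
- move=> c e [[[a u] v] x] [[[a' u'] v'] x'] Ex Ex'.
  move=> /(homog_Einf _ _ _ _ Ex)[ha hu hv hx].
  move=> /(homog_Einf _ _ _ _ Ex')[ha' hu' hv' hx'].
  have Em := Einf_mem_mul (x := (a, u, v, x)) (y := (a', u', v', x')) Ex Ex'.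
  rewrite (mulE a u' v' hu hv hx ha' hx') in Em *.
  apply/(homog_Einf _ _ _ _ Em).
  have ec : c (+) e = e (+) c by rewrite addbC.
  have h1 w : homog gM e w -> homog gM (c (+) e) (a *: w) by exact: superM.
  have h2 w : homog gM e w -> homog gM (c (+) e) (x w) by exact: (hmap_homog hx).
  have h3 w : homog gM c w -> homog gM (c (+) e) (koszul e c (a' *: w)).
    by move=> hw; apply: (homog_koszul GM) => //; rewrite ec; exact: superM.
  have h4 w : homog gM c w -> homog gM (c (+) e) (koszul e c (x' w)).
    move=> hw; apply: (homog_koszul GM) => //; rewrite ec; exact: (hmap_homog hx').
  split.
  + by apply: (homogB GA) => //; exact: q_homog.
  + apply: (homogB GM) => //; last exact: h4.
    apply: (homogB GM) => //; last exact: h3.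
    by apply: (homogD GM) => //; [exact: h1|exact: h2].
  + apply: (homogB GM) => //; last exact: h4.
    apply: (homogD GM) => //; last exact: h3.
    by apply: (homogD GM) => //; [apply: (homogN GM) => //; exact: h1|exact: h2].
  + apply: (hmap_add GM); last exact: (hmap_scomm GM hx hx').
    by apply: (hmap_add GM); exact: hmap_opE.
Qed.

Lemma hmap_mul b y : L y -> homog p b y -> hmap p L b (mul y).
Proof.
move=> Ly hy; split=> [z Lz|w z Lw Lz|c z Lz hz]; first exact: Einf_mem_mul.
  exact: (gp_addr product_Einf).
exact: (gp_homog product_Einf).
Qed.

(** ** Derivations of E_oo which extend those of the scalars *)

Lemma module_scalars : graded_module gK gA (actA iota) setT.
Proof.
split=> //; rewrite /actA.
- by move=> k x y _ _; rewrite mulrDr.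
- by move=> z _; rewrite rmorph0 mul0r.
- by move=> b c k z hk _ hz; apply: superA => //; exact: iota_homog.
Qed.

Lemma product_scalars : graded_product gA *%R setT.
Proof.
by split=> // [x y z|x y z|]; rewrite ?mulrDl ?mulrDr //; move=> *; exact: superA.
Qed.

Local Notation hderA := (hder gK gA (actA iota) *%R setT).
Local Notation hderE := (hder gK p la mul L).

Lemma hderA_hmap b f : hderA b f -> hmap gA setT b f.
Proof. by case/(hderP _ module_scalars). Qed.

Lemma hderA_leibniz b f : hderA b f -> leibniz gA *%R setT b f.
Proof. by case/(hderP _ module_scalars). Qed.

Lemma hderA_iota b f c k : hderA b f -> homog gK c k -> f (iota k) = 0.
Proof.
move=> hf hk; have := hf => /(hderP _ module_scalars)[_ fk _].
have := fk c k 1 hk Logic.I; rewrite /actA mulr1 => ->.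
by rewrite (leibniz_one (hderA_leibniz hf)) mulr0 koszul0.
Qed.

(** For [f] a derivation of [A] and [S = Delta_M] this is [d_{S,0}]; for [f = 0]
    and [S] in [E] it is the inner derivation of [(0, 0, 0, S)]. *)
Definition extend (f : A -> A) (S : M -> M) (z : T) : T :=
  let: (a, u, v, x) := z in (f a, S u, S v, sbr gM S x).

Lemma extend_homog b c f S a u v x : hmap gM setT b S -> hmap gM setT c x ->
  extend f S (a, u, v, x) =
    (f a, S u, S v, fun w => S (x w) - koszul b c (x (S w))).
Proof. by move=> Sm hx; apply: eq_Tinf => // w; rewrite (sbr_hmap GM Sm hx). Qed.

Lemma sbr_hmap_fun b c x y : hmap gM setT b x -> hmap gM setT c y ->
  hmap gM setT (b (+) c) (sbr gM x y).
Proof.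
move=> hx hy; apply: (eq_hmap GM _ (hmap_scomm GM hx hy)) => w _.
by rewrite (sbr_hmap GM hx hy).
Qed.

Lemma hmap_extend b f S : semiskew b f S -> (forall x, E x -> E (sbr gM S x)) ->
  hmap p L b (extend f S).
Proof.
move=> [Sm fm _ _] SE; split.
- by move=> [[[a u] v] x] Ex; exact: SE.
- move=> [[[a u] v] x] [[[a' u'] v'] x'] Ex Ex'; rewrite TinfD /= TinfD.
  apply: eq_Tinf => [|||w]; rewrite ?(hmapD fm) ?(hmapD Sm) //.
  by rewrite sbrDr // => *; exact: (hmapD Sm).
- move=> c [[[a u] v] x] Ex /(homog_Einf _ _ _ _ (Ex : E x))[ha hu hv hx].
  apply/(homog_Einf _ _ _ _ (SE _ Ex)).
  split; [exact: (hmap_homog fm)|exact: (hmap_homog Sm)|exact: (hmap_homog Sm)|].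
  exact: sbr_hmap_fun.
Qed.

Lemma leibniz_extend b f S : semiskew b f S -> (forall x, E x -> E (sbr gM S x)) ->
  leibniz p mul L b (extend f S).
Proof.
move=> ss SE; apply: (leibniz_homogP module_Einf product_Einf (hmap_extend ss SE)).
move=> c e [[[a u] v] x] [[[a' u'] v'] x'] Ex Ex'.
have Sm := ss_map ss; have fm := ss_fmap ss.
have Em := Einf_mem_mul (x := (a, u, v, x)) (y := (a', u', v', x')) Ex Ex'.
move=> hz hz'; have hm := gp_homog product_Einf Ex Ex' hz hz'.
move: hz hz' => /(homog_Einf _ _ _ _ (Ex : E x))[ha hu hv hx].
move=> /(homog_Einf _ _ _ _ (Ex' : E x'))[ha' hu' hv' hx'].
rewrite (extend_homog _ _ _ _ Sm hx) (extend_homog _ _ _ _ Sm hx').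
have hSu := hmap_homog Sm Logic.I hu; have hSv := hmap_homog Sm Logic.I hv.
have hSx := hmap_scomm GM Sm hx; have hSx' := hmap_scomm GM Sm hx'.
have hfa' := hmap_homog fm Logic.I ha'.
rewrite (mulE a u' v' hu hv hx ha' hx') in hm Em *.
have [_ _ _ hmx] := (homog_Einf _ _ _ _ Em).1 hm.
rewrite (extend_homog _ _ _ _ Sm hmx).
rewrite (mulE (f a) u' v' hSu hSv hSx ha' hx').
rewrite (mulE a (S u') (S v') hu hv hx hfa' hSx').
rewrite koszul_Tinf TinfD; apply: eq_Tinf => [|||w].
- rewrite (hmapB GA fm) // (ss_q ss v' hu) (ss_q ss u' hv) koszulB; zmod.
- have SB := hmapB GM Sm; rewrite !SB // (hmapD Sm) // !(hmap_koszul GM _ _ Sm) //.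
  rewrite (ss_scale ss _ ha) (ss_scale ss _ ha') /koszul.
  by case: (b) (c) (e) => [] [] [] /=; zmod.
- have SB := hmapB GM Sm; rewrite !SB // !(hmapD Sm) // (hmapN GM Sm) //.
  rewrite !(hmap_koszul GM _ _ Sm) //.
  rewrite (ss_scale ss _ ha) (ss_scale ss _ ha') /koszul.
  by case: (b) (c) (e) => [] [] [] /=; zmod.
- rewrite /= !(hmapD Sm) // (hmapN GM Sm) // (hmap_koszul GM _ _ Sm) //.
  rewrite !(hmapB GM hx) // !(hmapB GM hx') //.
  rewrite !(hmap_koszul GM _ _ hx) // !(hmap_koszul GM _ _ hx') //.
  have e1 := semiskew_opE w ss hu hv'; have e2 := semiskew_opE w ss hv hu'.
  move/eqP: e1; rewrite subr_eq => /eqP->; move/eqP: e2; rewrite subr_eq => /eqP->.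
  rewrite /koszul; by case: (b) (c) (e) => [] [] [] /=; zmod.
Qed.

Lemma hder_extend b f S : hderA b f -> semiskew b f S ->
  (forall x, E x -> E (sbr gM S x)) -> hderE b (extend f S).
Proof.
move=> hf ss SE; apply/(hderP _ module_Einf); split.
- exact: hmap_extend.
- have hS := hmap_extend ss SE.
  move=> c k z hk; move: z; apply: (graded_ind graded_Einf) => [y z Ly Lz E1 E2|e z Lz].
    rewrite (gm_addr module_Einf) // !(hmapD hS) ?E1 ?E2 ?koszulD //;
      try exact: (gm_mem module_Einf).
    by rewrite (gm_addr module_Einf) ?koszulD //; exact: (hmapL hS).
  case: z Lz => [[[a u] v] x] Ex hz.
  have hkz := gm_homog module_Einf hk Ex hz.
  have [_ _ _ hkx] := (homog_Einf _ _ _ _ (E_scale (iota k) Ex)).1 hkz.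
  have [ha hu hv hx] := (homog_Einf _ _ _ _ (Ex : E x)).1 hz.
  have hi := iota_homog hk; have Sm := ss_map ss.
  rewrite (extend_homog _ _ _ _ Sm hx) /Einf_act (extend_homog _ _ _ _ Sm hkx).
  rewrite koszul_Tinf; have fi := hderA_iota hf hk.
  apply: eq_Tinf => [|||w]; rewrite ?(ss_scale ss _ hi) ?fi ?scale0r ?add0r //.
    by case/(hderP _ module_scalars): hf => _ /(_ _ _ a hk Logic.I).
  rewrite /koszul; by case: (b) (c) (e) => [] [] [] /=; rewrite ?scalerBr ?scalerN; zmod.
- exact: leibniz_extend.
Qed.

(** ** The Jacobi identity *)

Lemma mul_leibniz_scalar b a0 : homog gA b a0 ->
  leibniz p mul L b (mul (a0, 0, 0, fun=> 0)).
Proof.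
move=> ha0; have L0 : L (a0, 0, 0, fun=> 0) by exact: E0.
have h0 : homog p b ((a0, 0, 0, fun=> 0) : T).
  apply/homog_Einf; first exact: E0.
  by split=> //; [exact: (homog0 GM)|exact: (homog0 GM)|exact: (hmap_const0 GM)].
apply: (leibniz_homogP module_Einf product_Einf (hmap_mul L0 h0)).
move=> c e [[[a u] v] x] [[[a' u'] v'] x'] Ex Ex' hz hz'.
have m0 d (a1 : A) u1 v1 x1 : E x1 -> homog p d ((a1, u1, v1, x1) : T) ->
    mul (a0, 0, 0, fun=> 0) (a1, u1, v1, x1) = (0, a0 *: u1, - (a0 *: v1), fun=> 0).
  move=> Ex1 hz1; have [ha1 hu1 hv1 hx1] := (homog_Einf _ _ _ _ Ex1).1 hz1.
  rewrite (mulE a0 u1 v1 (homog0 GM b) (homog0 GM b) (hmap_const0 GM b) ha1 hx1).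
  apply: eq_Tinf => [|||w]; rewrite ?q0l ?opE0l ?scaler0 ?(hmap0 GM hx1) ?koszul0; zmod.
have Em := Einf_mem_mul (x := (a, u, v, x)) (y := (a', u', v', x')) Ex Ex'.
have hmul := gp_homog product_Einf Ex Ex' hz hz'.
rewrite (m0 _ _ _ _ _ Ex hz) (m0 _ _ _ _ _ Ex' hz').
have [ha hu hv hx] := (homog_Einf _ _ _ _ (Ex : E x)).1 hz.
have [ha' hu' hv' hx'] := (homog_Einf _ _ _ _ (Ex' : E x')).1 hz'.
rewrite (mulE a u' v' hu hv hx ha' hx') in hmul Em *.
rewrite (m0 _ _ _ _ _ Em hmul).
have hau := superM ha0 hu; have hav := homogN GM Logic.I (superM ha0 hv).
rewrite (mulE 0 u' v' hau hav (hmap_const0 GM _) ha' hx').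
rewrite (mulE a (a0 *: u') (- (a0 *: v')) hu hv hx (homog0 GA (b (+) e))
  (hmap_const0 GM (b (+) e))).
rewrite koszul_Tinf TinfD.
have hxZ := hendZ _ (E_hend (Ex : E x) hx) ha0.
have hxZ' := hendZ _ (E_hend (Ex' : E x') hx') ha0.
apply: eq_Tinf => [|||w].
- rewrite qNl qNr !qZl (qZr _ ha0 hu) (qZr _ ha0 hv) /koszul.
  by case: (b) (c) => [] [] /=; zmod.
- rewrite !scalerDr !scalerN !koszul_scale hxZ hxZ' !scale0r !scalerA.
  rewrite (commA ha0 ha) (commA ha0 ha') /koszul.
  by case: (b) (c) (e) => [] [] [] /=; rewrite ?scaleNr ?scalerN; zmod.
- rewrite (hmapN GM hx) // (hmapN GM hx') // hxZ hxZ'.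
  rewrite !scalerDr !scalerN !koszul_scale !scale0r !scalerA.
  rewrite (commA ha0 ha) (commA ha0 ha') /koszul.
  by case: (b) (c) (e) => [] [] [] /=; rewrite ?scaleNr ?scalerN; zmod.
- rewrite opENl opENr (opE_scale _ _ ha0 hu) (opE_scale _ _ ha0 hv).
  rewrite (hmap0 GM hx) (hmap0 GM hx') !koszul0 /koszul.
  by case: (b) (c) => [] [] /=; zmod.
Qed.

(** The identity holds in [A] because [x] and [x'] are skew for [q], in the copies
    of [M] by the definition of [E_{u,v}], and in [E] by [semiskew_opE]. *)
Lemma mul_leibniz_up b u0 : homog gM b u0 ->
  leibniz p mul L b (mul (0, u0, 0, fun=> 0)).
Proof.
move=> hu0; have L0 : L (0, u0, 0, fun=> 0) by exact: E0.
have h0 : homog p b ((0, u0, 0, fun=> 0) : T).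
  apply/homog_Einf; first exact: E0.
  by split=> //; [exact: (homog0 GA)|exact: (homog0 GM)|exact: (hmap_const0 GM)].
apply: (leibniz_homogP module_Einf product_Einf (hmap_mul L0 h0)).
move=> c e [[[a u] v] x] [[[a' u'] v'] x'] Ex Ex' hz hz'.
have m0 d (a1 : A) u1 v1 x1 : E x1 -> homog p d ((a1, u1, v1, x1) : T) ->
    mul (0, u0, 0, fun=> 0) (a1, u1, v1, x1) =
    (q u0 v1, - koszul d b (a1 *: u0) - koszul d b (x1 u0), 0, opE u0 v1).
  move=> Ex1 hz1; have [ha1 hu1 hv1 hx1] := (homog_Einf _ _ _ _ Ex1).1 hz1.
  rewrite (mulE 0 u1 v1 hu0 (homog0 GM b) (hmap_const0 GM b) ha1 hx1).
  by apply: eq_Tinf => [|||w];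
    rewrite ?q0l ?opE0l ?scaler0 ?scale0r ?(hmap0 GM hx1) ?koszul0; zmod.
have Em := Einf_mem_mul (x := (a, u, v, x)) (y := (a', u', v', x')) Ex Ex'.
have hmul := gp_homog product_Einf Ex Ex' hz hz'.
rewrite (m0 _ _ _ _ _ Ex hz) (m0 _ _ _ _ _ Ex' hz').
have [ha hu hv hx] := (homog_Einf _ _ _ _ (Ex : E x)).1 hz.
have [ha' hu' hv' hx'] := (homog_Einf _ _ _ _ (Ex' : E x')).1 hz'.
rewrite (mulE a u' v' hu hv hx ha' hx') in hmul Em *.
rewrite (m0 _ _ _ _ _ Em hmul).
have hbc w d : homog gM (d (+) b) w -> homog gM (b (+) d) (- w).
  by rewrite addbC; exact: (homogN GM).
have hU : homog gM (b (+) c) (- koszul c b (a *: u0) - koszul c b (x u0)).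
  rewrite addbC; apply: (homogB GM) => //.
    by apply: (homogN GM) => //; apply: (homog_koszul GM) => //; exact: superM.
  by apply: (homog_koszul GM) => //; exact: (hmap_homog hx).
have hqv' := q_homog hu0 hv'.
rewrite (mulE (q u0 v) u' v' hU (homog0 GM (b (+) c)) (hmap_opE hu0 hv) ha' hx').
rewrite (mulE a _ 0 hu hv hx hqv' (hmap_opE hu0 hv')).
rewrite koszul_Tinf TinfD.
have Zx := E_hend (Ex : E x) hx; have Zx' := E_hend (Ex' : E x') hx'.
have sx := E_semiskew (Ex : E x) hx; have sx' := E_semiskew (Ex' : E x') hx'.
have xu0 := hmap_homog hx Logic.I hu0; have xu0' := hmap_homog hx' Logic.I hu0.
apply: eq_Tinf => [|||w].
- rewrite !(qDl, qDr, qNl, qNr) !q_koszull !q_koszulr !qZl (qZr _ ha hu0) (qZr _ ha' hu0).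
  have /esym/eqP := ss_q sx v' hu0; rewrite addr_eq0 => /eqP->.
  have /esym/eqP := ss_q sx' u0 hv; rewrite addrC addr_eq0 => /eqP /(congr1 (koszul e c)).
  rewrite koszulK => ->; rewrite (q_sym (hmap_homog hx' Logic.I hv) hu0).
  rewrite (qZr _ ha' hv) (q_sym hv hu0) q0l q0r /koszul.
  by case: (b) (c) (e) => [] [] [] /=; rewrite ?mulrN; zmod.
- rewrite /= (opE_homog hu hv' hu0) (opE_homog hv hu' hu0).
  rewrite (opE_homog hu0 hv hu') (opE_homog hu0 hv' hu).
  rewrite (q_sym hv' hu0) (q_sym hu hu0) (q_sym hu' hu0) (q_sym hv hu0) (q_sym hv' hu).
  rewrite !(hmapB GM hx) // !(hmapB GM hx') // (hmapN GM hx) // (hmapN GM hx') //.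
  rewrite !(hmap_koszul GM _ _ hx) // !(hmap_koszul GM _ _ hx') //.
  rewrite (hendZ _ Zx ha') (hendZ _ Zx' ha).
  rewrite !scalerBr !scalerN !scalerBl -!koszul_scale !scalerA (commA ha' ha) /koszul.
  by case: (b) (c) (e) => [] [] [] /=; rewrite ?scaleNr ?scalerN ?scalerA; zmod.
- rewrite (opE_homog hu0 hv hv') (opE_homog hu0 hv' hv) (q_sym hv' hv).
  rewrite !scaler0 (hmap0 GM hx) (hmap0 GM hx') /koszul.
  by case: (b) (c) (e) => [] [] [] /=; rewrite ?scaleNr; zmod.
- rewrite !(opEDl, opEDr, opENl, opENr) !opE_koszull !opE_koszulr opE0l opE0r.
  have /eqP := semiskew_opE w sx hu0 hv'; rewrite subr_eq => /eqP->.
  have /eqP := semiskew_opE w sx' hu0 hv; rewrite subr_eq => /eqP->.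
  rewrite (opE_sym _ hv xu0') (opE_sym _ hv (superM ha' hu0)).
  rewrite (opE_scale _ _ ha hu0) (opE_scale _ _ ha' hu0) /koszul.
  by case: (b) (c) (e) => [] [] [] /=; zmod.
Qed.

(** Exchanging the two copies of [M] is an automorphism, which carries the
    derivations of the previous lemma to those of the second copy. *)
Definition flip (z : T) : T := let: (a, u, v, x) := z in (- a, v, u, x).

Lemma flipK : involutive flip.
Proof. by move=> [[[a u] v] x] /=; rewrite opprK. Qed.

Lemma flipD y z : flip (y + z) = flip y + flip z.
Proof. by case: y z => [[[a u] v] x] [[[a' u'] v'] x']; rewrite !TinfD /= opprD. Qed.

Lemma flip_koszul b c z : flip (koszul b c z) = koszul b c (flip z).
Proof.
case: z => [[[a u] v] x]; rewrite !koszul_Tinf /=; congr (_, _, _, _).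
by rewrite /koszul; case: (b && c).
Qed.

Lemma flip_homog c z : L z -> homog p c z -> homog p c (flip z).
Proof.
case: z => [[[a u] v] x] Ex /(homog_Einf _ _ _ _ (Ex : E x))[ha hu hv hx].
by apply/homog_Einf => //; split=> //; exact: (homogN GA).
Qed.

Lemma flip_mul y z : flip (mul y z) = mul (flip y) (flip z).
Proof.
case: y z => [[[a u] v] x] [[[a' u'] v'] x'].
apply: eq_Tinf => [|||w]; rewrite ?scaleNr ?rscaleNr; zmod.
Qed.

Lemma mul_leibniz_down b v0 : homog gM b v0 ->
  leibniz p mul L b (mul (0, 0, v0, fun=> 0)).
Proof.
move=> hv0 c x y Lx Ly hx.
have Lf z : L z -> L (flip z) by case: z => [[[a u] v] f].
have -> : (0, 0, v0, fun=> 0) = flip (0, v0, 0, fun=> 0) by rewrite /= oppr0.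
have fE z : mul (flip (0, v0, 0, fun=> 0)) z = flip (mul (0, v0, 0, fun=> 0) (flip z)).
  by rewrite flip_mul flipK.
rewrite !fE (flip_mul x y) (mul_leibniz_up hv0 (Lf _ Lx) (Lf _ Ly) (flip_homog Lx hx)).
by rewrite flipD flip_koszul !flip_mul !flipK.
Qed.

Lemma signed_app0 x : E x -> signed_app gM x 0 = 0.
Proof.
by move=> Ex; have := signed_appDr 0 0 Ex; rewrite addr0 => /addrr_eq.
Qed.

Lemma mul_leibniz_E b x0 : E x0 -> hmap gM setT b x0 ->
  leibniz p mul L b (mul (0, 0, 0, x0)).
Proof.
move=> Ex0 hx0; have s0 := E_semiskew Ex0 hx0.
have SE x : E x -> E (sbr gM x0 x) by exact: E_sbr.
apply: (eq_leibniz product_Einf _ (leibniz_extend s0 SE)) => [[[[a u] v] x]] Ex.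
apply: eq_Tinf => [|||w]; rewrite ?q0l ?opE0l ?scale0r ?rscale0l; try zmod.
  by rewrite (signed_app0 (Ex : E x)); zmod.
by rewrite (signed_app0 (Ex : E x)); zmod.
Qed.

(** The Leibniz rule is additive in the map, so it can be checked for each of the
    four components of [y]. *)
Lemma hder_ad b y : L y -> homog p b y -> hderE b (mul y).
Proof.
move=> Ly hy; have hm := hmap_mul Ly hy.
case: y Ly hy hm => [[[a u] v] x] Ex hy hm.
have [ha hu hv hx] := (homog_Einf _ _ _ _ (Ex : E x)).1 hy.
apply/(hderP _ module_Einf); split=> //.
- move=> c k z hk; move: z; apply: (graded_ind graded_Einf) => [y z Ly Lz E1 E2|e z Lz].
    rewrite (gm_addr module_Einf) // !(hmapD hm) ?E1 ?E2 ?koszulD //;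
      try exact: (gm_mem module_Einf).
    by rewrite (gm_addr module_Einf) ?koszulD //; exact: (hmapL hm).
  case: z Lz => [[[a' u'] v'] x'] Ex' hz.
  have hkz := gm_homog module_Einf hk Ex' hz.
  have [hka _ _ hkx] := (homog_Einf _ _ _ _ (E_scale (iota k) Ex')).1 hkz.
  have [ha' hu' hv' hx'] := (homog_Einf _ _ _ _ (Ex' : E x')).1 hz.
  have hi := iota_homog hk; have Zx := E_hend (Ex : E x) hx.
  rewrite /Einf_act (mulE _ _ _ hu hv hx hka hkx) (mulE _ _ _ hu hv hx ha' hx') koszul_Tinf.
  apply: eq_Tinf => [|||w]; rewrite ?(qZr _ hi hu) ?(qZr _ hi hv) ?(hendZ _ Zx hi).
  + by rewrite /koszul; case: (b) (c) => [] [] /=; rewrite mulrBr; zmod.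
  + rewrite !scalerBr scalerDr !scalerA (commA ha hi) /koszul.
    by case: (b) (c) (e) => [] [] [] /=; rewrite ?scalerN ?scaleNr ?scalerA; zmod.
  + rewrite !(scalerBr, scalerDr) !scalerN !scalerA (commA ha hi) /koszul.
    by case: (b) (c) (e) => [] [] [] /=; rewrite ?scalerN ?scaleNr ?scalerA; zmod.
  + have oZ u1 v1 : homog gM b u1 ->
        opE u1 (iota k *: v1) w = koszul b c (iota k *: opE u1 v1 w).
      move=> hu1; rewrite -opE_scalel (opE_scale _ _ hi hu1) /koszul.
      by case: (b) (c) => [] []; rewrite /= ?opprK.
    rewrite !oZ // !(scalerBr, scalerDr) /koszul.
    by case: (b) (c) (e) => [] [] [] /=; rewrite ?scalerN; zmod.
have E4 z : L z -> mul (a, 0, 0, fun=> 0) z + mul (0, u, 0, fun=> 0) z +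
    (mul (0, 0, v, fun=> 0) z + mul (0, 0, 0, x) z) = mul (a, u, v, x) z.
  have L0 w1 w2 w3 : L (w1, w2, w3, fun=> 0) by exact: E0.
  move=> Lz; rewrite -!(gp_addl product_Einf) //; try exact: (gradedD graded_Einf).
  congr (mul _ z); rewrite !TinfD; apply: eq_Tinf => [|||w] /=; try zmod.
  by change (0 + 0 + (0 + x w) = x w); zmod.
have Lm y z : L y -> L z -> L (mul y z) by exact: Einf_mem_mul.
apply: (eq_leibniz product_Einf E4).
have La w (z : T) : L z -> L (mul (w, 0, 0, fun=> 0) z).
  by move=> Lz; apply: Lm => //; exact: E0.
have Lu w (z : T) : L z -> L (mul (0, w, 0, fun=> 0) z).
  by move=> Lz; apply: Lm => //; exact: E0.
have Lv w (z : T) : L z -> L (mul (0, 0, w, fun=> 0) z).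
  by move=> Lz; apply: Lm => //; exact: E0.
have Lx (z : T) : L z -> L (mul (0, 0, 0, x) z) by move=> Lz; exact: Lm.
have LD y z : L y -> L z -> L (y + z) by exact: (gradedD graded_Einf).
apply: (leibniz_add product_Einf) => [z Lz|z Lz||]; try by apply: LD; auto.
- apply: (leibniz_add product_Einf); auto; first exact: mul_leibniz_scalar.
  exact: mul_leibniz_up.
- apply: (leibniz_add product_Einf); auto; first exact: mul_leibniz_down.
  exact: mul_leibniz_E.
Qed.

(** ** Scalar derivations acting on E_oo *)

Local Notation DerA := (DerA gA gK iota).
Local Notation DerE := (DerEinf gA gM q gK iota E).
Local Notation dSE := (dSset gA gM I m q gK iota E).
Local Notation adE := (adEinf gA gM q E).

Lemma DerA_additive D : DerA D -> forall a a', D (a + a') = D a + D a'.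
Proof.
move=> [D0 [D1 [h0 h1 DE]]] a a'.
rewrite !DE // (hmapD (hderA_hmap h0)) // (hmapD (hderA_hmap h1)) //; zmod.
Qed.

(** A derivation kills the values of [q] on the basis, so the first term in the
    coefficients of [Delta_M] vanishes. *)
Lemma Delta_ME D : DerA D -> Delta_M I m q D = lift_der D.
Proof.
move=> hD; apply/funext => v; rewrite /Delta_M /lift_der /coordwise.
apply: eq_fsbigr => i; rewrite inE => Ii; congr (_ *: _).
have [n ->] := q_basis_opp Ii.
have [D0 [D1 [h0 h1 ->]]] := hD => //.
rewrite (leibniz_sign (hderA_hmap h0) (hderA_leibniz h0)).
rewrite (leibniz_sign (hderA_hmap h1) (hderA_leibniz h1)).
by rewrite addr0 mulr0 !mul0r add0r.
Qed.

Lemma hder_semiskew b f : hderA b f -> semiskew b f (lift_der f).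
Proof. by move=> hf; apply: semiskew_lift; [exact: hderA_hmap|exact: hderA_leibniz]. Qed.

Lemma E_sbr_lift b f x : hderA b f -> E x -> E (sbr gM (lift_der f) x).
Proof.
move=> hf Ex; have ss := hder_semiskew hf.
have hx c := E_hmap c Ex.
have Ec c : E (fun z => lift_der f (epart gM c x z) -
    koszul b c (epart gM c x (lift_der f z))).
  have Ep := E_epart c Ex; split.
    apply: semiskew_osp; apply: semiskew_scomm0 ss _; exact: E_semiskew.
  apply: fin_diag_lift; [exact: hderA_hmap|exact: hderA_leibniz| |by case: Ep].
  exact: E_hend.
suff -> : sbr gM (lift_der f) x = fun z =>
    lift_der f (epart gM false x z) - koszul b false (epart gM false x (lift_der f z)) +
    (lift_der f (epart gM true x z) - koszul b true (epart gM true x (lift_der f z))).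
  exact: E_add.
have xE : x = fun w => epart gM false x w + epart gM true x w.
  by apply/funext => w; exact: osp_sum (E_osp Ex).
apply/funext => z; rewrite [in LHS]xE sbrDr; last first.
  by move=> u v; exact: (hmapD (ss_map ss)).
by rewrite !(sbr_hmap GM (ss_map ss) (hx _)).
Qed.

Lemma hder_lift b f : hderA b f -> hderE b (extend f (lift_der f)).
Proof.
by move=> hf; apply: (hder_extend hf (hder_semiskew hf)) => x; exact: (E_sbr_lift hf).
Qed.

Lemma lift_sub f g v : (forall a a', f (a + a') = f a + f a') ->
  (forall a a', g (a + a') = g a + g a') ->
  lift_der (fun a => f a - g a) v = lift_der f v - lift_der g v.
Proof.
move=> fD gD; apply: (coord_inj ex1) => i Ii.
rewrite (coordB ex1) /lift_der !(coord_coordwise ex1) // => _ a a'.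
by rewrite fD gD; zmod.
Qed.

Lemma lift_add f g v : (forall a a', f (a + a') = f a + f a') ->
  (forall a a', g (a + a') = g a + g a') ->
  lift_der (fun a => f a + g a) v = lift_der f v + lift_der g v.
Proof.
move=> fD gD; apply: (coord_inj ex1) => i Ii.
rewrite (coordD ex1) /lift_der !(coord_coordwise ex1) // => _ a a'.
by rewrite fD gD; zmod.
Qed.

Lemma sbrBl x y z w : (forall u v, z (u + v) = z u + z v) ->
  sbr gM (fun w => x w - y w) z w = sbr gM x z w - sbr gM y z w.
Proof.
move=> zA; have zD b := epart_additive b zA.
have zN b u : epart gM b z (- u) = - epart gM b z u.
  apply/eqP; rewrite -subr_eq0 opprK -zD addNr.
  by have /eqP := zD b 0 0; rewrite addr0 -subr_eq subrr => /eqP <-.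
by rewrite !sbr_epart /koszul /= !epartB !zD !zN; zmod.
Qed.

Lemma extend_sub f g z : L z -> (forall a a', f (a + a') = f a + f a') ->
  (forall a a', g (a + a') = g a + g a') ->
  extend (fun a => f a - g a) (lift_der (fun a => f a - g a)) z =
    extend f (lift_der f) z - extend g (lift_der g) z.
Proof.
case: z => [[[a u] v] x] Ex fD gD.
have lE : lift_der (fun a => f a - g a) = fun v => lift_der f v - lift_der g v.
  by apply/funext => w; rewrite lift_sub.
by apply: eq_Tinf => [|||w]; rewrite ?lE // sbrBl //; exact: (E_additive (Ex : E x)).
Qed.

(** This is the commutator which [dS0] converts back into a scalar. *)
Lemma sbr_scalar b f a v : hderA b f -> sbr gM (lift_der f) (fun w => a *: w) v = f a *: v.
Proof.
move=> hf; have ss := hder_semiskew hf.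
have ha c := hend_map (hend_scalar (homog_part GA c (Logic.I : setT a))).
have -> : (fun w : M => a *: w) = fun w => gA false a *: w + gA true a *: w.
  by apply/funext => w; rewrite -scalerDl part_sum.
rewrite sbrDr; last by move=> u w; exact: (hmapD (ss_map ss)).
rewrite !(sbr_hmap GM (ss_map ss) (ha _)) //.
rewrite !(ss_scale ss v (homog_part GA _ _)) //.
have -> : f a = f (gA false a) + f (gA true a).
  by rewrite -(hmapD (hderA_hmap hf)) // part_sum.
by rewrite scalerDl; zmod.
Qed.

Lemma extend_add f g z : L z -> (forall a a', f (a + a') = f a + f a') ->
  (forall a a', g (a + a') = g a + g a') ->
  extend (fun a => f a + g a) (lift_der (fun a => f a + g a)) z =
    extend f (lift_der f) z + extend g (lift_der g) z.
Proof.
case: z => [[[a u] v] x] Ex fD gD.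
have lE : lift_der (fun a => f a + g a) = fun v => lift_der f v + lift_der g v.
  by apply/funext => w; rewrite lift_add.
by apply: eq_Tinf => [|||w]; rewrite ?lE // sbrDl //; exact: (E_additive (Ex : E x)).
Qed.

Lemma DerA_split D : DerA D -> exists2 D' : bool -> A -> A,
  forall b, hderA b (D' b) & D = fun a => D' false a + D' true a.
Proof.
by move=> /Der_split[D' [hD DE]]; exists D' => //; apply/funext => a; exact: DE.
Qed.

Lemma hderA_additive b f : hderA b f -> forall a a', f (a + a') = f a + f a'.
Proof. by move=> /hderA_hmap hf a a'; exact: (hmapD hf). Qed.

Lemma dS0E D z : DerA D -> L z -> dS0 gM (Delta_M I m q D) z = extend D (lift_der D) z.
Proof.
move=> hD; rewrite (Delta_ME hD); case: z => [[[a u] v] x] Ex /=.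
apply: eq_Tinf => //; rewrite /unscalar.
have DE w : sbr gM (lift_der D) (fun w => a *: w) w = D a *: w.
  have [D' hD' ->] := DerA_split hD.
  rewrite (_ : lift_der _ = fun v => lift_der (D' false) v + lift_der (D' true) v).
    rewrite sbrDl ?(sbr_scalar _ _ (hD' _)) -?scalerDl //.
    by move=> *; rewrite scalerDr.
  by apply/funext => w'; rewrite lift_add //; exact: hderA_additive.
apply: xget_unique => [|b bE]; first exact/funext.
by apply: scale_inj => w; rewrite -DE bE.
Qed.

(** The derivations [d_{S,0}] in terms of [extend], where no choice operator is
    left. *)
Lemma dSsetP d : dSE d <->
  exists2 D, DerA D & forall z, L z -> d z = extend D (lift_der D) z.
Proof.
split=> [[S [D hD <-] dE]|[D hD dE]].
  by exists D => // z Lz; rewrite dE // dS0E.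
by exists (Delta_M I m q D) => [|z Lz]; [exists D|rewrite dE // dS0E].
Qed.

Lemma extend_split D D' : (forall b, hderA b (D' b)) ->
    D = (fun a => D' false a + D' true a) ->
  forall z, L z -> extend D (lift_der D) z =
    extend (D' false) (lift_der (D' false)) z + extend (D' true) (lift_der (D' true)) z.
Proof. by move=> hD -> z Lz; rewrite extend_add //; exact: hderA_additive. Qed.

Lemma dSset_hder b f d : hderA b f -> (forall z, L z -> d z = extend f (lift_der f) z) ->
  dSE d.
Proof.
move=> hf dE; apply/dSsetP; exists f => //.
exact: (Der_hder module_scalars product_scalars hf).
Qed.

Lemma dSset_sub d e : dSE d -> dSE e -> dSE (fun z => d z - e z).
Proof.
move=> /dSsetP[D hD dE] /dSsetP[D1 hD1 eE]; apply/dSsetP.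
exists (fun a => D a - D1 a); first exact: (Der_sub module_scalars product_scalars).
by move=> z Lz; rewrite dE // eE // extend_sub //; exact: DerA_additive.
Qed.

Lemma eq_dSset d e : (forall z, L z -> d z = e z) -> dSE d -> dSE e.
Proof.
by move=> de /dSsetP[D hD dE]; apply/dSsetP; exists D => // z Lz; rewrite -de ?dE.
Qed.

Lemma dSset0 : dSE (fun=> 0).
Proof.
have h0 : hderA false (fun=> 0) by exact: (hder_const0 module_scalars product_scalars).
have d0 := dSset_hder h0 (fun z _ => erefl).
apply: (eq_dSset _ (dSset_sub d0 d0)).
by move=> z Lz /=; rewrite subrr.
Qed.

Lemma dSset_add d e : dSE d -> dSE e -> dSE (fun z => d z + e z).
Proof.
move=> hd he; apply: (eq_dSset _ (dSset_sub hd (dSset_sub dSset0 he))) => z _.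
by zmod.
Qed.

Lemma dSset_split d : dSE d -> exists d' : bool -> T -> T,
  [/\ forall b, exists2 f, hderA b f & d' b = extend f (lift_der f),
     forall b, hmap p L b (d' b) &
     forall z, L z -> d z = d' false z + d' true z].
Proof.
move=> /dSsetP[D /DerA_split[D' hD DE] dE].
exists (fun b => extend (D' b) (lift_der (D' b))); split=> [b|b|z Lz].
- by exists (D' b).
- by have /(hderP _ module_Einf)[] := hder_lift (hD b).
- by rewrite dE // (extend_split hD DE).
Qed.

Lemma dSset_Der d : dSE d -> DerE d.
Proof.
move=> /dSset_split[d' [hd _ dE]].
have hd' b : hderE b (d' b) by have [f hf ->] := hd b; exact: hder_lift.
by exists (d' false), (d' true).
Qed.

Lemma sbr_scale e b a S x w : homog gA e a -> hmap gM setT b S -> E x ->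
  sbr gM (fun w => a *: S w) x w = a *: sbr gM S x w.
Proof.
move=> ha Sm Ex; have hx c := E_hmap c Ex.
have aS := hmap_comp (hend_map (hend_scalar ha)) Sm.
have xE : x = fun w => epart gM false x w + epart gM true x w.
  by apply/funext => v; exact: osp_sum (E_osp Ex).
rewrite xE !sbrDr; try by move=> u v; rewrite (hmapD Sm) ?scalerDr.
rewrite !(sbr_hmap GM Sm (hx _)) // !(sbr_hmap GM aS (hx _)) //.
rewrite !(hendZ _ (E_hend (E_epart _ Ex) (hx _)) ha) scalerDr !scalerBr /koszul.
by case: (b) (e) => [] [] /=; rewrite ?scalerN; zmod.
Qed.

Lemma hderA_scale e b k f : homog gK e k -> supercommutative gK -> hderA b f ->
  hderA (e (+) b) (fun a => iota k * f a).
Proof.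
move=> hk commK hf; have /(hderP _ module_scalars)[fm fk fl] := hf.
have hi := iota_homog hk.
apply/(hderP _ module_scalars); split.
- split=> // [x y _ _|c x _ hx]; first by rewrite (hmapD fm) // mulrDr.
  by rewrite -addbA; apply: superA => //; exact: (hmap_homog fm).
- move=> c k' a hk' _; rewrite (fk c) // /actA.
  have kk : iota k * iota k' = koszul e c (iota k' * iota k).
    by exact: commA hi (iota_homog hk').
  rewrite /koszul in kk *.
  by case: (b) (c) (e) kk => [] [] [] /= kk; rewrite ?mulrN !mulrA kk ?mulNr ?opprK.
- move=> c x y _ _ hx; rewrite (fl c) // mulrDr mulrA; congr (_ + _).
  have xk := commA hx hi; rewrite mulrA xk /koszul.
  by case: (b) (c) (e) => [] [] [] /=; rewrite ?mulrN ?mulNr ?opprK mulrA.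
Qed.

Lemma lift_scalar_hom a f v : (forall a a', f (a + a') = f a + f a') ->
  lift_der (fun x => a * f x) v = a *: lift_der f v.
Proof.
move=> fD; apply: (coord_inj ex1) => i Ii.
rewrite (coordZ ex1) /lift_der !(coord_coordwise ex1) // => _ x y.
by rewrite fD mulrDr.
Qed.

Lemma extend_scale e b k f z : homog gK e k -> hderA b f -> L z ->
  extend (fun a => iota k * f a) (lift_der (fun a => iota k * f a)) z =
    la k (extend f (lift_der f) z).
Proof.
move=> hk hf; case: z => [[[a u] v] x] Ex.
have fD := hderA_additive hf.
have -> : lift_der (fun a => iota k * f a) = fun v => iota k *: lift_der f v.
  by apply/funext => w; exact: lift_scalar_hom.
apply: eq_Tinf => // w.
by rewrite (sbr_scale _ (iota_homog hk) (ss_map (hder_semiskew hf))).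
Qed.

Lemma extend_scomm b c f g z : hderA b f -> hderA c g -> L z ->
  extend f (lift_der f) (extend g (lift_der g) z) -
    koszul b c (extend g (lift_der g) (extend f (lift_der f) z)) =
  extend (fun a => f (g a) - koszul b c (g (f a)))
    (lift_der (fun a => f (g a) - koszul b c (g (f a)))) z.
Proof.
move=> hf hg Lz.
have hfg := hder_scomm module_scalars product_scalars hf hg.
have /(hderP _ module_Einf)[mf _ _] := hder_lift hf.
have /(hderP _ module_Einf)[mg _ _] := hder_lift hg.
have /(hderP _ module_Einf)[mfg _ _] := hder_lift hfg.
have mc := hmap_scomm graded_Einf mf mg.
move: z Lz; apply: (graded_ind graded_Einf) => [y z Ly Lz E1 E2|e z].
  by rewrite (hmapD mfg Ly Lz) -E1 -E2; exact: (hmapD mc Ly Lz).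
case: z => [[[a u] v] x] Ex /(homog_Einf _ _ _ _ (Ex : E x))[ha hu hv hx].
have Sm := ss_map (hder_semiskew hf); have Tm := ss_map (hder_semiskew hg).
have STm := ss_map (hder_semiskew hfg).
have liftE w : lift_der (fun a => f (g a) - koszul b c (g (f a))) w =
    lift_der f (lift_der g w) - koszul b c (lift_der g (lift_der f w)).
  apply: (coord_inj ex1) => i Ii; rewrite (coordB ex1).
  have -> w' : coord (koszul b c w') i = koszul b c (coord w' i).
    by rewrite /koszul; case: (b && c); rewrite ?(coordN ex1).
  by rewrite /lift_der !(coord_coordwise ex1) // => _;
    first [exact: (hderA_additive hf)|exact: (hderA_additive hg)
          |exact: (hderA_additive hfg)].
rewrite !(extend_homog _ _ _ _ Sm hx) !(extend_homog _ _ _ _ Tm hx).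
rewrite (extend_homog _ _ _ _ STm hx).
rewrite (extend_homog _ _ _ _ Sm (hmap_scomm GM Tm hx)).
rewrite (extend_homog _ _ _ _ Tm (hmap_scomm GM Sm hx)).
rewrite koszul_Tinf TinfN TinfD; apply: eq_Tinf => [|||w]; rewrite ?liftE //.
rewrite !(hmapB GM Sm) // !(hmapB GM Tm) // !(hmap_koszul GM _ _ Sm) //.
rewrite !(hmap_koszul GM _ _ Tm) // !(hmapB GM hx) // !(hmap_koszul GM _ _ hx) //.
by rewrite /koszul; case: (b) (c) (e) => [] [] [] /=; zmod.
Qed.

Lemma dSset_sbr d e : dSE d -> dSE e -> dSE (sbr p d e).
Proof.
move=> /dSset_split[d' [hd md dE]] /dSset_split[e' [he me eE]].
have S b c : dSE (fun z => d' b (e' c z) - koszul b c (e' c (d' b z))).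
  have [f hf ->] := hd b; have [g hg ->] := he c.
  apply: (dSset_hder (hder_scomm module_scalars product_scalars hf hg)) => z Lz.
  exact: extend_scomm.
apply: (eq_dSset _ (dSset_add (dSset_add (S true true) (S true false))
                              (dSset_add (S false true) (S false false)))).
by move=> z Lz; rewrite (sbr_sum graded_Einf md me dE eE Lz) !big_bool.
Qed.

Lemma dSset_subsupermodule : supercommutative gK -> subsupermodule p la dSE.
Proof.
move=> commK; split; [exact: dSset0|exact: dSset_sub| |].
- move=> k d /dSset_split[d' [hd md dE]].
  have S e b : dSE (fun z => la (gK e k) (d' b z)).
    have [f hf ->] := hd b.
    have hk : homog gK e (gK e k) by exact: (homog_part (grading_graded gK)).
    apply: (dSset_hder (hderA_scale hk commK hf)) => z Lz.
    by rewrite (extend_scale hk hf Lz).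
  apply: (eq_dSset _ (dSset_add (dSset_add (S false false) (S true false))
                                (dSset_add (S false true) (S true true)))) => z Lz /=.
  have laDl (y : T) : la (gK false k) y + la (gK true k) y = la k y.
    have ik : iota k = iota (gK false k) + iota (gK true k).
      by rewrite -rmorphD part_sum.
    case: y => [[[a u] v] x]; rewrite /Einf_act /= TinfD.
    by apply: eq_Tinf => [|||w]; rewrite [in RHS]ik ?mulrDl ?scalerDl.
  by rewrite !laDl dE // (gm_addr module_Einf) //; exact: (hmapL (md _)).
- move=> b d /dSset_split[d' [hd md dE]].
  have [f hf d'E] := hd b; apply: (dSset_hder hf) => z Lz.
  by rewrite (epart_split graded_Einf _ md dE Lz) d'E.
Qed.

(** ** Inner derivations of E_oo *)

Lemma signed_app_scale a x v : E x -> signed_app gM x (a *: v) = a *: signed_app gM x v.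
Proof.
move=> Ex; have hx c := E_hmap c Ex.
have -> : x = fun w => epart gM false x w + epart gM true x w.
  by apply/funext => w; exact: osp_sum (E_osp Ex).
rewrite !signed_appDl scalerDr.
have sD b u w : signed_app gM (epart gM b x) (u + w) =
    signed_app gM (epart gM b x) u + signed_app gM (epart gM b x) w.
  exact: signed_appDr (E_epart b Ex).
have S b : signed_app gM (epart gM b x) (a *: v) = a *: signed_app gM (epart gM b x) v.
  move: v; apply: (grading_ind (g := gM)) => [u w E1 E2|c v hv].
    by rewrite scalerDr !sD E1 E2 scalerDr.
  move: a; apply: (grading_ind (g := gA)) => [a a' E1 E2|e a ha].
    by rewrite !scalerDl sD E1 E2.
  rewrite (signed_app_homog (hx b) (superM ha hv)) (signed_app_homog (hx b) hv).
  rewrite (hendZ _ (E_hend (E_epart b Ex) (hx b)) ha) /koszul.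
  by case: (b) (c) (e) => [] [] [] /=; rewrite ?scalerN ?opprK.
by rewrite !S.
Qed.

Lemma act_mul k y z : L y -> L z -> la k (mul y z) = mul (la k y) z.
Proof.
case: y z => [[[a u] v] x] [[[a' u'] v'] x'] Ex Ex'.
apply: eq_Tinf => [|||w].
- by rewrite mulrBr !qZl.
- by rewrite signed_app_scale // scale_rscale !(scalerBr, scalerDr) scalerA.
- by rewrite signed_app_scale // scale_rscale !(scalerBr, scalerDr) scalerN scalerA.
- rewrite !opE_scalel !scalerDr; congr (_ + _).
  have hx c := E_hmap c (Ex : E x).
  have {1 2}-> : x = fun w => epart gM false x w + epart gM true x w.
    by apply/funext => v1; exact: osp_sum (E_osp (Ex : E x)).
  have aD := E_additive (Ex' : E x').
  rewrite sbrDl // scalerDr.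
  have -> : (fun w => iota k *: (epart gM false x w + epart gM true x w)) =
      fun w => iota k *: epart gM false x w + iota k *: epart gM true x w.
    by apply/funext => v1; rewrite scalerDr.
  rewrite sbrDl //.
  have S b : sbr gM (fun w => iota k *: epart gM b x w) x' w =
      iota k *: sbr gM (epart gM b x) x' w.
    have -> : iota k = iota (gK false k) + iota (gK true k).
      by rewrite -rmorphD part_sum.
    have -> : (fun w => (iota (gK false k) + iota (gK true k)) *: epart gM b x w) =
       fun w => iota (gK false k) *: epart gM b x w + iota (gK true k) *: epart gM b x w.
      by apply/funext => v1; rewrite scalerDl.
    rewrite sbrDl // scalerDl.
    have hk e : homog gA e (iota (gK e k)).
      by apply: iota_homog; exact: (homog_part (grading_graded gK)).
    by rewrite !(sbr_scale _ (hk _) (hx b)).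
  by rewrite !S.
Qed.

Lemma adE_subsupermodule : subsupermodule p la adE.
Proof.
apply: (adset_subsupermodule module_Einf product_Einf); exact: act_mul.
Qed.

Lemma adE_ideal d e : DerE d -> adE e -> adE (sbr p d e).
Proof. exact: (adset_ideal module_Einf product_Einf). Qed.

Lemma adE_Der d : adE d -> DerE d.
Proof.
move=> [y Ly dE]; have Lp b := graded_part graded_Einf b Ly.
have hp b := homog_part graded_Einf b Ly.
exists (mul (p false y)), (mul (p true y)).
split=> [||z Lz]; try exact: (hder_ad (Lp _) (hp _)).
rewrite dE // -(gp_addl product_Einf) // (graded_sum graded_Einf) //.
Qed.

(** * Every derivation is the sum of an inner and of a scalar one *)

Lemma neg_self (V : lmodType A) (v : V) : v = - v -> v = 0.
Proof.
have [y [_ y2]] := invZ (n := 2) isT => vN.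
have : 2%:~R *: v = 0 by rewrite scaler_int mulrz_nat mulr2n {2}vN subrr.
by move/(congr1 (fun w => y *: w)); rewrite scalerA y2 scale1r scaler0.
Qed.

Lemma qZr_even a u v : homog gM false u -> q u (a *: v) = a * q u v.
Proof.
move=> hu; move: a; apply: (grading_ind (g := gA)) => [x y E1 E2|b a ha].
  by rewrite scalerDl qDr E1 E2 mulrDl.
by rewrite (qZr _ ha hu) koszulf.
Qed.

Lemma sign_unit n (a : A) : a * (-1) ^+ n = 0 -> a = 0.
Proof.
move/(congr1 (fun x => x * (-1) ^+ n)).
by rewrite mul0r -mulrA -expr2 sqrr_sign mulr1.
Qed.

Lemma exists_avoiding (i k : rat) : exists n : int,
  [/\ n%:~R != i, n%:~R != - i, n%:~R != k & n%:~R != - k].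
Proof.
pose n := (Num.floor (`|i| + `|k|) + 1 : int).
have ltn : `|i| + `|k| < n%:~R by exact: floorD1_gt.
have H x : `|x| <= `|i| + `|k| -> n%:~R != x /\ n%:~R != - x.
  move=> xle; have xlt := le_lt_trans xle ltn.
  split; apply: contraTneq xlt => nE; rewrite nE -leNgt ?ler_norm //.
  by rewrite -normrN ler_norm.
have [|h1 h2] := H i; first by rewrite lerDl normr_ge0.
have [|h3 h4] := H k; first by rewrite lerDr normr_ge0.
by exists n.
Qed.

Section Centralizer.
Variables (b : bool) (R : M -> M).
Hypothesis hR : hend b R.
Hypothesis Rcentral : forall i j, I i -> I j -> exists g : A, forall w,
  R (opE (m i) (m j) w) -
    koszul b (parity i (+) parity j) (opE (m i) (m j) (R w)) = g *: w.

(** For an integral index [j] different from [i], [-i], [k] and [-k], the operator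
    [E_{m_i,m_j}] kills [m_k]. Hence it maps [R m_k] to a multiple of [m_k],
    while the coefficient of [m_j] in this image is, up to sign,
    [q (m_i) (R m_k)]. *)
Lemma central_orthogonal i k : I i -> I k -> i != k -> i != - k ->
  q (m i) (R (m k)) = 0.
Proof.
move=> Ii Ik ik iNk; have [n [ni nNi nk nNk]] := exists_avoiding i k.
set j : rat := n%:~R in ni nNi nk nNk; have Ij : I j := I_int n.
have hj := homog_basis_vec Ij; have hk := homog_basis_vec Ik.
have hi := homog_basis_vec Ii; rewrite parity_int in hj.
have hRk := hmap_homog (hend_map hR) Logic.I hk.
have [g /(_ (m k))] := Rcentral Ii Ij.
rewrite (opE_half _ hj hk) (opE_half _ hj hRk).
rewrite (q_basis_off Ij Ik nNk) (q_basis_off Ii Ik iNk) rscale0r scale0r koszul0 subr0.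
rewrite (hmap0 GM (hend_map hR)) sub0r => /(congr1 (fun v => coord v j)).
rewrite (coordN ex1) (coord_scale_basis ex1) // (negPf nk).
have kos b1 b2 v : coord (koszul b1 b2 v) j = koszul b1 b2 (coord v j).
  by rewrite /koszul; case: (b1 && b2); rewrite // (coordN ex1).
rewrite kos (coordB ex1) kos (rscale_homog (q_homog hj hRk) hi) kos.
rewrite !(coord_scale_basis ex1) // (negPf ni) eqxx koszul0 sub0r => /eqP.
rewrite oppr_eq0 => /eqP /(congr1 (koszul b (parity i (+) parity j))).
rewrite koszulK koszul0 => /eqP; rewrite oppr_eq0 => /eqP.
by move/(congr1 (koszul false (b (+) parity k))); rewrite koszulK koszul0.
Qed.

(** [E_{m_l,m_(-k)}] maps [m_k] to [m_l] up to sign and, by the previous lemma,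
    [R m_k] to a multiple of [m_l] whose coefficient only depends on [k]. Hence
    [R m_l] is a fixed multiple of [m_l] plus some [g m_k], and pairing with
    [m_(-k)] gives [g = 0]. *)
Lemma central_scalar_off (k : rat) : I k -> parity k = false -> k != 0 ->
  exists2 r, homog gA b r & forall l, I l -> l != k -> l != - k -> R (m l) = r *: m l.
Proof.
move=> Ik pk k0; have IN := I_opp Ik.
have hk := homog_basis_vec Ik; have hN := homog_basis_vec IN.
rewrite parity_opp in hN; rewrite pk in hk hN.
have hRk := hmap_homog (hend_map hR) Logic.I hk.
have [n nE] := q_basis_opp IN; rewrite opprK in nE.
pose be := q (m (- k)) (R (m k)).
have hbe : homog gA b be by have := q_homog hN hRk; rewrite addbF.
have signb : homog gA b ((-1) ^+ n * be).
  rewrite -signr_odd; case: (odd n); rewrite ?expr0 ?expr1 ?mul1r // mulN1r.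
  exact: (homogN GA).
exists ((-1) ^+ n * be) => // l Il lk lNk.
have hl := homog_basis_vec Il; have Nkl : - k != l by rewrite eq_sym.
have Nknl : - k != - l by rewrite eqr_opp eq_sym.
have [g gE] := Rcentral Il IN; have := gE (m k).
rewrite (opE_half _ hN hk) (opE_half _ hN hRk) nE.
rewrite (q_basis_off Il Ik lNk) (central_orthogonal Il Ik lk lNk).
rewrite !scale0r !koszul0 !subr0.
rewrite (rscale_homog hbe hl) parity_opp pk addbF koszulK.
have -> : m l <* (-1) ^+ n = (-1) ^+ n *: m l.
  rewrite -signr_odd; case: (odd n); rewrite ?expr0 ?expr1 ?rscale1 ?scale1r //.
  by rewrite rscaleNr rscale1 scaleN1r.
have -> : R ((-1) ^+ n *: m l) = (-1) ^+ n *: R (m l).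
  by rewrite -signr_odd !scaler_sign; case: (odd n); rewrite ?(hmapN GM (hend_map hR)).
move=> E1; have := congr1 (q (m (- k))) E1.
rewrite qDr qNr !qZr_even // (central_orthogonal IN Il Nkl Nknl).
rewrite (q_basis_off IN Il Nknl) !mulr0 subr0 nE => /esym/sign_unit g0.
move: E1; rewrite g0 scale0r => /eqP; rewrite subr_eq0 => /eqP.
move/(congr1 (fun v => (-1) ^+ n *: v)); rewrite !scalerA.
by rewrite -expr2 sqrr_sign scale1r.
Qed.

(** The indices [k = 1] and [k = 2] together reach all [l], and [l = 0], which
    both reach, shows that they give the same scalar. *)
Lemma central_scalar : exists2 r, homog gA b r & forall v, R v = r *: v.
Proof.
have I1 := I_int 1; have I2 := I_int 2; have I0 := I_int 0.
have [r1 hr1 R1] := central_scalar_off I1 (parity_int 1) isT.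
have [r2 hr2 R2] := central_scalar_off I2 (parity_int 2) isT.
have r12 : r1 = r2.
  have := R1 _ I0 isT isT; rewrite R2 // => /(congr1 (fun v => coord v 0%:~R)).
  by rewrite !(coord_scale_basis ex1) // eqxx.
exists r1 => // v; apply/eqP; rewrite -subr_eq0; apply/eqP.
have hd : hend b (fun w => R w + (- r1) *: w).
  by apply: hend_add => //; apply: hend_scalar => //; exact: (homogN GA).
rewrite -scaleNr; apply: (hend_basis0 hd) => l Il.
have [->|l1] := eqVneq l 1%:~R; first by rewrite R2 // scaleNr r12 subrr.
have [->|l1'] := eqVneq l (- 1%:~R).
  by rewrite R2 ?scaleNr ?r12 ?subrr //; exact: (I_opp I1).
by rewrite R1 // scaleNr subrr.
Qed.

End Centralizer.

(** An element of the center is a scalar [r] by [central_scalar], and a scalar in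
    [osp q] satisfies [2 r q (m_0, m_0) = 0]. *)
Lemma E_center b y : E y -> hmap gM setT b y ->
  (forall x, E x -> forall w, sbr gM y x w = 0) -> forall w, y w = 0.
Proof.
move=> Ey hy yc; have [r hr yr] : exists2 r, homog gA b r & forall v, y v = r *: v.
  apply: (central_scalar (E_hend Ey hy)) => i j Ii Ij; exists 0 => w.
  have hE := hmap_opE (homog_basis_vec Ii) (homog_basis_vec Ij).
  by rewrite scale0r -(sbr_hmap GM hy hE) // yc //; exact: E_opE.
have I0 := I_int 0; have h0 := homog_basis_vec I0; rewrite parity_int in h0.
have := ss_q (E_semiskew Ey hy) (m 0%:~R) h0.
rewrite koszulf !yr qZl (qZr_even _ _ h0) => /esym r2.
have [n nE] := q_basis_opp I0; rewrite oppr0 in nE.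
have r0 : r = 0.
  apply: (@sign_unit n); rewrite -nE.
  by apply: (@neg_self A^o); apply/eqP; rewrite -addr_eq0; apply/eqP.
by move=> w; rewrite yr r0 scale0r.
Qed.

Lemma mul_deg0 a x (z : T) : L z -> mul (a, 0, 0, x) z =
  (0, a *: z.1.1.2 + x z.1.1.2, - (a *: z.1.2) + x z.1.2, sbr gM x z.2).
Proof.
case: z => [[[a' u'] v'] x'] Ex.
have s0 := signed_app0 (Ex : E x').
by apply: eq_Tinf => [|||w]; rewrite ?q0l ?opE0l ?rscale0l ?s0; zmod.
Qed.

(** ** The grading element *)

Definition hgrad : T := (1, 0, 0, fun=> 0).

Lemma hgrad_mem : L hgrad. Proof. exact: E0. Qed.

Lemma hgrad_homog : homog p false hgrad.
Proof.
apply/homog_Einf; first exact: E0.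
split; [exact: homog_one|exact: (homog0 GM)|exact: (homog0 GM)|].
exact: (hmap_const0 GM).
Qed.

Lemma signed_app_zero v : signed_app gM (fun=> 0) v = 0.
Proof. by rewrite /signed_app /epart !big_bool /koszul /= !(graded_part0 GM); zmod. Qed.

Lemma sbr0l x w : E x -> sbr gM (fun=> 0) x w = 0.
Proof.
move=> Ex; have := sbrDl (fun=> 0) (fun=> 0) w (E_additive Ex).
rewrite (_ : (fun w => 0 + 0) = fun=> 0) => [/addrr_eq //|].
by apply/funext => v; rewrite addr0.
Qed.

Lemma sbr0r x w : E x -> sbr gM x (fun=> 0) w = 0.
Proof.
move=> Ex; have := sbrDr (fun=> 0) (fun=> 0) w (E_additive Ex).
rewrite (_ : (fun w => 0 + 0) = fun=> 0) => [/addrr_eq //|].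
by apply/funext => v; rewrite addr0.
Qed.

Lemma mul_hgrad z : L z -> mul hgrad z = (0, z.1.1.2, - z.1.2, fun=> 0).
Proof.
move=> Lz; rewrite /hgrad mul_deg0 //.
by apply: eq_Tinf => [|||w]; rewrite ?scale1r ?addr0 ?sbr0l.
Qed.

Section Decomposition.
Variables (b : bool) (d : T -> T).
Hypothesis hd : hderE b d.

Let dm : hmap p L b d. Proof. by case/(hderP _ module_Einf): hd. Qed.
Let dM : leibniz p mul L b d. Proof. by case/(hderP _ module_Einf): hd. Qed.
Let dk : klinear gK la L b d. Proof. by case/(hderP _ module_Einf): hd. Qed.

(** Applying [d] to the brackets of [hgrad] with the two copies of [M] gives
    [al u + y u = 0] and [- al v + y v = 0], hence [al = 0] and [y = 0]; the other
    components of these equations put the images in the right eigenspaces. *)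
Lemma deriv_hgrad0 al y : d hgrad = (al, 0, 0, y) ->
  [/\ d hgrad = 0,
    forall u, d (0, u, 0, fun=> 0) =
      (0, (d (0, u, 0, fun=> 0)).1.1.2, 0, fun=> 0),
    forall v, d (0, 0, v, fun=> 0) =
      (0, 0, (d (0, 0, v, fun=> 0)).1.2, fun=> 0) &
    forall a x, E x -> d (a, 0, 0, x) =
      ((d (a, 0, 0, x)).1.1.1, 0, 0, (d (a, 0, 0, x)).2)].
Proof.
move=> dh; have Lh := hgrad_mem; have Ldh := hmapL dm Lh.
have Ey : E y by have := Ldh; rewrite dh.
have y0 := osp_at0 (E_osp Ey).
have LU u : L (0, u, 0, fun=> 0) by exact: E0.
have LV v : L (0, 0, v, fun=> 0) by exact: E0.
have dhz z : L z -> d (mul hgrad z) =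
    (0, al *: z.1.1.2 + y z.1.1.2, - (al *: z.1.2) + y z.1.2, sbr gM y z.2) +
    (0, (d z).1.1.2, - (d z).1.2, fun=> 0).
  move=> Lz; rewrite (dM Lh Lz hgrad_homog) dh mul_deg0 // mul_hgrad ?koszulf //.
  exact: (hmapL dm).
have sbr0 w := sbr0r w Ey.
have HU u : d (0, u, 0, fun=> 0) = (0, (d (0, u, 0, fun=> 0)).1.1.2, 0, fun=> 0) /\
    al *: u + y u = 0.
  have := dhz _ (LU u); rewrite mul_hgrad //= oppr0.
  case: (d (0, u, 0, fun=> 0)) => [[[a1 u1] v1] z1] /=.
  rewrite TinfD scaler0 oppr0 y0 => -[-> E1 E2 E3].
  have al0 : al *: u + y u = 0.
    by move/eqP: E1; rewrite eq_sym -subr_eq0 addrK => /eqP.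
  split=> //; apply: eq_Tinf => //; first exact: addr0.
    by apply: (@neg_self M); rewrite {1}E2; zmod.
  by move=> w; rewrite E3 sbr0 addr0.
have HV v : d (0, 0, v, fun=> 0) = (0, 0, (d (0, 0, v, fun=> 0)).1.2, fun=> 0) /\
    - (al *: v) + y v = 0.
  have := dhz _ (LV v); rewrite mul_hgrad //=.
  have -> : (0, 0, - v, fun=> 0) = - ((0, 0, v, fun=> 0) : T).
    by rewrite TinfN; apply: eq_Tinf => [|||w]; rewrite ?oppr0.
  rewrite (hmapN graded_Einf dm) //.
  case: (d (0, 0, v, fun=> 0)) => [[[a1 u1] v1] z1] /=.
  rewrite TinfN TinfD scaler0 y0 => -[E0 E1 E2 E3].
  have al0 : - (al *: v) + y v = 0.
    by move/eqP: E2; rewrite eq_sym -subr_eq0 addrK => /eqP.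
  split=> //; apply: eq_Tinf => //.
  - by apply/eqP; rewrite -oppr_eq0 E0 addr0.
  - by apply: (@neg_self M); rewrite -[RHS]/(- u1) E1; zmod.
  - move=> w; apply/eqP; rewrite -oppr_eq0; apply/eqP.
    by have := congr1 (fun f => f w) E3; rewrite /= sbr0 addr0.
have al0 : al = 0.
  apply: scale_inj => v; rewrite scale0r; apply: neg_self.
  have [_ E1] := HU v; have [_ E2] := HV v.
  by apply: (@addIr _ (y v)); rewrite E1 E2.
have yz v : y v = 0 by have [_] := HU v; rewrite al0 scale0r add0r.
split=> [|u|v|a x Ex]; [|by case: (HU u)|by case: (HV v)|].
  by rewrite dh al0; apply: eq_Tinf.
have Lz : L (a, 0, 0, x) by [].
have := dhz _ Lz; rewrite mul_hgrad //= oppr0.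
have -> : (0, 0, 0, fun=> 0) = 0 :> T by [].
rewrite (hmap0 graded_Einf dm).
case: (d (a, 0, 0, x)) => [[[a1 u1] v1] z1] /=.
rewrite TinfD !scaler0 !oppr0 !y0 => -[_ E1 E2 _].
apply: eq_Tinf => //.
  by rewrite E1; zmod.
by apply/eqP; rewrite -oppr_eq0 E2; apply/eqP; zmod.
Qed.

(** ** Derivations which kill the grading element *)

Section KillGrading.
Hypothesis dh : d hgrad = 0.

Let inU (u : M) : T := (0, u, 0, fun=> 0).
Let inV (v : M) : T := (0, 0, v, fun=> 0).
Let inA (a : A) : T := (a, 0, 0, fun=> 0).
Let inX (x : M -> M) : T := (0, 0, 0, x).

Let LU u : L (inU u). Proof. exact: E0. Qed.
Let LV v : L (inV v). Proof. exact: E0. Qed.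
Let LA a : L (inA a). Proof. exact: E0. Qed.

(* The matrix of [d], which preserves the decomposition of [E_oo] into
   eigenspaces of [hgrad]. *)
Let S u := (d (inU u)).1.1.2.
Let S' v := (d (inV v)).1.2.
Let f a := (d (inA a)).1.1.1.
Let F a := (d (inA a)).2.
Let g x := (d (inX x)).1.1.1.
Let H x := (d (inX x)).2.

Let dU u : d (inU u) = inU (S u).
Proof. by have [_ -> _ _] := deriv_hgrad0 (dh : _ = (0, 0, 0, fun=> 0)). Qed.

Let dV v : d (inV v) = inV (S' v).
Proof. by have [_ _ -> _] := deriv_hgrad0 (dh : _ = (0, 0, 0, fun=> 0)). Qed.

Let dA a : d (inA a) = (f a, 0, 0, F a).
Proof. by have [_ _ _ ->] := deriv_hgrad0 (dh : _ = (0, 0, 0, fun=> 0)); last exact: E0. Qed.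

Let dX x : E x -> d (inX x) = (g x, 0, 0, H x).
Proof. by move=> Ex; have [_ _ _ ->] := deriv_hgrad0 (dh : _ = (0, 0, 0, fun=> 0)). Qed.

Let hU c u : homog gM c u -> homog p c (inU u).
Proof.
move=> hu; apply/homog_Einf; first exact: E0.
by split=> //; [exact: (homog0 GA)|exact: (homog0 GM)|exact: (hmap_const0 GM)].
Qed.

Let hV c v : homog gM c v -> homog p c (inV v).
Proof.
move=> hu; apply/homog_Einf; first exact: E0.
by split=> //; [exact: (homog0 GA)|exact: (homog0 GM)|exact: (hmap_const0 GM)].
Qed.

Let hA c a : homog gA c a -> homog p c (inA a).
Proof.
move=> hu; apply/homog_Einf; first exact: E0.
by split=> //; [exact: (homog0 GM)|exact: (homog0 GM)|exact: (hmap_const0 GM)].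
Qed.

Let hX c x : E x -> hmap gM setT c x -> homog p c (inX x).
Proof.
move=> Ex hx; apply/homog_Einf => //.
by split=> //; [exact: (homog0 GA)|exact: (homog0 GM)|exact: (homog0 GM)].
Qed.

Let S_hmap : hmap gM setT b S.
Proof.
split=> // [u v _ _|c u _ hu].
  have E1 : inU (u + v) = inU u + inU v.
    by rewrite /inU TinfD; apply: eq_Tinf => [|||w]; rewrite ?addr0.
  by rewrite /S E1 (hmapD dm).
have := hmap_homog dm (LU u) (hU hu); rewrite dU => /(homog_Einf _ _ _ _ E0).
by case.
Qed.

Let S'_hmap : hmap gM setT b S'.
Proof.
split=> // [u v _ _|c u _ hu].
  have E1 : inV (u + v) = inV u + inV v.
    by rewrite /inV TinfD; apply: eq_Tinf => [|||w]; rewrite ?addr0.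
  by rewrite /S' E1 (hmapD dm).
have := hmap_homog dm (LV u) (hV hu); rewrite dV => /(homog_Einf _ _ _ _ E0).
by case.
Qed.

Let f_hmap : hmap gA setT b f.
Proof.
split=> // [u v _ _|c a _ ha].
  have E1 : inA (u + v) = inA u + inA v.
    by rewrite /inA TinfD; apply: eq_Tinf => [|||w]; rewrite ?addr0.
  by rewrite /f E1 (hmapD dm).
have Ld := hmapL dm (LA a); rewrite dA in Ld.
have := hmap_homog dm (LA a) (hA ha); rewrite dA => /(homog_Einf _ _ _ _ Ld).
by case.
Qed.

Let EF a : E (F a).
Proof. by have := hmapL dm (LA a). Qed.

Let F_hmap c a : homog gA c a -> hmap gM setT (b (+) c) (F a).
Proof.
move=> ha; have := hmap_homog dm (LA a) (hA ha); rewrite dA.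
by move=> /(homog_Einf _ _ _ _ (EF a))[].
Qed.

Let EH x : E x -> E (H x).
Proof. by move=> Ex; have := hmapL dm (Ex : L (inX x)). Qed.

(* The products of the components of degree 0 with those of degree 1 and -1. *)
Let mul0U a x u : E x -> mul (a, 0, 0, x) (inU u) = inU (a *: u + x u).
Proof.
move=> Ex; rewrite mul_deg0 //=; apply: eq_Tinf => [|||w] //.
  by rewrite scaler0 oppr0 (osp_at0 (E_osp Ex)) addr0.
by rewrite sbr0r.
Qed.

Let mul0V a x v : E x -> mul (a, 0, 0, x) (inV v) = inV (- (a *: v) + x v).
Proof.
move=> Ex; rewrite mul_deg0 //=; apply: eq_Tinf => [|||w] //.
  by rewrite scaler0 (osp_at0 (E_osp Ex)) addr0.
by rewrite sbr0r.
Qed.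

Let mul0X a x a' x' : E x -> E x' -> mul (a, 0, 0, x) (a', 0, 0, x') = inX (sbr gM x x').
Proof.
move=> Ex Ex'; rewrite mul_deg0 //=; apply: eq_Tinf => [|||w] //.
  by rewrite scaler0 (osp_at0 (E_osp Ex)) addr0.
by rewrite scaler0 oppr0 (osp_at0 (E_osp Ex)) addr0.
Qed.

Let inU_inj u v : inU u = inU v -> u = v. Proof. by case. Qed.
Let inV_inj u v : inV u = inV v -> u = v. Proof. by case. Qed.

Let inUD u v : inU u + inU v = inU (u + v).
Proof. by rewrite /inU TinfD; apply: eq_Tinf => [|||w]; rewrite ?addr0. Qed.

Let inVD u v : inV u + inV v = inV (u + v).
Proof. by rewrite /inV TinfD; apply: eq_Tinf => [|||w]; rewrite ?addr0. Qed.

Let koszulU c e u : koszul c e (inU u) = inU (koszul c e u).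
Proof. by rewrite koszul_Tinf !koszul0; apply: eq_Tinf => // w; rewrite koszul0. Qed.

Let koszulV c e u : koszul c e (inV u) = inV (koszul c e u).
Proof. by rewrite koszul_Tinf !koszul0; apply: eq_Tinf => // w; rewrite koszul0. Qed.

Let S_scale0 c a u : homog gA c a ->
  S (a *: u) = f a *: u + F a u + koszul b c (a *: S u).
Proof.
move=> ha; apply: inU_inj; rewrite -dU.
have -> : inU (a *: u) = mul (inA a) (inU u) by rewrite mul0U ?addr0 //; exact: E0.
rewrite (dM (LA a) (LU u) (hA ha)) dA dU mul0U ?mul0U ?koszulU ?inUD ?addr0 //.
exact: E0.
Qed.

Let S'_scale0 c a v : homog gA c a ->
  S' (a *: v) = f a *: v - F a v + koszul b c (a *: S' v).
Proof.
move=> ha; have E1 : - S' (a *: v) = - (f a *: v) + F a v + koszul b c (- (a *: S' v)).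
  rewrite -(hmapN GM S'_hmap) //; apply: inV_inj; rewrite -dV.
  have -> : inV (- (a *: v)) = mul (inA a) (inV v) by rewrite mul0V ?addr0 //; exact: E0.
  rewrite (dM (LA a) (LV v) (hA ha)) dA dV mul0V ?mul0V ?koszulV ?inVD ?addr0 //.
  exact: E0.
rewrite -[LHS]opprK E1 /koszul; case: (b && c); zmod.
Qed.

Let F_central c a x w : homog gA c a -> E x -> sbr gM (F a) x w = 0.
Proof.
move=> ha Ex.
have m0 : mul (inA a) (inX x) = 0.
  by rewrite mul0X //; [apply: eq_Tinf => // v; rewrite sbr0l|exact: E0].
have := dM (LA a) (Ex : L (inX x)) (hA ha).
rewrite m0 (hmap0 graded_Einf dm) dA dX // mul0X ?mul0X //; [|exact: E0|exact: EH].
rewrite koszul_Tinf TinfD => -[_ _ _ /(congr1 (fun k => k w))] /=.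
by rewrite sbr0l ?koszul0 ?addr0 //; exact: EH.
Qed.

Let F0 c a w : homog gA c a -> F a w = 0.
Proof.
move=> ha; apply: (E_center (EF a) (F_hmap ha)) => x Ex v.
exact: F_central ha Ex.
Qed.

Let S_scale c a u : homog gA c a -> S (a *: u) = f a *: u + koszul b c (a *: S u).
Proof. by move=> ha; rewrite (S_scale0 _ ha) (F0 _ ha) addr0. Qed.

Let S'_scale c a u : homog gA c a -> S' (a *: u) = f a *: u + koszul b c (a *: S' u).
Proof. by move=> ha; rewrite (S'_scale0 _ ha) (F0 _ ha) subr0. Qed.

(* [f] is a derivation because [S] is semilinear and [M] is faithful. *)
Let f_hder : hderA b f.
Proof.
apply/(hderP _ module_scalars); split=> //.
- move=> c k a hk _; have := dk hk (LA a).
  have -> : la k (inA a) = inA (iota k * a).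
    by apply: eq_Tinf => [|||w]; rewrite ?scaler0.
  rewrite !dA /Einf_act koszul_Tinf => -[E1 _ _ _]; exact: E1.
- apply: (leibniz_homogP module_scalars product_scalars f_hmap).
  move=> c e a a' _ _ ha ha'; apply: scale_inj => v.
  have := S_scale v (superA ha ha'); rewrite -scalerA.
  rewrite (S_scale _ ha) (S_scale _ ha') scalerDr => E1.
  apply: (@addIr _ (koszul b (c (+) e) (a *: (a' *: S v)))); rewrite -scalerA in E1.
  rewrite -E1 scalerDl -!scalerA /koszul.
  by case: (b) (c) (e) => [] [] [] /=; rewrite ?scaleNr ?scalerN -?scalerA; zmod.
Qed.

Let S_bracket c x u : E x -> hmap gM setT c x ->
  S (x u) = g x *: u + H x u + koszul b c (x (S u)).
Proof.
move=> Ex hx; apply: inU_inj; rewrite -dU.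
have -> : inU (x u) = mul (inX x) (inU u) by rewrite mul0U ?scale0r ?add0r.
rewrite (dM (Ex : L (inX x)) (LU u) (hX Ex hx)) dX // dU !mul0U //; last exact: EH.
by rewrite koszulU inUD scale0r add0r.
Qed.

Let S'_bracket c x u : E x -> hmap gM setT c x ->
  S' (x u) = - (g x *: u) + H x u + koszul b c (x (S' u)).
Proof.
move=> Ex hx; apply: inV_inj; rewrite -dV.
have -> : inV (x u) = mul (inX x) (inV u) by rewrite mul0V ?scale0r ?oppr0 ?add0r.
rewrite (dM (Ex : L (inX x)) (LV u) (hX Ex hx)) dX // dV !mul0V //; last exact: EH.
by rewrite koszulV inVD scale0r oppr0 add0r.
Qed.

Let S_diff_hend : hend b (fun u => S u - S' u).
Proof.
split; first exact: (hmap_sub GM).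
move=> c a v ha _; rewrite (S_scale _ ha) (S'_scale _ ha) scalerBr koszulB; zmod.
Qed.

Let S_diff : exists2 r, homog gA b r & forall u, S u - S' u = r *: u.
Proof.
apply: (central_scalar S_diff_hend) => i j Ii Ij.
have hE := hmap_opE (homog_basis_vec Ii) (homog_basis_vec Ij).
have EE := E_opE (m i) (m j).
exists (g (opE (m i) (m j)) + g (opE (m i) (m j))) => w.
rewrite (S_bracket _ EE hE) (S'_bracket _ EE hE).
rewrite (hmapB GM hE) // koszulB scalerDl; zmod.
Qed.

Let g0 c x : E x -> hmap gM setT c x -> g x = 0.
Proof.
move=> Ex hx; have [r hr rE] := S_diff.
apply: scale_inj => u; rewrite scale0r; apply: (@neg_self M).
have E1 : S (x u) - S' (x u) = koszul b c (x (S u - S' u)).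
  rewrite !rE (hendZ _ (E_hend Ex hx) hr) /koszul.
  by case: (b) (c) => [] [] /=; rewrite ?opprK.
rewrite (S_bracket _ Ex hx) (S'_bracket _ Ex hx) (hmapB GM hx) // koszulB in E1.
apply/eqP; rewrite -subr_eq0 opprK; apply/eqP.
by move/eqP: E1; rewrite -subr_eq0 => /eqP <-; zmod.
Qed.

Let S_q c u v : homog gM c u -> f (q u v) = q (S u) v + koszul b c (q u (S' v)).
Proof.
move=> hu; move: v; apply: (grading_ind (g := gM)) => [v w E1 E2|e v hv].
  by rewrite (hmapD S'_hmap) // !qDr (hmapD f_hmap) // E1 E2 koszulD; zmod.
have Ex := E_opE u v; have hx := hmap_opE hu hv.
have mUV u' v' : mul (inU u') (inV v') = (q u' v', 0, 0, opE u' v').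
  have hu' c' := homog_part GM c' (Logic.I : setT u').
  apply: eq_Tinf => [|||w].
  - by rewrite q0l subr0.
  - rewrite scaler0 rscale0r signed_app_zero; zmod.
  - by rewrite scale0r rscale0r signed_app_zero; zmod.
  - by rewrite opE0l sbr0l ?addr0 //; exact: E0.
have sp : (q u v, 0, 0, opE u v) = inA (q u v) + inX (opE u v).
  by rewrite /inA /inX TinfD; apply: eq_Tinf => [|||w]; rewrite ?addr0 ?add0r.
have := dM (LU u) (LV v) (hU hu).
rewrite dU dV !mUV sp (hmapD dm) // dA dX // koszul_Tinf !TinfD.
by rewrite (g0 Ex hx) addr0 => -[].
Qed.

(** [X] is [S] minus the scalar [rho = r / 2] and the extension of [f]. As
    [S' = S - r], the same [X] appears in [S'] with [rho] replaced by [- rho],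
    which is how [(rho, 0, 0, X)] acts on the two copies of [M]. *)
Lemma decompose_hgrad0 : exists fD y,
  [/\ hderA b fD, L y, homog p b y &
    forall z, L z -> d z = mul y z + extend fD (lift_der fD) z].
Proof.
have [r hr rE] := S_diff.
have [h2 [_ h2E]] := invZ (n := 2) isT.
(* Taking the part of degree [b] makes [rho] homogeneous without deciding the
   parity of the inverse of 2. *)
pose rho := gA b (h2 * r).
have hrho : homog gA b rho by exact: (homog_part GA).
have rho2 : rho + rho = r.
  rewrite /rho -(graded_partD GA) // -mulr2n -mulrnAl.
  by rewrite -[h2 *+ 2]mulr_natr h2E mul1r.
have ss := hder_semiskew f_hder.
pose X u := S u - (lift_der f u + rho *: u).
have hX0 : hmap gM setT b X.
  apply: (hmap_sub GM S_hmap); apply: (hmap_add GM (ss_map ss)).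
  exact: hend_map (hend_scalar hrho).
have S'E u : S' u = X u + lift_der f u - rho *: u.
  have -> : S' u = S u - r *: u by rewrite -rE; zmod.
  by rewrite /X -rho2 scalerDl; zmod.
have SE u : S u = X u + lift_der f u + rho *: u by rewrite /X; zmod.
have sX : semiskew b (fun=> 0) X.
  split=> //; first exact: (hmap_const0 GA).
  - move=> c a v ha; rewrite scale0r add0r /X (S_scale _ ha) (ss_scale ss _ ha).
    rewrite scalerBr scalerDr koszulB koszulD !scalerA (commA hrho ha).
    by rewrite /koszul; case: (b && c); rewrite ?scaleNr; zmod.
  - move=> c u v hu; have := S_q v hu; rewrite (ss_q ss v hu) SE S'E.
    rewrite !(qDl, qDr, qNl, qNr) qZl (qZr _ hrho hu) !koszulD => E1.
    have {E1} := E1; rewrite -[X in _ = _ + (_ + X)](_ : - (rho * q u v) = _); last first.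
      by rewrite /koszul; case: (b) (c) => [] [] /=; rewrite ?opprK.
    move/eqP; rewrite -subr_eq0 => /eqP E1; rewrite -[LHS]oppr0 -{}E1; zmod.
have bracket c x w : E x -> hmap gM setT c x ->
    sbr gM X x w = H x w - sbr gM (lift_der f) x w.
  move=> Ex hx; rewrite (sbr_hmap GM hX0 hx) // (sbr_hmap GM (ss_map ss) hx) //.
  rewrite /X (S_bracket _ Ex hx) (g0 Ex hx) scale0r add0r.
  rewrite !(hmapB GM hx) // (hmapD hx) // (hendZ _ (E_hend Ex hx) hrho) /koszul.
  by case: (b) (c) => [] [] /=; zmod.
have EX : E X.
  apply: (E_self_normalizing (semiskew_osp sX)) => x Ex.
  have hx c := E_hmap c Ex; have Ep c := E_epart c Ex.
  have xE : x = fun w => epart gM false x w + epart gM true x w.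
    by apply/funext => w; exact: osp_sum (E_osp Ex).
  have -> : sbr gM X x = fun w =>
      (H (epart gM false x) w - sbr gM (lift_der f) (epart gM false x) w) +
      (H (epart gM true x) w - sbr gM (lift_der f) (epart gM true x) w).
    apply/funext => w; rewrite [in LHS]xE sbrDr; last first.
      by move=> u v; exact: (hmapD hX0).
    by rewrite !(bracket _ _ _ (Ep _) (hx _)).
  have El c := E_sbr_lift f_hder (Ep c).
  by apply: E_add; apply: E_sub => //; exact: EH.
pose y : T := (rho, 0, 0, X).
have Ly : L y by [].
have hy : homog p b y.
  by apply/homog_Einf => //; split=> //; exact: (homog0 GM).
exists f, y; split=> //.
have /(hderP _ module_Einf)[my _ _] := hder_ad Ly hy.
have /(hderP _ module_Einf)[mf _ _] := hder_lift f_hder.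
have mr := hmap_add graded_Einf my mf.
apply: (graded_ind graded_Einf) => [z z' Lz Lz' E1 E2|c z Lz].
  by rewrite (hmapD dm) // E1 E2; have := hmapD mr Lz Lz' => /= ->.
case: z Lz => [[[a u] v] x] Ex /(homog_Einf _ _ _ _ (Ex : E x))[ha hu hv hx].
have -> : d (a, u, v, x) = (f a, S u, S' v, H x).
  have -> : (a, u, v, x) = inA a + inX x + (inU u + inV v).
    rewrite /inA /inX /inU /inV !TinfD.
    by apply: eq_Tinf => [|||w]; rewrite ?addr0 ?add0r.
  rewrite !(hmapD dm) //; try exact: (gradedD graded_Einf).
  rewrite dA dX // dU dV (g0 Ex hx) !TinfD.
  apply: eq_Tinf => [|||w] /=; try zmod.
  by change (F a w + H x w + (0 + 0) = H x w); rewrite (F0 _ ha); zmod.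
rewrite /y mul_deg0 // /extend TinfD; apply: eq_Tinf => [|||w] /=.
- by rewrite add0r.
- by rewrite SE; zmod.
- by rewrite S'E; zmod.
- by rewrite (bracket c) //; zmod.
Qed.

End KillGrading.
End Decomposition.

(** Here [(0, -u, v, 0)] is chosen because its bracket with [hgrad] is
    [(0, u, v, 0)], the part of [d hgrad] to be removed. *)
Lemma decompose_homog b d : hderE b d -> exists fD y,
  [/\ hderA b fD, L y &
    forall z, L z -> d z = mul y z + extend fD (lift_der fD) z].
Proof.
move=> hd; have /(hderP _ module_Einf)[dm _ _] := hd.
have Lh := hgrad_mem; have Ldh := hmapL dm Lh.
have := hmap_homog dm Lh hgrad_homog; rewrite addbF.
case E1 : (d hgrad) Ldh => [[[al u] v] y] Ey.
move=> /(homog_Einf _ _ _ _ (Ey : E y))[hal hu hv hy].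
pose y1 : T := (0, - u, v, fun=> 0).
have Ly1 : L y1 by exact: E0.
have hy1 : homog p b y1.
  apply/homog_Einf; first exact: E0.
  by split=> //; [exact: (homog0 GA)|exact: (homogN GM)|exact: (hmap_const0 GM)].
have hd1 := hder_sub module_Einf product_Einf hd (hder_ad Ly1 hy1).
have d1h : d hgrad - mul y1 hgrad = (al, 0, 0, y).
  rewrite E1 /y1 /hgrad (mulE 0 0 0 (homogN GM Logic.I hu) hv (hmap_const0 GM b)
    homog_one (hmap_const0 GM false)).
  rewrite TinfN TinfD; apply: eq_Tinf => [|||w];
    rewrite /= ?q0r ?opE0r ?scaler0 ?scale1r ?koszulf /koszul /=; zmod.
have [dh0 _ _ _] := deriv_hgrad0 hd1 d1h.
have [fD [y2 [hf Ly2 _ dE]]] := decompose_hgrad0 hd1 dh0.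
exists fD, (y1 + y2); split=> //; first exact: (gradedD graded_Einf).
move=> z Lz; rewrite (gp_addl product_Einf) // -addrA -dE //; zmod.
Qed.

Lemma DerE_decompose d : DerE d -> exists d1 d2, [/\ adE d1, dSE d2 &
  forall z, L z -> d z = d1 z + d2 z].
Proof.
move=> [d0 [d1 [/decompose_homog[f0 [y0 [hf0 Ly0 d0E]]]
  /decompose_homog[f1 [y1 [hf1 Ly1 d1E]]] dE]]].
exists (mul (y0 + y1)), (fun z => extend f0 (lift_der f0) z + extend f1 (lift_der f1) z).
split.
- by exists (y0 + y1) => //; exact: (gradedD graded_Einf).
- by apply: dSset_add; [exact: (dSset_hder hf0)|exact: (dSset_hder hf1)].
- move=> z Lz; rewrite dE // d0E // d1E // (gp_addl product_Einf) //; zmod.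
Qed.

(** If [ad y] is an extension of [D], it kills [hgrad], so that [y = (a, 0, 0, x)];
    comparing the two copies of [M] gives [a = 0], and [x] agrees with the
    extension of [D], which vanishes on the basis. *)
Lemma adE_dSE_disjoint d : adE d -> dSE d -> forall z, L z -> d z = 0.
Proof.
move=> [y Ly dE] /dSsetP[D hD dE'].
have [D' hD' DE] := DerA_split hD.
have D1 : D 1 = 0.
  by rewrite DE !(leibniz_one (hderA_leibniz (hD' _))) addr0.
have lb i : I i -> lift_der D (m i) = 0.
  move=> Ii; rewrite DE lift_add; try exact: hderA_additive.
  by rewrite !(lift_basis (hderA_hmap (hD' _)) (hderA_leibniz (hD' _)) Ii) addr0.
case: y Ly dE => [[[a u] v] x] Ex dE.
have eqz z : L z -> mul (a, u, v, x) z = extend D (lift_der D) z.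
  by move=> Lz; rewrite -dE // dE'.
have l0 : lift_der D 0 = 0.
  rewrite DE lift_add; try exact: hderA_additive.
  by rewrite !(hmap0 GM (ss_map (hder_semiskew (hD' _)))) addr0.
have := eqz _ hgrad_mem; rewrite /hgrad /= D1 l0 => -[_ Eu Ev _].
have s0 w : signed_app gM (fun=> 0) w = 0.
  exact: signed_app_zero.
rewrite !scaler0 !(osp_at0 (E_osp (Ex : E x))) !rscale1 !s0 in Eu Ev.
have u0 : u = 0 by apply: oppr_inj; rewrite oppr0 -[RHS]Eu; zmod.
have v0 : v = 0 by rewrite -[RHS]Ev; zmod.
rewrite u0 v0 in eqz Ex.
have HU w : a *: w + x w = lift_der D w.
  have Lz : L (0, w, 0, fun=> 0) by exact: E0.
  by have := eqz _ Lz; rewrite mul_deg0 //= => -[].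
have HV w : - (a *: w) + x w = lift_der D w.
  have Lz : L (0, 0, w, fun=> 0) by exact: E0.
  by have := eqz _ Lz; rewrite mul_deg0 //= => -[].
have a0 : a = 0.
  apply: scale_inj => w; rewrite scale0r; apply: (@neg_self M).
  by apply: (@addIr _ (x w)); rewrite HU HV.
have xl w : x w = lift_der D w by rewrite -HU a0 scale0r add0r.
have x0 w : x w = 0.
  rewrite (osp_sum w (E_osp (Ex : E x))).
  have x0' c : epart gM c x w = 0.
    apply: (hend_basis0 (E_hend (E_epart c (Ex : E x)) (E_hmap c (Ex : E x)))) => i Ii.
    rewrite (epart_homog _ (osp_at0 (E_osp (Ex : E x))) (homog_basis_vec Ii)).
    by rewrite xl lb // (graded_part0 GM).
  by rewrite !x0' addr0.
move=> z Lz; rewrite dE // u0 v0 mul_deg0 // a0.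
have xE : x = fun=> 0 by apply/funext.
by rewrite xE; apply: eq_Tinf => [|||w]; rewrite ?scale0r ?oppr0 ?addr0 ?sbr0l.
Qed.

Lemma DerE_semidirect : supercommutative gK -> semidirect p la L DerE adE dSE.
Proof.
move=> commK; split.
- by split; [exact: adE_subsupermodule|exact: dSset_subsupermodule].
- rewrite eqEsubset; split=> d.
    exact: DerE_decompose.
  move=> [d1 [d2 [h1 h2 dE]]]; apply: (eq_Der (fun z Lz => esym (dE z Lz))).
  by apply: (Der_add module_Einf product_Einf); [exact: adE_Der|exact: dSset_Der].
- exact: adE_dSE_disjoint.
- exact: adE_ideal.
- exact: dSset_sbr.
Qed.

End Supermodule.

Theorem corollary4p10
  (K : pzRingType) (gK : grading K)
  (A : pzRingType) (gA : grading A) (iota : {rmorphism K -> A})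
  (M : lmodType A) (gM : grading M)
  (I : set rat) (m : rat -> M) (q : M -> M -> A)
  (superK : superring gK) (commK : supercommutative gK)
  (halfK : exists h : K, h *+ 2 = 1)
  (extA : superextension gK gA iota)
  (superM : supermodule gA gM)
  (hI : I = Zidx \/ I = halfZidx)
  (basis_m : homog_basis gM I m)
  (quad_q : quadratic_form gA gM q)
  (values_q : standard_values I m q)
  (invZ : forall n : int, n != 0 -> exists y : A, inverse_of n%:~R y) :
  let E := osp_fd gA gM I m q in
  self_normalizing gA gM q E /\
  semidirect (Einf_part gA gM) (Einf_act iota) (Einf E)
    (DerEinf gA gM q gK iota E)
    (adEinf gA gM q E)
    (dSset gA gM I m q gK iota E).
Proof.
have [superA commA iota_homog] := extA.
split; first exact: E_self_normalizing.
exact: DerE_semidirect.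
Qed.
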